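(* Given $f\in\mathcal{F}_V$, if (i) $V=L^q(\Omega)$ with $q\in(1,\infty]$ and $p\in\mathcal{P}_W^{\alpha,\beta}$ ($0<\alpha<1<\beta$) with $W=L^\infty(\Omega)$, or (ii) $V=H^{-2}_*(\Omega)$ and $p\in\mathcal{P}_W^{\alpha,\beta}$ ($0<\alpha<1<\beta$) with $W=H^2(\Omega)$, then the problem $$\min_{p\in\mathcal{P}_W^{\alpha,\beta}}\mathcal{G}^\infty_p,\qquad\text{where}\quad \mathcal{G}^\infty_p:=\max_{f\in\mathcal{F}_V}\mathcal{G}^\infty_{f,p},$$ admits a solution.
   Context: Let $\Omega=(0,\pi)\times(-\ell,\ell)\subset\mathbb{R}^2$ with $\ell>0$ fixed (a narrow rectangle, $2\ell\ll\pi$; no quantitative condition is imposed) and let $\sigma\in(0,1/2)$ be fixed. Energy space: $H^2_*(\Omega)=\{u\in H^2(\Omega): u=0 \text{ on } \{0,\pi\}\times(-\ell,\ell)\}$ (functions in it are continuous on $\overline\Omega$), with scalar product $$(u,v)_{H^2_*}=\int_\Omega\big[\Delta u\,\Delta v+(1-\sigma)(2u_{xy}v_{xy}-u_{xx}v_{yy}-u_{yy}v_{xx})\big]\,dx\,dy,$$ whose norm $\|\cdot\|_{H^2_*}$ is equivalent to the usual $H^2(\Omega)$ norm on $H^2_*(\Omega)$. $H^{-2}_*(\Omega)$ is the dual of $H^2_*(\Omega)$, with duality $\langle\cdot,\cdot\rangle$ and norm $\|f\|_{H^{-2}_*}=\sup_{\|v\|_{H^2_*}=1}\langle f,v\rangle$.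 Forces: $\mathcal{F}_V=\{f\in V:\|f\|_V=1\}$. Weights: $\mathcal{P}_{L^\infty}^{\alpha,\beta}$ is the set of $p\in L^\infty(\Omega)$ with $\alpha\le p\le\beta$ a.e., $p(x,y)=p(x,-y)$ a.e. in $\Omega$, and $\int_\Omega p\,dx\,dy=|\Omega|$. For a fixed constant $\kappa>1$, $\mathcal{P}_{H^2}^{\alpha,\beta}=\{p\in H^2(\Omega): p\in\mathcal{P}_{L^\infty}^{\alpha,\beta},\ \|p\|_{H^2}\le\kappa\sqrt{|\Omega|}\}$. $\mathcal{P}_W^{\alpha,\beta}$ denotes $\mathcal{P}_{L^\infty}^{\alpha,\beta}$ if $W=L^\infty(\Omega)$ and $\mathcal{P}_{H^2}^{\alpha,\beta}$ if $W=H^2(\Omega)$. Weak problem: given $f\in V$ and $p\in\mathcal{P}_W^{\alpha,\beta}$, $u\in H^2_*(\Omega)$ is the unique solution of $(u,v)_{H^2_*}=\langle pf,v\rangle$ for all $v\in H^2_*(\Omega)$, where $\langle pf,v\rangle=\int_\Omega pfv\,dx\,dy$ if $V=L^q(\Omega)$, and $\langle pf,v\rangle:=\langle f,pv\rangle$ if $V=H^{-2}_*(\Omega)$ and $p\in\mathcal{P}_{H^2}^{\alpha,\beta}$ (note $pv\in H^2_*(\Omega)$). Gap function: $\mathcal{G}_{f,p}(x)=u(x,\ell)-u(x,-\ell)$ for $x\in[0,\pi]$, and $\mathcal{G}^\infty_{f,p}=\max_{x\in(0,\pi)}|\mathcal{G}_{f,p}(x)|$. For each fixed $p\in\mathcal{P}_W^{\alpha,\beta}$,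 the maximum over $f\in\mathcal{F}_V$ defining $\mathcal{G}^\infty_p$ is known to be attained in both cases. In the definition of $\mathcal{G}^\infty_p$ the letter $f$ is a bound variable. *)

(* Defs.v *)
From HB Require Import structures.
From mathcomp Require Import all_boot all_order all_algebra.
From mathcomp Require Import all_classical all_reals all_analysis.
Set Implicit Arguments.
Unset Strict Implicit.
Unset Printing Implicit Defensive.
Import Order.TTheory GRing.Theory Num.Theory.
Import numFieldNormedType.Exports.
Local Open Scope classical_set_scope.
Local Open Scope ring_scope.

(** Elements of L^q(Omega), H^2(Omega), ... are represented by real functions on
    the whole plane; only their a.e. class on Omega matters, and every notion
    below is invariant under modification on a null set of Omega. *)

Section plate.
Context {R : realType}.
Implicit Types (l : R) (u v w p phi : R * R -> R) (i j n : nat).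

Definition Omega l : set (R * R) := [set` `]0, pi[] `*` [set` `]- l, l[].

Lemma measurable_Omega l :
  measurable (Omega l : set (measurableTypeR R * measurableTypeR R)).
Proof. by apply: measurableX; exact: measurable_itv. Qed.

(** Two-dimensional Lebesgue measure restricted to Omega. *)
Definition dO l
    : {measure set (measurableTypeR R * measurableTypeR R) -> \bar R} :=
  mrestr (@lebesgue_measure R \x @lebesgue_measure R)%E (measurable_Omega l).

Definition area l : R := fine (dO l setT).

Definition dx phi : R * R -> R := fun z => 'D_(1, 0) phi z.
Definition dy phi : R * R -> R := fun z => 'D_(0, 1) phi z.

Fixpoint is_Cn n phi : Prop :=
  continuous phi /\
  if n is m.+1 then
    (forall z, derivable phi z (1, 0) /\ derivable phi z (0, 1)) /\
    is_Cn m (dx phi) /\ is_Cn m (dy phi)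
  else True.

Definition test_fun l phi : Prop :=
  (forall n, is_Cn n phi) /\
  exists K : set (R * R),
    [/\ compact K, K `<=` Omega l & forall z, ~ K z -> phi z = 0].

Definition is_weak_deriv l i j u w : Prop :=
  forall phi, test_fun l phi ->
    \int[dO l]_z (u z * iter i dx (iter j dy phi) z) =
    (-1) ^+ (i + j) * \int[dO l]_z (w z * phi z).

Definition H2 l : set (R * R -> R) := [set u | u \in Lfun (dO l) 2%:E /\
  forall i j, (i + j <= 2)%N ->
    exists2 w, w \in Lfun (dO l) 2%:E & is_weak_deriv l i j u w].

(** The weak derivative d^(i+j) u / dx^i dy^j (unique a.e. in Omega). *)
Definition wD l i j u : R * R -> R :=
  xget (cst 0) [set w | w \in Lfun (dO l) 2%:E /\ is_weak_deriv l i j u w].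

Definition H2_norm l u : R :=
  Num.sqrt (\sum_(i < 3) \sum_(j < 3 | (i + j <= 2)%N)
              \int[dO l]_z (wD l i j u z ^+ 2)).

(** The representative of [u] that is continuous on the closure of Omega, through
    which pointwise values of elements of H^2(Omega) are read. It exists by the
    Sobolev embedding and is unique on the closure of Omega. *)
Definition crep l u : R * R -> R :=
  xget (cst 0) [set v | {within closure (Omega l), continuous v} /\
                        {ae dO l, forall z, v z = u z}].

Definition H2s l : set (R * R -> R) := [set u | H2 l u /\
  forall y, - l < y < l -> crep l u (0, y) = 0 /\ crep l u (pi, y) = 0].

Definition H2s_dot l (sigma : R) u v : R :=
  \int[dO l]_z
    ((wD l 2 0 u z + wD l 0 2 u z) * (wD l 2 0 v z + wD l 0 2 v z)
     + (1 - sigma) * (2 * wD l 1 1 u z * wD l 1 1 v z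
                      - wD l 2 0 u z * wD l 0 2 v z
                      - wD l 0 2 u z * wD l 2 0 v z)).

Definition H2s_norm l sigma u : R := Num.sqrt (H2s_dot l sigma u u).

(** The dual of H^2_*: functionals are total on functions, but only their values
    on [H2s l] matter. Boundedness and linearity force such a functional to
    depend only on the a.e. class of its argument. *)
Definition Hm2s l sigma : set ((R * R -> R) -> R) := [set f |
  (forall (a : R) u v, H2s l u -> H2s l v ->
     f (fun z => a * u z + v z) = a * f u + f v) /\
  exists C : R, forall v, H2s l v -> `|f v| <= C * H2s_norm l sigma v].

Definition Hm2s_norm l sigma (f : (R * R -> R) -> R) : \bar R :=
  ereal_sup [set (f v)%:E | v in [set v | H2s l v /\ H2s_norm l sigma v = 1]].

Definition force_Lq l (q : \bar R) : set (R * R -> R) := [set f |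
  f \in Lfun (dO l) q /\ ('N[dO l]_q[EFin \o f] = 1)%E].

Definition force_Hm2s l sigma : set ((R * R -> R) -> R) := [set f |
  Hm2s l sigma f /\ (Hm2s_norm l sigma f = 1)%E].

Definition weight_Linfty l (alpha beta : R) : set (R * R -> R) := [set p |
  [/\ p \in Lfun (dO l) +oo%E,
      {ae dO l, forall z, alpha <= p z <= beta},
      {ae dO l, forall z, p z = p (z.1, - z.2)} &
      \int[dO l]_z p z = area l]].

Definition weight_H2 l alpha beta (kappa : R) : set (R * R -> R) := [set p |
  [/\ H2 l p, weight_Linfty l alpha beta p &
      H2_norm l p <= kappa * Num.sqrt (area l)]].

(** The functional v |-> <p f, v> in the two cases. *)
Definition load_Lq l p (f : R * R -> R) : (R * R -> R) -> R :=
  fun v => \int[dO l]_z (p z * f z * v z).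
Definition load_Hm2s p (f : (R * R -> R) -> R) : (R * R -> R) -> R :=
  fun v => f (p \* v).

(** The weak solution with right-hand side [T] (unique a.e. in Omega). *)
Definition weak_sol l sigma (T : (R * R -> R) -> R) : R * R -> R :=
  xget (cst 0) [set u | H2s l u /\
    forall v, H2s l v -> H2s_dot l sigma u v = T v].

Definition gap l sigma T (x : R) : R :=
  let u := crep l (weak_sol l sigma T) in u (x, l) - u (x, - l).

(** Maxima are written as suprema in the extended reals, so that no junk value
    can arise; the ones below are attained. *)
Definition gap_max l sigma T : \bar R :=
  ereal_sup [set `|gap l sigma T x|%:E | x in `]0, pi[].

Definition worst_gap_Lq l sigma q p : \bar R :=
  ereal_sup [set gap_max l sigma (load_Lq l p f) | f in force_Lq l q].

Definition worst_gap_Hm2s l sigma p : \bar R :=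
  ereal_sup [set gap_max l sigma (load_Hm2s p f) | f in force_Hm2s l sigma].

End plate.

(* Main.v *)
Require Import Defs.
From HB Require Import structures.
From mathcomp Require Import all_boot all_order all_algebra.
From mathcomp Require Import all_classical all_reals all_analysis.
From mathcomp Require Import measurable_realfun.
From mathcomp Require Import ring lra.
Set Implicit Arguments.
Unset Strict Implicit.
Unset Printing Implicit Defensive.
Import Order.TTheory GRing.Theory Num.Theory.
Import numFieldNormedType.Exports.
Local Open Scope classical_set_scope.
Local Open Scope ring_scope.

(** The gap at a point x is a bounded linear functional on H^2_*, so the Riesz
    representative w_x of that functional and the symmetry of the plate form give
    G_{f,p}(x) = <pf, w_x>.  Hence the worst gap is a supremum of absolute values of
    functionals that are linear in p: a convex, lower semicontinuous function of p.
    It is minimised by the direct method in a Hilbert space: in L^2 for the bounded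
    weights (all constraints survive along an a.e. convergent subsequence), and in
    H^2 for the H^2 weights, where multiplication by p is bounded on H^2_*.  Weak
    compactness is replaced by intersecting nested closed convex bounded sets.

    The facts needed about H^2 come from Fubini: a function has a square integrable
    weak x-derivative iff almost all of its horizontal slices are absolutely
    continuous.  This yields an integral representation with a kernel bounded by 1,
    hence continuous representatives, coercivity of the form under the boundary
    condition, and the estimate of products of first derivatives. *)

(** * Minimisation in semi-inner product spaces *)

(** No maximising force is ever exhibited or followed as [p] varies: a bound [r] on the worst gap is
    the conjunction, over all [f] and [x], of the bounds [|<pf, w_x>| <= r], so midpoint convexity
    and closedness of sublevel sets are checked for one pair at a time. That single pairing dictates
    the topology on [p]. With [f] integrable and [w_x] bounded, pointwise a.e. convergence of
    bounded weights is enough. With [f] in the dual of H^2_*, the product [p w_x] itself must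
    converge in H^2_*; the obstacle is the term [p_x v_x], in which neither factor is bounded.
    Elements are functions, and their derivatives are picked by choice, hence known only up to null
    sets. This is why derivatives are first exhibited explicitly and then identified by uniqueness,
    and why test functions come in countable families: a weak identity moves to almost every slice
    only if countably many tests decide it. Traces are replaced by an integral formula valid, on
    almost every horizontal line, for every abscissa, endpoints included; the boundary condition is
    read from it. *)

Section semi_inner_product.
Context {R : realType} {T : Type}.
Implicit Types (H K : set (T -> R)) (B : (T -> R) -> (T -> R) -> R)
  (u v w : T -> R) (s : nat -> T -> R).

Definition comb (a b : R) u v : T -> R := fun z => a * u z + b * v z.
Definition midpt u v := comb 2^-1 2^-1 u v.
Definition sqdist B u v := B (comb 1 (-1) u v) (comb 1 (-1) u v).

(* Elements are functions rather than a.e. classes, so [B] may be degenerate and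
   limits are not unique. *)
Record semi_ip H B : Prop := SemiIp {
  ip_lc : forall a u v, H u -> H v -> H (fun z => a * u z + v z);
  ip_lin : forall a u v w, H u -> H v -> H w ->
    B (fun z => a * u z + v z) w = a * B u w + B v w;
  ip_sym : forall u v, H u -> H v -> B u v = B v u;
  ip_ge0 : forall u, H u -> 0 <= B u u }.

Definition sqcvg B s u :=
  forall e : R, 0 < e -> exists N, forall n, (N <= n)%N -> sqdist B (s n) u < e.

Definition complete_ip H B := forall s, (forall n, H (s n)) ->
  (forall e : R, 0 < e -> exists N, forall m n, (N <= m)%N -> (N <= n)%N ->
     sqdist B (s m) (s n) < e) ->
  exists2 u, H u & sqcvg B s u.

Definition closed_ip H B K := forall s u, (forall n, K (s n)) -> H u ->
  sqcvg B s u -> K u.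

Section theory.
Context (H : set (T -> R)) (B : (T -> R) -> (T -> R) -> R).
Hypothesis ipB : semi_ip H B.

(** Closure and linearity are assumed only for [a * u + v]. Writing [b * v] as [(b - 1) * v + v]
    reaches every combination without assuming that [H] contains zero. *)
Lemma combE a b u v :
  comb a b u v = (fun z => a * u z + (fun z => (b - 1) * v z + v z) z).
Proof. by apply/funext => z; rewrite /comb; ring. Qed.

Lemma ip_comb a b u v : H u -> H v -> H (comb a b u v).
Proof. by move=> Hu Hv; rewrite combE; do 2 apply: (ip_lc ipB) => //. Qed.

Lemma ip_combl a b u v w : H u -> H v -> H w ->
  B (comb a b u v) w = a * B u w + b * B v w.
Proof.
move=> Hu Hv Hw; rewrite combE (ip_lin ipB)//; last exact: (ip_lc ipB).
by rewrite (ip_lin ipB)//; ring.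
Qed.

Lemma ip_comb2 a b u v : H u -> H v ->
  B (comb a b u v) (comb a b u v) =
  a ^+ 2 * B u u + 2 * a * b * B u v + b ^+ 2 * B v v.
Proof.
move=> Hu Hv; have Hc := ip_comb a b Hu Hv.
rewrite ip_combl// (ip_sym ipB Hu Hc) (ip_sym ipB Hv Hc) !ip_combl//.
by rewrite (ip_sym ipB Hv Hu); ring.
Qed.

Lemma sqdistE u v : H u -> H v -> sqdist B u v = B u u - 2 * B u v + B v v.
Proof. by move=> Hu Hv; rewrite /sqdist ip_comb2//; ring. Qed.

Lemma sqdist_ge0 u v : H u -> H v -> 0 <= sqdist B u v.
Proof. by move=> Hu Hv; apply: (ip_ge0 ipB); exact: ip_comb. Qed.

Lemma sqdistC u v : H u -> H v -> sqdist B u v = sqdist B v u.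
Proof. by move=> Hu Hv; rewrite !sqdistE// (ip_sym ipB Hv Hu); ring. Qed.

(** Parallelogram identity. The term [sqdist B u v / 4] forces near-minimisers towards each other
    and keeps midpoints inside balls. *)
Lemma ip_midpt u v : H u -> H v ->
  B (midpt u v) (midpt u v) = (B u u + B v v) / 2 - sqdist B u v / 4.
Proof. by move=> Hu Hv; rewrite ip_comb2// sqdistE// !expr2; lra. Qed.

(** Positivity on [d * u + v] and [d * u - v], divided by [d]. The free parameter serves in limits,
    where a small multiple of a bounded square is balanced against a large multiple of a vanishing
    one. *)
Lemma ip_young (d : R) u v : 0 < d -> H u -> H v ->
  2 * `|B u v| <= d * B u u + B v v / d.
Proof.
move=> d0 Hu Hv.
have h (e : R) : e ^+ 2 = 1 -> 0 <= d * B u u + B v v / d + 2 * e * B u v.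
  move=> e1; have := ip_ge0 ipB (ip_comb d e Hu Hv).
  rewrite ip_comb2// e1 mul1r => h; rewrite -(pmulr_rge0 _ d0).
  rewrite [X in 0 <= X](_ : _ = d ^+ 2 * B u u + 2 * d * e * B u v + B v v)//.
  by field; rewrite gt_eqF.
have := h 1 (expr1n _ _); have := h (-1) ltac:(by rewrite sqrrN expr1n).
by case: (ger0P (B u v)) => _; lra.
Qed.

Lemma ip_cs u v : H u -> H v -> B u v ^+ 2 <= B u u * B v v.
Proof.
move=> Hu Hv; have a0 := ip_ge0 ipB Hu; have c0 := ip_ge0 ipB Hv.
have quad x y := ip_ge0 ipB (ip_comb x y Hu Hv).
move: a0 c0; rewrite le_eqVlt => /predU1P[a0|a0]; last first.
  move=> _; have := quad (- B u v) (B u u); rewrite ip_comb2// => h.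
  rewrite -subr_ge0 -(pmulr_rge0 _ a0); apply: le_trans h _.
  by rewrite le_eqVlt; apply/orP; left; apply/eqP; ring.
rewrite le_eqVlt => /predU1P[c0|c0]; last first.
  have := quad (B v v) (- B u v); rewrite ip_comb2// => h.
  rewrite -subr_ge0 -(pmulr_rge0 _ c0); apply: le_trans h _.
  by rewrite le_eqVlt; apply/orP; left; apply/eqP; ring.
(* The form may vanish on nonzero functions, so no division is possible when both squares are 0;
   positivity on [u + v] and [u - v] then gives [B u v = 0]. *)
have := quad 1 1; have := quad 1 (-1); rewrite !ip_comb2// -a0 -c0 => h1 h2.
have -> : B u v = 0 by lra.
by rewrite expr0n mulr0.
Qed.

(* The parallelogram identity makes near-minimisers of the norm over the [C n] a
   Cauchy sequence; this replaces weak compactness of bounded convex sets. *)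
Lemma nested_inter (C : nat -> set (T -> R)) (M : R) :
  complete_ip H B ->
  (forall n, C n `<=` H) -> (forall n, C n !=set0) ->
  (forall m n, (m <= n)%N -> C n `<=` C m) ->
  (forall n u v, C n u -> C n v -> C n (midpt u v)) ->
  (forall n, closed_ip H B (C n)) ->
  (forall n u, C n u -> B u u <= M) ->
  exists u, forall n, C n u.
Proof.
move=> cH CH C0 dC mC clC bC.
pose E n := [set B u u | u in C n].
have E0 n : E n !=set0 by have [u Cu] := C0 n; exists (B u u); exists u.
have lbE n : has_lbound (E n).
  by exists 0 => _ [u Cu <-]; apply: (ip_ge0 ipB); exact: CH Cu.
pose d n := inf (E n).
have dM n : d n <= M.
  have [u Cu] := C0 n; apply: le_trans (bC n u Cu).
  by apply: ge_inf => //; exists u.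
have dn m n : (m <= n)%N -> d m <= d n.
  move=> mn; apply: lb_le_inf => // _ [u Cu <-].
  by apply: ge_inf => //; exists u => //; exact: dC Cu.
have ex n : exists u, C n u /\ B u u < d n + n.+1%:R^-1.
  have [] := @inf_adherent _ (E n) n.+1%:R^-1.
  - by rewrite invr_gt0 ltr0Sn.
  - by split.
  by move=> _ [u Cu <-] h; exists u.
have [s hs] := choice ex.
have Cs n : C n (s n) by have [] := hs n.
have Hs n : H (s n) by exact: CH (Cs n).
have sup_d : has_sup (range d).
  by split; [exists (d 0); exists 0 | exists M => _ [n _ <-]].
pose D := sup (range d).
have dD n : d n <= D by apply: ub_le_sup; [exact: sup_d.2|exists n].
(* Both points lie in the convex set [C m], so their midpoint has square at least [d m]; the
   parallelogram identity then bounds their distance by the gap between [d m] and the supremum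
   [D]. *)
have key m n : (m <= n)%N ->
    sqdist B (s m) (s n) <= 2 * (D - d m) + 2 * m.+1%:R^-1 + 2 * n.+1%:R^-1.
  move=> mn; have Cmid : C m (midpt (s m) (s n)).
    by apply: mC => //; exact: dC mn _ (Cs n).
  have : d m <= B (midpt (s m) (s n)) (midpt (s m) (s n)).
    by apply: ge_inf => //; exists (midpt (s m) (s n)).
  rewrite ip_midpt// => h.
  have [_ h1] := hs m; have [_ h2] := hs n; have h3 := dD n.
  move: (sqdist B _ _) (m.+1%:R^-1) (n.+1%:R^-1) h h1 h2 => q i j; lra.
have [u Hu su] : exists2 u, H u & sqcvg B s u.
  apply: cH => // e e0.
  have e4 : 0 < e / 4 by lra.
  have [_ [N1 _ <-] hN1] := sup_adherent e4 sup_d.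
  have [N2 hN2] : exists N : nat, N.+1%:R^-1 < e / 8.
    have e8 : 0 < e / 8 by lra.
    by exact: (near_infty_natSinv_lt (PosNum e8)).2 _ (leqnn _) ||
      (have [N _ /(_ N (leqnn N)) ?] := near_infty_natSinv_lt (PosNum e8); exists N).
  exists (maxn N1 N2).
  have inv k : (N2 <= k)%N -> k.+1%:R^-1 < e / 8.
    move=> h; apply: le_lt_trans hN2.
    by rewrite lef_pV2 ?posrE ?ltr0Sn// ler_nat.
  wlog mn : / forall m n, (maxn N1 N2 <= m)%N -> (m <= n)%N ->
      sqdist B (s m) (s n) < e.
    apply => m n; rewrite geq_max => /andP[m1 m2] mn.
    apply: le_lt_trans (key m n mn) _.
    have := inv m m2; have := inv n (leq_trans m2 mn).
    have := dn _ _ m1; rewrite -/D in hN1.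
    by move: (m.+1%:R^-1) (n.+1%:R^-1) => i j; lra.
  move=> m n hm hn; have [mn'|/ltnW nm] := leqP m n; first exact: mn.
  by rewrite sqdistC//; exact: mn.
(* The sequence shifted by [n] stays in [C n] and has the same limit. *)
exists u => n; apply: (clC n (fun k => s (n + k)%N)) => //.
  by move=> k; apply: (dC n (n + k)%N) => //; exact: leq_addr.
move=> e e0; have [N hN] := su e e0; exists N => k Nk; apply: hN.
exact: leq_trans Nk (leq_addl _ _).
Qed.

(** The sublevel sets at heights [inf + 1/(n+1)] are nested, and any common point is a minimiser.
    The hypotheses on [G] are phrased through sublevel sets, the form in which a supremum of many
    conditions is easy to handle. *)
Lemma min_exists K (G : (T -> R) -> \bar R) :
  complete_ip H B -> K `<=` H -> K !=set0 -> (forall u, K u -> (0 <= G u)%E) ->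
  (forall (r : R) u v, K u -> K v -> (G u <= r%:E)%E -> (G v <= r%:E)%E ->
     K (midpt u v) /\ (G (midpt u v) <= r%:E)%E) ->
  (forall r : R, closed_ip H B [set u | K u /\ (G u <= r%:E)%E]) ->
  (forall r : R, exists M : R, forall u, K u -> (G u <= r%:E)%E -> B u u <= M) ->
  exists2 u, K u & forall v, K v -> (G u <= G v)%E.
Proof.
move=> cH KH [u0 Ku0] G0 mK clK bK.
pose m := ereal_inf (G @` K).
have mG v : K v -> (m <= G v)%E by move=> Kv; apply: ereal_inf_lbound; exists v.
have m0 : (0 <= m)%E by apply: le_ereal_inf_tmp => _ [v Kv <-]; exact: G0.
(* If the infimum is infinite, [G] is constantly [+oo] on [K] and every point is a minimiser. *)
case: (eqVneq m +oo%E) => [moo|mnoo].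
  by exists u0 => // v Kv; have := mG v Kv; rewrite moo leye_eq => /eqP ->; exact: leey.
have mfin : m \is a fin_num by rewrite ge0_fin_numE// ltey.
pose r := fine m; have mr : m = r%:E by rewrite fineK.
pose C n := [set u | K u /\ (G u <= (r + n.+1%:R^-1)%:E)%E].
have [M hM] := bK (r + 1).
have C1 n u : C n u -> (G u <= (r + 1)%:E)%E.
  move=> [_ h]; apply: le_trans h _; rewrite lee_fin lerD2l invf_le1 ?ltr0Sn//.
  by rewrite ler1n.
have [u Cu] : exists u, forall n, C n u.
  apply: (@nested_inter C M) => //.
  - by move=> n u [/KH].
  - move=> n; have : (m < (r + n.+1%:R^-1)%:E)%E.
      by rewrite mr lte_fin ltrDl invr_gt0 ltr0Sn.
    by move=> /ereal_inf_lt[_ [v Kv <-]] /ltW h; exists v.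
  - move=> i j ij u [Ku h]; split => //; apply: le_trans h _.
    by rewrite lee_fin lerD2l lef_pV2 ?posrE ?ltr0Sn// ler_nat.
  - by move=> n u v [Ku Gu] [Kv Gv]; exact: mK.
  - by move=> n; exact: clK.
  - by move=> n u Cu; apply: hM; [exact: Cu.1|exact: C1 Cu].
exists u; first exact: (Cu 0).1.
move=> v Kv; apply: le_trans (mG v Kv); rewrite mr.
apply/lee_addgt0Pr => e e0.
have [N _ /(_ N (leqnn N)) hN] := near_infty_natSinv_lt (PosNum e0).
apply: le_trans (Cu N).2 _; rewrite -EFinD lee_fin lerD2l; exact: ltW.
Qed.

(* The representative minimises [B v v - 2 F v]. *)
Lemma riesz (F : (T -> R) -> R) (C : R) : complete_ip H B -> H !=set0 ->
  (forall a u v, H u -> H v -> F (fun z => a * u z + v z) = a * F u + F v) ->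
  (forall v, H v -> F v ^+ 2 <= C * B v v) -> 0 <= C ->
  exists2 u, H u & forall v, H v -> B u v = F v.
Proof.
move=> cH H0 linF bF C0.
have Fcomb a b u v : H u -> H v -> F (comb a b u v) = a * F u + b * F v.
  move=> Hu Hv; rewrite combE linF//; last exact: (ip_lc ipB).
  by rewrite linF//; ring.
have Fyoung (d : R) v : 0 < d -> H v -> 2 * `|F v| <= d * C + B v v / d.
  move=> d0 Hv; have b0 := ip_ge0 ipB Hv; have bFv := bF v Hv.
  have dB : 0 <= B v v / d by rewrite divr_ge0// ltW.
  have dC : 0 <= d * C by rewrite mulr_ge0// ltW.
  rewrite -(@ler_pXn2r _ 2)// ?nnegrE ?addr_ge0// ?mulr_ge0//.
  rewrite exprMn real_normK ?num_real//.
  apply: le_trans (_ : 4 * ((d * C) * (B v v / d)) <= _).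
    rewrite (_ : d * C * (B v v / d) = C * B v v); last by field; rewrite gt_eqF.
    by rewrite (_ : 2 ^+ 2 = 4 :> R) ?ler_pM2l//; ring.
  rewrite -subr_ge0.
  rewrite (_ : _ - _ = (d * C - B v v / d) ^+ 2); first exact: sqr_ge0.
  by ring.
pose J v := B v v - 2 * F v.
have J_bound v : H v -> B v v <= 2 * J v + 4 * C.
  move=> Hv; have := @Fyoung 2 v ltac:(by []) Hv; rewrite /J.
  by have := ler_norm (F v); lra.
(* By [J_bound], the shift by [2 * C] makes the functional nonnegative, as [min_exists] asks. *)
have [u Hu minu] : exists2 u, H u & forall v, H v -> ((J u + 2 * C)%:E <= (J v + 2 * C)%:E)%E.
  apply: (@min_exists H (fun v => (J v + 2 * C)%:E)) => //.
  - move=> u Hu; rewrite lee_fin.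
    by have := J_bound u Hu; have := ip_ge0 ipB Hu; lra.
  - move=> r u v Hu Hv; rewrite !lee_fin => hu hv; split; first exact: ip_comb.
    have := sqdist_ge0 Hu Hv; rewrite /J Fcomb// ip_midpt//.
    by move: hu hv; rewrite /J; lra.
  - move=> r s u hs Hu su; split => //; rewrite lee_fin.
    pose M := 2 * r.
    have Hs n : H (s n) by have [] := hs n.
    have Js n : J (s n) + 2 * C <= r by have [_] := hs n; rewrite lee_fin.
    have Ms n : B (s n) (s n) <= M.
      by have := J_bound _ (Hs n); have := Js n; rewrite /M; lra.
    have M0 : 0 <= M by apply: le_trans (ip_ge0 ipB (Hs 0%N)) (Ms 0%N).
    apply/ler_addgt0Pr => e e0.
    (* First [d] makes [d * (M + C)] at most [e / 2]; then the distance to the limit is taken so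
       small that the terms divided by [d] use up the other half. *)
    pose d := e / 2 / (M + C + 1).
    have d0 : 0 < d by rewrite divr_gt0//; lra.
    have e'0 : 0 < e / 2 / (1 + 2 / d).
      by rewrite divr_gt0 ?ltr_pwDl//; [lra|rewrite divr_ge0// ltW].
    have [N /(_ N (leqnn N)) hN] := su _ e'0.
    pose w := comb 1 (-1) (s N) u.
    have Hw : H w by exact: ip_comb.
    have wE : sqdist B (s N) u = B w w by [].
    rewrite wE in hN.
    have Buw : B u u = B (s N) (s N) - 2 * B (s N) w + B w w.
      rewrite -[X in X = _](_ : B (comb 1 (-1) (s N) w) (comb 1 (-1) (s N) w) = _).
        by rewrite ip_comb2//; ring.
      by congr B; apply/funext => z; rewrite /w /comb; ring.
    have Fw : F w = F (s N) - F u by rewrite Fcomb//; ring.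
    have y1 := ip_young d0 (Hs N) Hw; have y2 := Fyoung d w d0 Hw.
    have t1 : d * B (s N) (s N) <= d * M by rewrite ler_pM2l.
    have t2 : d * (M + C) <= e / 2.
      rewrite -[leRHS](@divfK _ (M + C + 1)); last by rewrite gt_eqF//; lra.
      by rewrite -/d ler_pM2l//; lra.
    have t3 : B w w * (1 + 2 / d) <= e / 2.
      by rewrite -ler_pdivlMr ?(ltW hN)// ltr_pwDl// divr_ge0// ltW.
    have n1 := ler_norm (- B (s N) w); rewrite normrN in n1.
    have n2 := ler_norm (F w).
    have t3' : B w w + 2 * (B w w / d) <= e / 2.
      by apply: le_trans t3; rewrite mulrDr mulr1 mulrCA.
    rewrite mulrDr in t2.
    have := Js N; rewrite /J Buw (_ : F u = F (s N) - F w); last by rewrite Fw; ring.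
    move: (B w w / d) (d * B (s N) (s N)) t1 y1 y2 t3' => q1 q2.
    move: (d * M) (d * C) t2 => q3 q4; lra.
  - move=> r; exists (2 * r) => v Hv; rewrite lee_fin => h.
    by have := J_bound v Hv; lra.
exists u => // v Hv.
pose x := B u v - F v; pose b := B v v.
have b0 : 0 <= b := ip_ge0 ipB Hv.
(* The optimal step would be [- x / b], but [b] may vanish. With [b + 1] the variation is still a
   negative multiple of [x ^+ 2], which minimality forbids unless [x = 0]. *)
pose t := - x / (b + 1).
have := minu _ (ip_comb 1 t Hu Hv); rewrite lee_fin /J Fcomb// ip_comb2//.
rewrite -/b => h.
have h2 : 0 <= 2 * t * x + t ^+ 2 * b by rewrite /x; lra.
have bn0 : b + 1 != 0 by rewrite gt_eqF//; lra.
have : 2 * t * x + t ^+ 2 * b = - (x ^+ 2 * ((b + 2) / (b + 1) ^+ 2)).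
  by rewrite /t; field.
move=> h3; rewrite h3 oppr_ge0 in h2.
have : x ^+ 2 <= 0.
  rewrite -(@pmulr_lle0 _ ((b + 2) / (b + 1) ^+ 2))//.
  by rewrite divr_gt0 ?exprn_gt0//; lra.
by rewrite real_exprn_even_le0 ?num_real//= subr_eq0 => /eqP.
Qed.

End theory.
End semi_inner_product.

Section sqcvg_theory.
Context {R : realType} {T : Type} (H : set (T -> R)) (B : (T -> R) -> (T -> R) -> R).
Hypothesis ipB : semi_ip H B.
Implicit Types (u v w : T -> R).

Lemma sqdist_triangle u v w : H u -> H v -> H w ->
  sqdist B u v <= 2 * sqdist B u w + 2 * sqdist B v w.
Proof.
move=> Hu Hv Hw; rewrite !(sqdistE ipB)//.
have := ip_ge0 ipB (ip_comb ipB 1 1 (ip_comb ipB 1 (-1) Hu Hw) (ip_comb ipB 1 (-1) Hv Hw)).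
have -> : comb 1 1 (comb 1 (-1) u w) (comb 1 (-1) v w) = comb 1 (-2) (comb 1 1 u v) w.
  by apply/funext => z; rewrite /comb; ring.
have Huv := ip_comb ipB 1 1 Hu Hv.
rewrite (ip_comb2 ipB)// (ip_comb2 ipB)// (ip_combl ipB)//.
move: (B u u) (B v v) (B w w) (B u v) (B u w) (B v w) => x1 x2 x3 x4 x5 x6; lra.
Qed.

Lemma sqcvg_cauchy s u : (forall n, H (s n)) -> H u -> sqcvg B s u ->
  forall e : R, 0 < e -> exists N, forall m n, (N <= m)%N -> (N <= n)%N ->
    sqdist B (s m) (s n) < e.
Proof.
move=> Hs Hu su e e0; have [N hN] := su _ (divr_gt0 e0 (ltr0Sn _ 3)).
exists N => m n Nm Nn; apply: le_lt_trans (sqdist_triangle (Hs m) (Hs n) Hu) _.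
have := hN m Nm; have := hN n Nn; lra.
Qed.

Lemma sqcvg_unique s u v : (forall n, H (s n)) -> H u -> H v -> sqcvg B s u -> sqcvg B s v ->
  sqdist B u v = 0.
Proof.
move=> Hs Hu Hv su sv; apply/eqP; rewrite eq_le (sqdist_ge0 ipB)// andbT.
apply/ler_addgt0Pr => e e0; rewrite add0r; have e4 := divr_gt0 e0 (ltr0Sn _ 3).
have [N1 h1] := su _ e4; have [N2 h2] := sv _ e4; pose n := maxn N1 N2.
apply: le_trans (sqdist_triangle Hu Hv (Hs n)) _.
have := h1 n (leq_maxl _ _); have := h2 n (leq_maxr _ _).
by rewrite (sqdistC ipB (Hs n) Hu) (sqdistC ipB (Hs n) Hv); lra.
Qed.

(** Closed balls are closed: expand the square of [s N - w] with [w = s N - u] and absorb the cross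
    term by [ip_young]. It preserves the H^2 norm constraint on weights. *)
Lemma sqcvg_bound s u M : (forall n, H (s n)) -> H u -> sqcvg B s u ->
  (forall n, B (s n) (s n) <= M) -> B u u <= M.
Proof.
move=> Hs Hu su sM; have M0 : 0 <= M := le_trans (ip_ge0 ipB (Hs 0%N)) (sM 0%N).
apply/ler_addgt0Pr => e e0; have [d d0 dM] : exists2 d, 0 < d & d * M <= e / 2.
  exists (e / 2 / (M + 1)); first by rewrite !divr_gt0//; lra.
  by rewrite mulrAC ler_pdivrMr; [rewrite ler_wpM2l//; lra|lra].
have e'0 : 0 < e / 2 / (1 + d^-1) by rewrite !divr_gt0// addr_gt0// invr_gt0.
have [N /(_ N (leqnn N))] := su _ e'0; set w := comb 1 (-1) (s N) u.
have Hw : H w by exact: (ip_comb ipB).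
have -> : sqdist B (s N) u = B w w by [].
have -> : B u u = B (s N) (s N) - 2 * B (s N) w + B w w.
  have -> : B u u = B (comb 1 (-1) (s N) w) (comb 1 (-1) (s N) w).
    by congr B; apply/funext => z; rewrite /w /comb; ring.
  by rewrite (ip_comb2 ipB)//; ring.
have := ip_young ipB d0 (Hs N) Hw; have := ler_norm (- B (s N) w); rewrite normrN.
have h1 := ler_wpM2l (ltW d0) (sM N).
move=> h2 h3; rewrite ltr_pdivlMr ?addr_gt0 ?invr_gt0// mulrDr mulr1.
have aux (x1 x2 x3 x4 x5 x6 x7 : R) : x1 <= x2 -> - x3 <= x4 -> 2 * x4 <= x1 + x5 ->
    x2 <= e / 2 -> x6 <= M -> x7 + x5 < e / 2 -> x6 - 2 * x3 + x7 <= M + e by lra.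
exact: aux h1 h2 h3 dM (sM N).
Qed.

End sqcvg_theory.

(** * Real-valued integrals and L2 *)

Section real_integral.
Context d (T : measurableType d) (R : realType).
Context (mu : {measure set T -> \bar R}).
Implicit Types f g h : T -> R.

Definition mint f := mu.-integrable [set: T] (EFin \o f).

Lemma mint_measurable f : mint f -> measurable_fun [set: T] f.
Proof. by move=> /measurable_int/measurable_EFinP. Qed.

Lemma mint_lin a f g : mint f -> mint g -> mint (fun z => a * f z + g z).
Proof.
move=> mf mg.
exact: (integrableD measurableT (integrableZl measurableT a mf) mg).
Qed.

Lemma mintZ a f : mint f -> mint (fun z => a * f z).
Proof. by move=> mf; exact: (integrableZl measurableT a mf). Qed.

Lemma mintD f g : mint f -> mint g -> mint (fun z => f z + g z).
Proof. by move=> mf mg; exact: (integrableD measurableT mf mg). Qed.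

Lemma mintB f g : mint f -> mint g -> mint (fun z => f z - g z).
Proof. by move=> mf mg; exact: (integrableB measurableT mf mg). Qed.

Lemma mint_norm f : mint f -> mint (fun z => `|f z|).
Proof. by move=> mf; exact: (integrable_norm mf). Qed.

Lemma mint_le f g : measurable_fun [set: T] f -> mint g ->
  (forall z, `|f z| <= g z) -> mint f.
Proof.
move=> mf mg fg; apply: le_integrable mg => //; first exact/measurable_EFinP.
by move=> z _; rewrite lee_fin (le_trans (fg z))// ler_norm.
Qed.

Lemma mint_mul_bounded (M : R) f g : measurable_fun [set: T] f ->
  (forall z, `|f z| <= M) -> mint g -> mint (fun z => f z * g z).
Proof.
move=> mf fM mg; apply: (@mint_le _ (fun z => M * `|g z|)).
- by apply: measurable_funM => //; exact: mint_measurable.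
- by apply: mintZ; exact: mint_norm.
- by move=> z; rewrite normrM ler_wpM2r.
Qed.

Lemma Rint_lin a f g : mint f -> mint g ->
  \int[mu]_z (a * f z + g z) = a * \int[mu]_z f z + \int[mu]_z g z.
Proof.
by move=> mf mg; rewrite RintegralD//; [rewrite RintegralZl|exact: mintZ].
Qed.

Lemma Rint_ae_eq f g : measurable_fun [set: T] f -> measurable_fun [set: T] g ->
  {ae mu, forall z, f z = g z} -> \int[mu]_z f z = \int[mu]_z g z.
Proof.
move=> mf mg fg; congr fine; apply: ae_eq_integral => //; try exact/measurable_EFinP.
by apply: filterS fg => z /= -> _.
Qed.

Lemma ae_eq_mint f g : measurable_fun [set: T] g -> {ae mu, forall z, f z = g z} ->
  mint f -> mint g.
Proof.
move=> mg fg /integrableP[mf foo]; apply/integrableP; split.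
  exact/measurable_EFinP.
apply: le_lt_trans foo; rewrite le_eqVlt; apply/orP; left; apply/eqP.
apply: ae_eq_integral => //; [|exact: measurableT_comp|].
  by apply: measurableT_comp => //; exact/measurable_EFinP.
by apply: filterS fg => z /= -> _.
Qed.

Lemma Rint_ae_le f g : mint f -> mint g ->
  {ae mu, forall z, f z <= g z} -> \int[mu]_z f z <= \int[mu]_z g z.
Proof.
move=> mf mg fg; have mf' := mint_measurable mf; have mg' := mint_measurable mg.
(* Replacing [g] by the a.e. equal function [max f g] turns the a.e. inequality into a pointwise
   one. *)
have mm : measurable_fun [set: T] (fun z => Num.max (f z) (g z)).
  exact: measurable_maxr.
have mgE : {ae mu, forall z, g z = Num.max (f z) (g z)}.
  by apply: filterS fg => z h; rewrite max_r.
rewrite (Rint_ae_eq mg' mm mgE); apply: le_Rintegral => //.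
  exact: ae_eq_mint mm mgE mg.
by move=> z _; rewrite le_max lexx.
Qed.

Lemma mint_ae_le f g : measurable_fun [set: T] f -> mint g ->
  {ae mu, forall z, `|f z| <= g z} -> mint f.
Proof.
move=> mf mg fg; have mg' := mint_measurable mg.
have mm : measurable_fun [set: T] (fun z => Num.max `|f z| (g z)).
  by apply: measurable_maxr => //; exact: measurableT_comp.
have mgE : {ae mu, forall z, g z = Num.max `|f z| (g z)}.
  by apply: filterS fg => z h; rewrite max_r.
apply: (mint_le mf (ae_eq_mint mm mgE mg)).
by move=> z; rewrite le_max lexx.
Qed.

Lemma Rint_eq0 f : mint f -> (forall z, 0 <= f z) -> \int[mu]_z f z = 0 ->
  {ae mu, forall z, f z = 0}.
Proof.
move=> mf f0 If; have mf' := mint_measurable mf.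
have /(ae_eq_integral_abs mu measurableT _).1 : (\int[mu]_z `|(f z)%:E| = 0)%E.
  under eq_integral do rewrite gee0_abs ?lee_fin//.
  by rewrite -[LHS]fineK ?integrable_fin_num//; congr EFin.
by move=> h; apply: filterS (h (proj2 (measurable_EFinP _ _) mf')) => z /= /(_ I) [].
Qed.

Lemma Rint_cvg (f_ : nat -> T -> R) f g : (forall n, measurable_fun [set: T] (f_ n)) ->
  measurable_fun [set: T] f ->
  {ae mu, forall z, f_ ^~ z @ \oo --> f z} -> mint g ->
  (forall n, {ae mu, forall z, `|f_ n z| <= g z}) ->
  \int[mu]_z f_ n z @[n --> \oo] --> \int[mu]_z f z.
Proof.
move=> mf_ mf ff mg fg.
have [] := @dominated_convergence _ T R mu setT measurableT (fun n => EFin \o f_ n)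
   (EFin \o f) (EFin \o g) _ _ _ mg _.
- by move=> n; exact/measurable_EFinP.
- exact/measurable_EFinP.
- by apply: filterS ff => z h _; apply: cvg_EFin => //; exact: nearW.
- by apply: filterS (ae_foralln fg) => z h n _; rewrite lee_fin.
move=> if_ _ h; apply: fine_cvg; rewrite fineK; last exact: integrable_fin_num.
exact: h.
Qed.

End real_integral.

Section L2.
Context d (T : measurableType d) (R : realType).
Context (mu : {finite_measure set T -> \bar R}).
Implicit Types (f g h : T -> R) (s : nat -> T -> R).

Definition L2 : set (T -> R) := [set f | f \in Lfun mu 2%:E].
Definition ip2 f g := \int[mu]_z (f z * g z).
Definition mass := fine (mu setT).

Lemma mass_ge0 : 0 <= mass.
Proof. by rewrite fine_ge0. Qed.

Lemma mint_cst c : mint mu (fun=> c).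
Proof. exact: finite_measure_integrable_cst. Qed.

Lemma L2P f : L2 f <-> measurable_fun [set: T] f /\ mint mu (fun z => f z ^+ 2).
Proof.
split=> [Lf|[mf If]].
  split; last exact: Lfun2_integrable_sqr.
  by move: Lf; rewrite /L2/= inE => /andP[]; rewrite inE.
rewrite /L2/= inE; apply/andP; split; rewrite inE//=.
rewrite /finite_norm unlock poweR_lty//.
under eq_integral do rewrite /= powR_mulrn// real_normK ?num_real//.
exact: integrable_lty.
Qed.

Lemma L2_measurable f : L2 f -> measurable_fun [set: T] f.
Proof. by move=> /L2P[]. Qed.

Lemma L2_mint_mul f g : L2 f -> L2 g -> mint mu (fun z => f z * g z).
Proof. by move=> Lf Lg; have /Lfun1_integrable := Lfun2_mul_Lfun1 Lf Lg. Qed.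

Lemma L2_cst c : L2 (fun=> c).
Proof. exact: Lfun_cst. Qed.

Lemma L2_mint f : L2 f -> mint mu f.
Proof.
move=> Lf; have := L2_mint_mul (L2_cst 1) Lf.
by congr (mint _ _); apply/funext => z; rewrite mul1r.
Qed.

Lemma L2_le f g : measurable_fun [set: T] f -> L2 g ->
  {ae mu, forall z, `|f z| <= `|g z|} -> L2 f.
Proof.
move=> mf /L2P[mg Ig] fg; apply/L2P; split => //.
apply: (mint_ae_le _ Ig); first exact: measurable_funX.
apply: filterS fg => z h; rewrite ger0_norm ?sqr_ge0//.
by rewrite -(real_normK (num_real (f z))) -(real_normK (num_real (g z))) lerXn2r ?nnegrE.
Qed.

Lemma L2_lin a f g : L2 f -> L2 g -> L2 (fun z => a * f z + g z).
Proof.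
move=> Lf Lg; have mf := L2_measurable Lf; have mg := L2_measurable Lg.
apply/L2P; split.
  by apply: measurable_funD => //; exact: measurable_funM.
have := mint_lin (a ^+ 2) (L2_mint_mul Lf Lf)
  (mint_lin (2 * a) (L2_mint_mul Lf Lg) (L2_mint_mul Lg Lg)).
by congr (mint _ _); apply/funext => z; ring.
Qed.

Lemma L2_ip : semi_ip L2 ip2.
Proof.
split.
- exact: L2_lin.
- move=> a u v w Lu Lv Lw; rewrite /ip2.
  rewrite -Rint_lin; [|exact: L2_mint_mul..].
  by apply: eq_Rintegral => z _; ring.
- by move=> u v Lu Lv; apply: eq_Rintegral => z _; rewrite mulrC.
- by move=> u Lu; apply: Rintegral_ge0 => z _; rewrite -expr2 sqr_ge0.
Qed.

Lemma L2_mul_bounded (M : R) f g : measurable_fun [set: T] f ->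
  {ae mu, forall z, `|f z| <= M} -> L2 g -> L2 (fun z => f z * g z).
Proof.
move=> mf fM Lg; apply: (@L2_le _ (fun z => M * g z + 0)).
- by apply: measurable_funM => //; exact: L2_measurable.
- by apply: L2_lin => //; exact: L2_cst.
- apply: filterS fM => z h; rewrite addr0 !normrM ler_wpM2r// (le_trans h)//.
  exact: ler_norm.
Qed.

(** Cauchy-Schwarz against the constant 1. *)
Lemma sqr_L1_le f : L2 f -> (\int[mu]_z `|f z|) ^+ 2 <= mass * ip2 f f.
Proof.
move=> Lf; have mf := L2_measurable Lf.
have Lnf : L2 (fun z => `|f z|).
  apply: L2_le Lf _; first exact: measurableT_comp.
  by apply: aeW => z /=; rewrite normr_id.
have -> : mass = ip2 (fun=> 1) (fun=> 1).
  by rewrite /ip2 Rintegral_cst// mulr1 mul1r.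
have -> : ip2 f f = ip2 (fun z => `|f z|) (fun z => `|f z|).
  by apply: eq_Rintegral => z _; rewrite -expr2 -(real_normK (num_real _)) expr2.
have -> : \int[mu]_z `|f z| = ip2 (fun=> 1) (fun z => `|f z|).
  by apply: eq_Rintegral => z _; rewrite mul1r.
exact: (ip_cs L2_ip (L2_cst 1) Lnf).
Qed.

Lemma ip2_ae_eq f f' g g' : L2 f -> L2 f' -> L2 g -> L2 g' ->
  {ae mu, forall z, f z = f' z} -> {ae mu, forall z, g z = g' z} ->
  ip2 f g = ip2 f' g'.
Proof.
move=> Lf Lf' Lg Lg' ff' gg'; apply: Rint_ae_eq.
- by apply: measurable_funM; exact: L2_measurable.
- by apply: measurable_funM; exact: L2_measurable.
- by apply: filterS2 ff' gg' => z -> ->.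
Qed.

Lemma ip2_eq0 f : L2 f -> ip2 f f = 0 -> {ae mu, forall z, f z = 0}.
Proof.
move=> Lf f0; have := @Rint_eq0 _ _ _ mu (fun z => f z * f z) (L2_mint_mul Lf Lf) _ f0.
move=> /(_ (fun z => _)) h; apply: filterS (h _) => [z /eqP|z].
  by rewrite mulf_eq0 orbb => /eqP.
by rewrite -expr2 sqr_ge0.
Qed.

End L2.

(** * Fatou's lemma and the completeness of L2 *)

Section fatou_bounds.
Context d (T : measurableType d) (R : realType).
Context (mu : {measure set T -> \bar R}).
Context (F : nat -> T -> R) (C : R) (K : nat).
Hypothesis iF : forall n, mint mu (F n).
Hypothesis F0 : forall n z, 0 <= F n z.
Hypothesis FC : forall n, (K <= n)%N -> \int[mu]_z F n z <= C.

Let L z := limn_einf (fun n => (F n z)%:E).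

Let mL : measurable_fun setT L.
Proof.
rewrite (_ : L = fun z => - limn_esup (fun n => (- F n z)%:E))%E; last first.
  apply/funext => z; rewrite /L -limn_einfN; congr limn_einf.
  by apply/funext => n; rewrite /= opprK.
apply: measurableT_comp => //; apply: measurable_fun_limn_esup => n.
apply/measurable_EFinP; apply: measurableT_comp => //.
exact: (mint_measurable (iF n)).
Qed.

Let L0 z : (0 <= L z)%E.
Proof.
rewrite /L limn_einf_lim; apply: lime_ge; first exact: is_cvg_einfs.
apply: nearW => n; apply: le_ereal_inf_tmp => _ [m _ <-].
by rewrite lee_fin.
Qed.

Let fatouL : (\int[mu]_z L z <= C%:E)%E.
Proof.
apply: le_trans (fatou mu measurableT _ _) _.
- by move=> n; exact: measurable_int (iF n).
- by move=> n z _; rewrite lee_fin.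
rewrite limn_einf_lim; apply: lime_le; first exact: is_cvg_einfs.
exists K => // n /= Kn; apply: (@le_trans _ _ (\int[mu]_z (F n z)%:E)%E).
  by apply: ereal_inf_lbound; exists n => /=.
rewrite -[leLHS]fineK; last exact: integrable_fin_num (iF n).
by rewrite lee_fin; exact: FC.
Qed.

(** By Fatou the lower limit has integral at most [C], so it is finite a.e. Applied to partial sums
    of absolute increments, it yields a.e. convergence of a series. *)
Lemma fatou_ae_lty :
  {ae mu, forall z, (limn_einf (fun n => (F n z)%:E) < +oo)%E}.
Proof.
have iL : mu.-integrable setT L.
  apply/integrableP; split => //.
  rewrite (eq_integral L) => [|z _]; last by rewrite gee0_abs.
  by apply: le_lt_trans fatouL _; rewrite ltry.
have := integrable_ae measurableT iL; apply: filterS => z /(_ I).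
by rewrite ge0_fin_numE.
Qed.

Lemma fatou_mint (f : T -> R) : measurable_fun setT f ->
  {ae mu, forall z, F ^~ z @ \oo --> f z} -> mint mu f /\ \int[mu]_z f z <= C.
Proof.
move=> mf Ff.
have LE : {ae mu, forall z, L z = (f z)%:E}.
  apply: filterS Ff => z Ff; rewrite /L.
  have Ff' : (fun n => (F n z)%:E) @ \oo --> (f z)%:E.
    by apply: cvg_EFin => //; exact: nearW.
  by have [-> _] := cvg_limn_einf_sup Ff'.
have f0 : {ae mu, forall z, 0 <= f z}.
  by apply: filterS LE => z h; rewrite -lee_fin -h.
have mfE : measurable_fun setT (EFin \o f) by exact/measurable_EFinP.
have iabs : (\int[mu]_z `|(f z)%:E| <= C%:E)%E.
  apply: le_trans fatouL; rewrite le_eqVlt; apply/orP; left; apply/eqP.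
  apply: ge0_ae_eq_integral => //; first exact: measurableT_comp.
  by apply: filterS LE => z h _; rewrite -h gee0_abs.
have If : mint mu f.
  by apply/integrableP; split => //; apply: le_lt_trans iabs _; rewrite ltry.
split=> //; rewrite -lee_fin fineK; last exact: integrable_fin_num.
apply: le_trans (le_trans _ iabs); first exact: lexx.
apply: le_integral => //; first exact: integrable_abse.
by move=> z _; exact: lee_abs.
Qed.

End fatou_bounds.

Section L2_complete.
Context d (T : measurableType d) (R : realType).
Context (mu : {finite_measure set T -> \bar R}).

(** Riesz-Fischer: a fast subsequence has absolute increments of summable integral, so it converges
    a.e., and Fatou brings the whole sequence to the same limit in L2. The subsequence stays in the
    statement because the pointwise constraints on weights pass to the limit along it. *)
Lemma L2_complete_ae (s : nat -> T -> R) : (forall n, L2 mu (s n)) ->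
  (forall e : R, 0 < e -> exists N, forall m n, (N <= m)%N -> (N <= n)%N ->
     sqdist (ip2 mu) (s m) (s n) < e) ->
  exists f, [/\ L2 mu f, sqcvg (ip2 mu) s f & exists g : nat -> nat,
    (forall k, (k <= g k)%N) /\ {ae mu, forall z, s (g n) z @[n --> \oo] --> f z}].
Proof.
move=> Ls cs; have ipL := L2_ip mu.
have half0 k : 0 < (4^-1 : R) ^+ k by rewrite exprn_gt0.
have [N hN] := choice (fun k => cs _ (half0 k)).
(* A sum of successors is at once nondecreasing in [k], above every [N i] with [i <= k], and at
   least [k]. *)
pose M k := (\sum_(i < k.+1) (N i).+1)%N.
have MN k : (N k <= M k)%N.
  rewrite /M big_ord_recr/=; apply: leq_trans (leq_addl _ _).
  exact: leqnSn.
have Mmono k : (M k <= M k.+1)%N by rewrite /M [leqRHS]big_ord_recr/= leq_addr.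
have Mle i j : (i <= j)%N -> (M i <= M j)%N.
  by move=> ij; rewrite -(subnK ij); elim: (j - i)%N => //= n ih; apply: leq_trans ih (Mmono _).
have Mge k : (k <= M k)%N.
  elim: k => // k ih; rewrite /M big_ord_recr/= addnS ltnS.
  exact: leq_trans ih (leq_addr _ _).
(* [c] stands for the square root of the mass: [mass mu <= c ^+ 2] is all that the bound [he]
   needs. *)
pose g k := s (M k); pose c := mass mu + 1.
have m0 := mass_ge0 mu; have c0 : 0 < c by rewrite /c; lra.
pose e k z : R := `|g k.+1 z - g k z|.
have Lg k : L2 mu (g k) by exact: Ls.
have Ldiff k : L2 mu (fun z => g k.+1 z - g k z).
  have := L2_lin (-1) (Lg k) (Lg k.+1).
  by congr (L2 _ _); apply/funext => z; ring.
have ie k : mint mu (e k) by apply: mint_norm; exact: L2_mint.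
have he k : \int[mu]_z e k z <= c * 2^-1 ^+ k.
  rewrite -(@ler_pXn2r _ 2)// ?nnegrE; last 2 first.
    by apply: Rintegral_ge0 => z _; rewrite normr_ge0.
    by rewrite mulr_ge0 ?exprn_ge0// ltW.
  apply: le_trans (sqr_L1_le (Ldiff k)) _.
  have -> : ip2 mu (fun z => g k.+1 z - g k z) (fun z => g k.+1 z - g k z) =
      sqdist (ip2 mu) (g k.+1) (g k).
    by rewrite /sqdist; congr (ip2 mu _ _); apply/funext => z; rewrite /comb; ring.
  apply: (@le_trans _ _ (mass mu * 4^-1 ^+ k)).
    apply: ler_wpM2l => //; apply: ltW; apply: hN; last exact: MN.
    exact: leq_trans (MN _) (Mmono _).
  rewrite exprMn -exprM mulnC exprM (_ : 2^-1 ^+ 2 = 4^-1 :> R); last by field.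
  by apply: ler_wpM2r; [exact: ltW|rewrite /c; nra].
pose h n z : R := \sum_(0 <= k < n) e k z.
have ih n : mint mu (h n).
  rewrite /h; elim: n => [|n IH].
    rewrite (_ : (fun z => _) = fun=> 0); first exact: mint_cst.
    by apply/funext => z; rewrite big_geq.
  rewrite (_ : (fun z => _) = fun z => \sum_(0 <= k < n) e k z + e n z).
    exact: mintD.
  by apply/funext => z; rewrite big_nat_recr.
have hC n : \int[mu]_z h n z <= 2 * c.
  suff -> : \int[mu]_z h n z = \sum_(0 <= k < n) \int[mu]_z e k z.
    apply: (@le_trans _ _ (\sum_(0 <= k < n) c * 2^-1 ^+ k)).
      by apply: ler_sum => k _; exact: he.
    have : \sum_(0 <= k < n) c * 2^-1 ^+ k + 2 * c * 2^-1 ^+ n = 2 * c.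
      elim: n => [|n IH]; first by rewrite big_geq// expr0; ring.
      by rewrite big_nat_recr//= -[RHS]IH exprS; field.
    have := exprn_gt0 n (_ : 0 < 2^-1 :> R); rewrite invr_gt0 => /(_ ltac:(by [])) q0.
    by have : 0 < 2 * c * 2^-1 ^+ n; [rewrite !mulr_gt0|lra].
  elim: n => [|n IH].
    by rewrite big_geq//; under eq_Rintegral do rewrite /h big_geq//; rewrite Rintegral_cst// mul0r.
  rewrite big_nat_recr//= -IH -RintegralD//; [|exact: ih|exact: ie].
  by apply: eq_Rintegral => z _; rewrite /h big_nat_recr.
have h0 n z : 0 <= h n z by apply: sumr_ge0 => k _; exact: normr_ge0.
have aelty := fatou_ae_lty ih h0 (fun n (_ : (0 <= n)%N) => hC n).
(* The upper limit is total and measurable, and is the limit wherever the subsequence converges. *)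
pose f z := fine (limn_esup (fun k => (g k z)%:E)).
have gf : {ae mu, forall z, g ^~ z @ \oo --> f z}.
  apply: filterS aelty => z hlty.
  have hmono : nondecreasing_seq (h ^~ z).
    apply/nondecreasing_seqP => n; rewrite /h big_nat_recr//= lerDl.
    exact: normr_ge0.
  have cvgh : cvgn (series (e ^~ z)).
    apply: nondecreasing_is_cvgn; first exact: hmono.
    have hcvg : (fun n => (h n z)%:E) @ \oo --> ereal_sup (range (fun n => (h n z)%:E)).
      by apply: ereal_nondecreasing_cvgn => i j ij; rewrite lee_fin; exact: hmono.
    have [E _] := cvg_limn_einf_sup hcvg; rewrite E in hlty.
    exists (fine (ereal_sup (range (fun n => (h n z)%:E)))) => _ [n _ <-].
    rewrite -lee_fin fineK; first by apply: ereal_sup_ubound; exists n.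
    rewrite ge0_fin_numE//; apply: (@le_trans _ _ (h 0%N z)%:E); first by rewrite lee_fin.
    by apply: ereal_sup_ubound; exists 0%N.
  have cg : cvgn (g ^~ z).
    have := @normed_cvg R R (fun k => g k.+1 z - g k z) cvgh.
    move=> /cvg_ex[l hl]; apply/cvg_ex; exists (l + g 0%N z).
    rewrite (_ : g ^~ z = fun n => series (fun k => g k.+1 z - g k z) n + g 0%N z).
      by apply: cvgD => //; exact: cvg_cst.
    by apply/funext => n; rewrite /series/= telescope_sumr// subrK.
  move/cvg_ex : cg => [l hl]; rewrite /f.
  have hl' : (fun k => (g k z)%:E) @ \oo --> l%:E.
    by apply: cvg_EFin => //; exact: nearW.
  by have [_ ->] := cvg_limn_einf_sup hl'.
have mf : measurable_fun setT f.
  apply: measurableT_comp => //.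
  apply: measurable_fun_limn_esup => k; apply/measurable_EFinP.
  exact: L2_measurable (Lg k).
(* Fatou in [k] for [(s n - g k) ^+ 2], whose integral is below [4^-1 ^+ j] from [k = j] on. *)
have key j n : (N j <= n)%N -> mint mu (fun z => (s n z - f z) ^+ 2) /\
    \int[mu]_z (s n z - f z) ^+ 2 <= 4^-1 ^+ j.
  move=> jn.
  have sqE k z : (s n z - g k z) ^+ 2 = comb 1 (-1) (s n) (g k) z * comb 1 (-1) (s n) (g k) z.
    by rewrite /comb; ring.
  have Lc k : L2 mu (comb 1 (-1) (s n) (g k)) by apply: (ip_comb ipL).
  apply: (@fatou_mint _ _ _ mu (fun k z => (s n z - g k z) ^+ 2) _ j).
  - by move=> k; under eq_fun do rewrite sqE; exact: L2_mint_mul.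
  - by move=> k z; exact: sqr_ge0.
  - move=> k jk; under eq_Rintegral do rewrite sqE.
    apply: ltW; apply: hN => //.
    exact: leq_trans (MN j) (Mle _ _ jk).
  - by apply: measurable_funX; apply: measurable_funB => //; exact: L2_measurable (Ls n).
  - apply: filterS gf => z hz.
    under eq_fun do rewrite expr2.
    by rewrite expr2; apply: cvgM; apply: cvgB => //; exact: cvg_cst.
have Lsf n : (N 0%N <= n)%N -> L2 mu (fun z => s n z - f z).
  move=> hn; apply/L2P; split; last exact: (key 0%N n hn).1.
  by apply: measurable_funB => //; exact: L2_measurable (Ls n).
have Lf : L2 mu f.
  have := L2_lin (-1) (Lsf _ (leqnn _)) (Ls (N 0%N)).
  by congr (L2 _ _); apply/funext => z; ring.
exists f; split=> //; last by exists M; split.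
move=> e0 e00.
have [j hj] : exists j : nat, 4^-1 ^+ j < e0.
  have h4 : `|4^-1 : R| < 1 by rewrite ger0_norm// invf_lt1// ltr1n.
  have := @cvg_geometric R 1 4^-1 h4 => /cvgrPdist_lt/(_ _ e00)[j _ /(_ j (leqnn j))] /=.
  rewrite sub0r normrN /geometric /= mul1r ger0_norm ?exprn_ge0// => hj.
  by exists j.
exists (N j) => n jn; apply: le_lt_trans hj.
apply: le_trans (key j n jn).2; rewrite le_eqVlt; apply/orP; left; apply/eqP.
by apply: eq_Rintegral => z _; rewrite /comb; ring.
Qed.

Lemma L2_complete : complete_ip (L2 mu) (ip2 mu).
Proof. by move=> s Ls /(L2_complete_ae Ls)[f [Lf sf _]]; exists f. Qed.

End L2_complete.

(** * Smooth bumps *)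

Section smooth1.
Context {R : realType}.
Implicit Types (f g : R -> R) (x p q : R) (n k : nat).

(** [sm n] asks for [n + 1] successive derivatives, each given by a witness, so closure under sums,
    products and affine changes is an induction. *)
Fixpoint sm n f : Prop := exists2 g, (forall x, is_derive x 1 f (g x)) &
  if n is m.+1 then sm m g else True.

Definition smooth f := forall n, sm n f.

Lemma smS n f : sm n.+1 f -> sm n f.
Proof.
elim: n f => [|n IH] f [g fg sg]; first by exists g.
by exists g => //; exact: IH.
Qed.

Lemma sm_lin n (a : R) f g : sm n f -> sm n g -> sm n (fun x => a * f x + g x).
Proof.
elim: n f g => [|n IH] f g [f' ff' sf'] [g' gg' sg'];
  exists (fun x => a * f' x + g' x) => //; do ?exact: IH;
  by move=> x; apply: (@is_deriveD _ _ _ (a \*: f) g x 1 (a *: f' x) (g' x)).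
Qed.

Lemma sm_mul n f g : sm n f -> sm n g -> sm n (fun x => f x * g x).
Proof.
elim: n f g => [|n IH] f g.
  move=> [f' ff' _] [g' gg' _]; exists (fun x => f x * g' x + g x * f' x) => //.
  by move=> x; exact: (is_deriveM (ff' x) (gg' x)).
move=> sf sg; have sf1 := smS sf; have sg1 := smS sg.
move: sf sg => [f' ff' sf'] [g' gg' sg'].
exists (fun x => 1 * (f x * g' x) + g x * f' x).
  by move=> x; rewrite mul1r; exact: (is_deriveM (ff' x) (gg' x)).
by apply: (sm_lin 1); exact: IH.
Qed.

Lemma sm_cst n (c : R) : sm n (fun=> c).
Proof.
elim: n c => [|n IH] c; exists (fun=> 0) => //; by move=> x; exact: is_derive_cst.
Qed.

Lemma sm_affine n (c e : R) f : sm n f -> sm n (fun x => f (c * x + e)).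
Proof.
elim: n f => [|n IH] f [f' ff' sf']; exists (fun x => c * f' (c * x + e) + 0) => //;
  rewrite ?addr0.
- move=> x; rewrite addr0 mulrC.
  have -> : (fun x => f (c * x + e)) = f \o (fun x => c * x + e) by [].
  apply: is_derive1_comp; rewrite -[X in is_derive _ _ _ X]addr0.
  apply: (@is_deriveD _ _ _ (c \*: id) (cst e) x 1).
  by rewrite -[X in is_derive _ _ _ X]mulr1; exact: is_deriveZ.
- move=> x; rewrite addr0 mulrC.
  have -> : (fun x => f (c * x + e)) = f \o (fun x => c * x + e) by [].
  apply: is_derive1_comp; rewrite -[X in is_derive _ _ _ X]addr0.
  apply: (@is_deriveD _ _ _ (c \*: id) (cst e) x 1).
  by rewrite -[X in is_derive _ _ _ X]mulr1; exact: is_deriveZ.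
- by apply: sm_lin; [exact: IH|exact: sm_cst].
Qed.

Lemma is_derive_quadratic f (C : R) : (forall t, `|f t| <= C * t ^+ 2) ->
  is_derive (0 : R) 1 f 0.
Proof.
move=> fC; have f0 : f 0 = 0.
  by apply/eqP; rewrite -normr_le0 (le_trans (fC 0))// expr0n mulr0.
have C0 : 0 <= C by have := fC 1; rewrite expr1n mulr1; apply: le_trans.
have h : h^-1 *: (f (h *: 1 + 0) - f 0) @[h --> 0^'] --> (0 : R).
  apply/cvgrPdist_le => e e0; near=> h.
  have hn0 : h != 0 by near: h; exact: nbhs_dnbhs_neq.
  rewrite sub0r normrN f0 subr0 addr0 [h *: 1]mulr1 [_ *: _]/(_ * _).
  rewrite normrM normfV ler_pdivrMl ?normr_gt0//.
  apply: le_trans (fC h) _; rewrite -(real_normK (num_real h)) mulrC expr2 -mulrA.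
  apply: ler_wpM2l => //.
  have : `|h| <= e / (C + 1).
    near: h; apply: dnbhs0_le; rewrite divr_gt0//; lra.
  move=> hle; apply: (@le_trans _ _ (e / (C + 1) * C)); first exact: ler_wpM2r.
  rewrite mulrAC ler_pdivrMr ?ler_pM2l//; lra.
apply: DeriveDef; first by apply/cvg_ex; exists 0.
by apply/cvg_lim.
Unshelve. all: by end_near. Qed.

(** The classical flat function [exp(-1/x)] with powers of [1/x] attached: differentiation maps
    [flat k] into the span of [flat k.+1] and [flat k.+2], so smoothness is an induction over all
    [k] at once. *)
Definition flat k x : R := if 0 < x then x^-1 ^+ k * expR (- x^-1) else 0.

Lemma flat_ge0 k x : 0 <= flat k x.
Proof.
rewrite /flat; case: ifPn => // x0.
by rewrite mulr_ge0 ?expR_ge0// exprn_ge0// invr_ge0 ltW.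
Qed.

(** The term of order [k + 2] in the exponential series at [1/t] beats [t^-k] by two powers of [t];
    a quadratic bound gives derivative 0 at the origin. *)
Lemma flat_quadratic k t : `|flat k t| <= (k.+2)`!%:R * t ^+ 2.
Proof.
rewrite ger0_norm ?flat_ge0// /flat; case: ifPn => [t0|_]; last first.
  by rewrite mulr_ge0// sqr_ge0.
have y0 : 0 <= t^-1 by rewrite invr_ge0 ltW.
have := expR_ge1Dxn k.+1 y0; set E := expR _ => hE.
have E0 : 0 < E by exact: expR_gt0.
have f0 : 0 < (k.+2)`!%:R :> R by rewrite ltr0n fact_gt0.
rewrite expRN -/E ler_pdivrMr//.
have {}hE : t^-1 ^+ k.+2 <= (k.+2)`!%:R * E.
  by rewrite mulrC -ler_pdivrMr//; apply: le_trans hE; rewrite lerDr.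
rewrite mulrAC; apply: (@le_trans _ _ (t^-1 ^+ k.+2 * t ^+ 2)); last first.
  by apply: ler_wpM2r => //; exact: sqr_ge0.
rewrite -addn2 exprD -mulrA -exprMn mulVf ?gt_eqF// expr1n mulr1//.
Qed.

Lemma is_derive_flat k x :
  is_derive x 1 (flat k) (- k%:R * flat k.+1 x + flat k.+2 x).
Proof.
case: (ltgtP 0 x) => [x0|x0|<-].
- have nx : x != 0 by rewrite gt_eqF.
  have dV : is_derive x 1 (@GRing.inv R) (- x ^- 2).
    have := @is_deriveV R id x 1 1 nx (is_derive_id _ _).
    by rewrite [X in is_derive _ _ _ X]mulr1.
  have dN : is_derive x 1 (fun t : R => - t^-1) (x ^- 2).
    by rewrite -[X in is_derive _ _ _ X]opprK; exact: is_deriveN.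
  have dE := @is_derive1_comp _ expR (fun t : R => - t^-1) x _ _ (is_derive_expR (- x^-1)) dN.
  have := is_deriveM (is_deriveX k dV) dE.
  move=> h; apply: (near_eq_is_derive _ (is_derive_eq h _)).
    near=> t; have t0 : 0 < t by near: t; exact: lt_nbhsr.
    by rewrite /flat t0 /= [LHS]/(_ * _) /= exprfctE.
  rewrite /flat x0 /= exprfctE -exprVn.
  by case: k {h} => [|k]; rewrite /GRing.scale/= !exprS ?expr0; ring.
- rewrite /flat !ltNge (ltW x0)/= mulr0 addr0.
  apply: (near_eq_is_derive _ (is_derive_cst (0 : R) x 1)).
  near=> t; rewrite ltNge ifF//; apply/negbTE; rewrite negbK; apply: ltW.
  near: t; exact: lt_nbhsl.
- rewrite /flat ltxx mulr0 addr0; apply: is_derive_quadratic; exact: flat_quadratic.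
Unshelve. all: by end_near. Qed.

Lemma sm_flat n k : sm n (flat k).
Proof.
elim: n k => [|n IH] k; exists (fun x => - k%:R * flat k.+1 x + flat k.+2 x) => //.
- exact: is_derive_flat.
- exact: is_derive_flat.
- by apply: sm_lin; exact: IH.
Qed.

(** The scaling by [n + 1] makes these smooth functions, bounded by 1, converge pointwise to the
    indicator of []p, q[]. *)
Definition bump p q n x := flat 0 (n.+1%:R * (x - p)) * flat 0 (n.+1%:R * (q - x)).

Lemma smooth_bump p q n : smooth (bump p q n).
Proof.
move=> m; apply: sm_mul.
- rewrite (_ : (fun x => _) = fun x => flat 0 (n.+1%:R * x + - n.+1%:R * p)).
    by apply: sm_affine; exact: sm_flat.
  by apply/funext => x; congr flat; ring.
- rewrite (_ : (fun x => _) = fun x => flat 0 (- n.+1%:R * x + n.+1%:R * q)).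
    by apply: sm_affine; exact: sm_flat.
  by apply/funext => x; congr flat; ring.
Qed.

Lemma flat0_le1 x : flat 0 x <= 1.
Proof.
rewrite /flat; case: ifPn => // x0; rewrite expr0 mul1r -expR0 ler_expR.
by rewrite oppr_le0 invr_ge0 ltW.
Qed.

Lemma bump_ge0 p q n x : 0 <= bump p q n x.
Proof. by rewrite mulr_ge0 ?flat_ge0. Qed.

Lemma bump_norm_le1 p q n x : `|bump p q n x| <= 1.
Proof. by rewrite ger0_norm ?bump_ge0// mulr_ile1 ?flat_ge0 ?flat0_le1. Qed.

Lemma bump_out p q n x : x \notin `]p, q[ -> bump p q n x = 0.
Proof.
rewrite in_itv/= negb_and -!leNgt => /orP[xp|qx]; rewrite /bump {1}/flat.
  by rewrite ltNge nmulr_rle0 ?subr_le0// xp mul0r || (rewrite ltNge pmulr_rle0// subr_le0 xp mul0r).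
by rewrite /flat (ltNge 0 (_ * (q - x))) pmulr_rle0// subr_le0 qx mulr0.
Qed.

Lemma flat0_cvg x : 0 < x -> flat 0 (n.+1%:R * x) @[n --> \oo] --> (1 : R).
Proof.
move=> x0.
rewrite (_ : (fun n => _) = fun n : nat => expR (- (n.+1%:R^-1 * x^-1))); last first.
  apply/funext => n; rewrite /flat mulr_gt0// expr0 mul1r invfM; congr expR.
rewrite -[X in _ --> X]expR0; apply: continuous_cvg; first exact: continuous_expR.
rewrite -[X in _ --> X]oppr0; apply: cvgN; rewrite -[X in _ --> X](mul0r x^-1).
by apply: cvgM; [exact: cvg_harmonic|exact: cvg_cst].
Qed.

Lemma bump_cvg p q x : bump p q n x @[n --> \oo] --> (\1_(`]p, q[%classic : set R) x : R).
Proof.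
rewrite indicE; have [xpq|xpq] := boolP (x \in `]p, q[); last first.
  rewrite memNset; last exact/negP.
  under eq_fun do rewrite (bump_out _ xpq); exact: cvg_cst.
rewrite mem_set//; move: xpq; rewrite in_itv/= => /andP[px xq].
by rewrite -[X in _ --> X]mulr1; apply: cvgM; apply: flat0_cvg; rewrite subr_gt0.
Qed.

Lemma sm_continuous n f : sm n f -> continuous f.
Proof.
move=> sf x; apply/differentiable_continuous/derivable1_diffP.
have [g fg _] : sm 0 f by elim: n sf => // n IH /smS.
by have [] := fg x.
Qed.

End smooth1.

(** * Rectangles and Fubini *)

Section real_fubini.
Context d1 d2 (T1 : measurableType d1) (T2 : measurableType d2) (R : realType).
Context (m1 : {sigma_finite_measure set T1 -> \bar R})
        (m2 : {sigma_finite_measure set T2 -> \bar R}).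
Implicit Types F G : T1 * T2 -> R.
Local Notation m12 := (m1 \x m2)%E.

Lemma measurable_sec2 F y : measurable_fun [set: T1 * T2] F ->
  measurable_fun [set: T1] (fun x => F (x, y)).
Proof. by move=> mF; exact: (measurableT_comp mF (pair2_measurable y)). Qed.

Lemma measurable_Rint1 F : measurable_fun [set: T1 * T2] F ->
  measurable_fun [set: T1] (fun x => \int[m2]_y F (x, y)).
Proof.
move=> mF; have mE : measurable_fun setT (EFin \o F) by exact/measurable_EFinP.
apply: measurableT_comp => //.
rewrite (_ : (fun x => _) = (fun x => (\int[m2]_y (EFin \o F)^\+ (x, y) -
    \int[m2]_y (EFin \o F)^\- (x, y))%E)).
  apply: emeasurable_funB; apply: measurable_fun_fubini_tonelli_F => //.
  - exact: measurable_funepos.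
  - exact: measurable_funeneg.
apply/funext => x; rewrite integralE; congr (_ - _)%E;
  by apply: eq_integral => y _; rewrite ?funepos.unlock ?funeneg.unlock.
Qed.

Lemma measurable_Rint2 F : measurable_fun [set: T1 * T2] F ->
  measurable_fun [set: T2] (fun y => \int[m1]_x F (x, y)).
Proof.
move=> mF; have mE : measurable_fun setT (EFin \o F) by exact/measurable_EFinP.
apply: measurableT_comp => //.
rewrite (_ : (fun y => _) = (fun y => (\int[m1]_x (EFin \o F)^\+ (x, y) -
    \int[m1]_x (EFin \o F)^\- (x, y))%E)).
  apply: emeasurable_funB; apply: measurable_fun_fubini_tonelli_G => //.
  - exact: measurable_funepos.
  - exact: measurable_funeneg.
apply/funext => x; rewrite integralE; congr (_ - _)%E;
  by apply: eq_integral => y _; rewrite ?funepos.unlock ?funeneg.unlock.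
Qed.

Lemma mint_sec1 F : mint m12 F -> {ae m1, forall x, mint m2 (fun y => F (x, y))}.
Proof. exact: ae_integrable1. Qed.

Lemma mint_sec2 F : mint m12 F -> {ae m2, forall y, mint m1 (fun x => F (x, y))}.
Proof. exact: ae_integrable2. Qed.

Let fineF1 F : mint m12 F ->
  {ae m1, forall x, fubini_F m2 (EFin \o F) x = (\int[m2]_y F (x, y))%:E}.
Proof.
move=> iF; apply: filterS (mint_sec1 iF) => x ix.
by rewrite /fubini_F /Rintegral fineK//; exact: integrable_fin_num.
Qed.

Let fineF2 F : mint m12 F ->
  {ae m2, forall y, fubini_G m1 (EFin \o F) y = (\int[m1]_x F (x, y))%:E}.
Proof.
move=> iF; apply: filterS (mint_sec2 iF) => x ix.
by rewrite /fubini_G /Rintegral fineK//; exact: integrable_fin_num.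
Qed.

Lemma mint_Rint1 F : mint m12 F -> mint m1 (fun x => \int[m2]_y F (x, y)).
Proof.
move=> iF; have mF := mint_measurable iF.
have mI := measurable_Rint1 mF.
have /integrableP[mf If] := integrable_fubini_F iF.
apply/integrableP; split; first exact/measurable_EFinP.
apply: le_lt_trans If; rewrite le_eqVlt; apply/orP; left; apply/eqP.
apply: ae_eq_integral => //; do ?[apply: measurableT_comp => //].
by apply: filterS (fineF1 iF) => x /= -> _.
Qed.

Lemma mint_Rint2 F : mint m12 F -> mint m2 (fun y => \int[m1]_x F (x, y)).
Proof.
move=> iF; have mF := mint_measurable iF.
have mI := measurable_Rint2 mF.
have mFE : measurable_fun setT (EFin \o F) by exact/measurable_EFinP.
apply/integrableP; split; first exact/measurable_EFinP.
have h := (@integrable21ltyP _ _ _ _ _ m1 m2 (EFin \o F) mFE).1 iF.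
apply: le_lt_trans h.
apply: ge0_le_integral => //.
- by apply: measurableT_comp => //; exact/measurable_EFinP.
- apply: (measurable_fun_fubini_tonelli_G (abse \o (EFin \o F))).
    exact: measurableT_comp.
  by move=> z; exact: abse_ge0.
move=> y _; apply: le_trans (le_abse_integral _ _ _) => //.
  have fe (e : \bar R) : (`|(fine e)%:E| <= `|e|)%E.
    by case: e => [r| |]; rewrite ?lexx//= ?normr0 ?leey.
  exact: fe.
by apply/measurable_EFinP; exact: measurable_sec2.
Qed.

Lemma fubini_R1 F : mint m12 F ->
  \int[m12]_z F z = \int[m1]_x \int[m2]_y F (x, y).
Proof.
move=> iF; have mF := mint_measurable iF.
rewrite {1}/Rintegral -(integral12_prod_meas1 iF); congr fine.
have h1 : measurable_fun setT (fubini_F m2 (EFin \o F)) by exact: (measurable_fubini_F iF).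
have h2 : measurable_fun setT (fun x => (\int[m2]_y F (x, y))%:E).
  by apply/measurable_EFinP; exact: measurable_Rint1.
apply: (ae_eq_integral _ _ measurableT h1 h2).
by apply: filterS (fineF1 iF) => x /= -> _.
Qed.

Lemma fubini_R2 F : mint m12 F ->
  \int[m12]_z F z = \int[m2]_y \int[m1]_x F (x, y).
Proof.
move=> iF; have mF := mint_measurable iF.
rewrite {1}/Rintegral -(integral21_prod_meas1 iF); congr fine.
have h1 : measurable_fun setT (fubini_G m1 (EFin \o F)) by exact: (measurable_fubini_G iF).
have h2 : measurable_fun setT (fun y => (\int[m1]_x F (x, y))%:E).
  by apply/measurable_EFinP; exact: measurable_Rint2.
apply: (ae_eq_integral _ _ measurableT h1 h2).
by apply: filterS (fineF2 iF) => x /= -> _.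
Qed.

Lemma ae_sec1 (P : T1 * T2 -> Prop) : {ae m12, forall z, P z} ->
  {ae m1, forall x, {ae m2, forall y, P (x, y)}}.
Proof.
move=> [N [mN N0 PN]].
have /(ae_eq_integral_abs m1 measurableT _).1 h :
    (\int[m1]_x `|m2 (xsection N x)| = 0)%E.
  rewrite -[RHS]N0; apply: eq_integral => x _.
  by rewrite gee0_abs//; exact: measure_ge0.
apply: filterS (h _) => [x /(_ I) /= Nx0|]; last exact: measurable_fun_xsection.
exists (xsection N x); split => //; first exact: measurable_xsection.
by move=> y /= nP; rewrite /xsection/= inE; apply: PN.
Qed.

Lemma ae_sec2 (P : T1 * T2 -> Prop) : {ae m12, forall z, P z} ->
  {ae m2, forall y, {ae m1, forall x, P (x, y)}}.
Proof.
move=> [N [mN N0 PN]].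
(* The product measure [\x] slices in the first variable; by uniqueness it agrees with [\x^], which
   slices in the second. *)
have N0' : (m1 \x^ m2)%E N = 0%E.
  rewrite -N0; apply/esym.
  by apply: product_measure_unique => // B C mB mC/=; rewrite product_measure2E.
have /(ae_eq_integral_abs m2 measurableT _).1 h :
    (\int[m2]_x `|m1 (ysection N x)| = 0)%E.
  rewrite -[RHS]N0'; apply: eq_integral => x _.
  by rewrite gee0_abs//; exact: measure_ge0.
apply: filterS (h _) => [x /(_ I) /= Nx0|]; last exact: measurable_fun_ysection.
exists (ysection N x); split => //; first exact: measurable_ysection.
by move=> y /= nP; rewrite /ysection/= inE; apply: PN.
Qed.

(** The converse of slicing: Tonelli applied to [|F - G|], whence the joint measurability. *)
Lemma ae_eq_prod1 F G : measurable_fun [set: T1 * T2] F ->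
  measurable_fun [set: T1 * T2] G ->
  {ae m1, forall x, {ae m2, forall y, F (x, y) = G (x, y)}} ->
  {ae m12, forall z, F z = G z}.
Proof.
move=> mF mG FG.
have mB : measurable_fun setT (fun z => (F z - G z)%:E).
  by apply/measurable_EFinP; exact: measurable_funB.
have /(ae_eq_integral_abs m12 measurableT mB).1 h :
    (\int[m12]_z `|(F z - G z)%:E| = 0)%E.
  rewrite (fubini_tonelli1 (fun z => `|(F z - G z)%:E|)%E)//; last exact: measurableT_comp.
  rewrite (ae_eq_integral (cst 0%E)) ?integral0//.
  - apply: (measurable_fun_fubini_tonelli_F (fun z => `|(F z - G z)%:E|)%E) => //.
    exact: measurableT_comp.
  - apply: filterS FG => x FGx _; rewrite /fubini_F (ae_eq_integral (cst 0%E)) ?integral0//.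
      apply: measurableT_comp => //; apply: (measurableT_comp mB).
      exact: pair1_measurable.
    by apply: filterS FGx => y -> _; rewrite subrr abse0.
by apply: filterS h => z /(_ I) [] /eqP; rewrite subr_eq0 => /eqP.
Qed.

Lemma ae_eq_prod2 F G : measurable_fun [set: T1 * T2] F ->
  measurable_fun [set: T1 * T2] G ->
  {ae m2, forall y, {ae m1, forall x, F (x, y) = G (x, y)}} ->
  {ae m12, forall z, F z = G z}.
Proof.
move=> mF mG FG.
have mB : measurable_fun setT (fun z => (F z - G z)%:E).
  by apply/measurable_EFinP; exact: measurable_funB.
have /(ae_eq_integral_abs m12 measurableT mB).1 h :
    (\int[m12]_z `|(F z - G z)%:E| = 0)%E.
  rewrite (fubini_tonelli2 (fun z => `|(F z - G z)%:E|)%E)//; last exact: measurableT_comp.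
  rewrite (ae_eq_integral (cst 0%E)) ?integral0//.
  - apply: (measurable_fun_fubini_tonelli_G (fun z => `|(F z - G z)%:E|)%E) => //.
    exact: measurableT_comp.
  - apply: filterS FG => x FGx _; rewrite /fubini_G (ae_eq_integral (cst 0%E)) ?integral0//.
      apply: measurableT_comp => //; apply: (measurableT_comp mB).
      exact: pair2_measurable.
    by apply: filterS FGx => y -> _; rewrite subrr abse0.
by apply: filterS h => z /(_ I) [] /eqP; rewrite subr_eq0 => /eqP.
Qed.

Lemma mint_tensor (f : T1 -> R) (g : T2 -> R) : mint m1 f -> mint m2 g ->
  mint m12 (fun z => f z.1 * g z.2).
Proof.
move=> mf mg; have mf' := mint_measurable mf; have mg' := mint_measurable mg.
have mfg : measurable_fun setT (fun z : T1 * T2 => f z.1 * g z.2).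
  by apply: measurable_funM; [exact: (measurableT_comp mf')|exact: (measurableT_comp mg')].
apply/integrable12ltyP; first exact/measurable_EFinP.
rewrite (eq_integral (fun x => `|f x|%:E * (\int[m2]_y `|g y|)%:E)%E); last first.
  move=> x _; rewrite /Rintegral fineK; last exact: (integrable_fin_num _ (mint_norm mg)).
  rewrite -integralZl//; last exact: (mint_norm mg).
  by apply: eq_integral => y _; rewrite /= normrM.
rewrite integralZr//; last exact: (mint_norm mf).
rewrite lte_mul_pinfty//; first exact: integral_ge0.
  exact: (integrable_fin_num _ (mint_norm mf)).
by rewrite ltry.
Qed.

End real_fubini.

(** * Measures that agree on measurable sets, and restriction to a rectangle *)

Section measure_transfer.
Context d (T : measurableType d) (R : realType).
Context (m m' : {measure set T -> \bar R}).
Hypothesis mm' : forall A, measurable A -> m A = m' A.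

Lemma eq_measure_Rint (f : T -> R) : \int[m]_z f z = \int[m']_z f z.
Proof. by congr fine; apply: eq_measure_integral => A mA _; exact: mm'. Qed.

Lemma eq_measure_mint (f : T -> R) : mint m f -> mint m' f.
Proof.
move=> /integrableP[mf If]; apply/integrableP; split => //.
by rewrite (eq_measure_integral m)// => A mA _; rewrite mm'.
Qed.

Lemma eq_measure_ae (P : T -> Prop) : {ae m, forall z, P z} -> {ae m', forall z, P z}.
Proof. by move=> [N [mN N0 PN]]; exists N; split => //; rewrite -mm'. Qed.

End measure_transfer.

Section restriction.
Context d (T : measurableType d) (R : realType).
Context (mu : {measure set T -> \bar R}) (D : set T) (mD : measurable D).
Local Notation m := (mrestr mu mD).

Lemma restr_ae (P : T -> Prop) :
  {ae m, forall z, P z} <-> {ae mu, forall z, D z -> P z}.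
Proof.
split=> [[N [mN N0 PN]]|[N [mN N0 PN]]].
  exists (N `&` D); split => //; first exact: measurableI.
  by move=> z /= /not_implyP[Dz nP]; split => //; exact: PN.
exists (N `|` ~` D); split.
- by apply: measurableU => //; exact: measurableC.
- rewrite /mrestr setIUl setICl setU0.
  by apply: (subset_measure0 _ mN _ N0) => //; exact: measurableI.
- move=> z /= nP; have [Dz|nD] := pselect (D z); last by right.
  by left; apply: PN => /= /(_ Dz).
Qed.

Lemma restr_in : {ae m, forall z, D z}.
Proof. by apply/restr_ae; exact: aeW. Qed.

Lemma restr_integral (f : T -> \bar R) : measurable_fun setT f ->
  (\int[m]_z f z = \int[mu]_(z in D) f z)%E.
Proof.
move=> mf; have mfD : measurable_fun setT (f \_ D).
  exact/(measurable_restrictT _ mD).1/measurable_funTS.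
have fD : {ae m, forall z, setT z -> f z = (f \_ D) z}.
  by apply: filterS restr_in => z Dz _; rewrite patchE mem_set.
rewrite (ae_eq_integral (f \_ D) f measurableT mf mfD fD).
rewrite -integral_mkcond; apply: eq_measure_integral => A mA AD.
by rewrite /= /mrestr setIidl.
Qed.

Lemma restr_Rint (f : T -> R) : measurable_fun setT f ->
  \int[m]_z f z = \int[mu]_(z in D) f z.
Proof. by move=> mf; congr fine; apply: restr_integral; exact/measurable_EFinP. Qed.

Lemma restr_mint (f : T -> R) : measurable_fun setT f ->
  mint m f <-> mu.-integrable D (EFin \o f).
Proof.
move=> mf; have mE : measurable_fun setT (EFin \o f) by exact/measurable_EFinP.
split=> /integrableP[_ If]; apply/integrableP; split => //.
- exact: measurable_funTS.
- by rewrite -restr_integral//; exact: measurableT_comp.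
- by rewrite restr_integral//; exact: measurableT_comp.
Qed.

End restriction.

Section rectangle.
Context {R : realType}.
Local Notation lam := (@lebesgue_measure R).
Local Notation mR := (measurableTypeR R).

Lemma lebesgue_itv_lty (a b : R) : (lam [set` `]a, b[] < +oo)%E.
Proof. by rewrite lebesgue_measure_itv/=; case: ifP => // _; rewrite ltry. Qed.

Lemma measurable_oo (a b : R) : measurable ([set` `]a, b[] : set mR).
Proof. exact: measurable_itv. Qed.

Definition mI (a b : R) : {finite_measure set mR -> \bar R} :=
  mfrestr (measurable_oo a b) (lebesgue_itv_lty a b).

Definition rect (a b c d : R) : set (R * R) := [set` `]a, b[] `*` [set` `]c, d[].

Lemma measurable_rect a b c d : measurable (rect a b c d : set (mR * mR)%type).
Proof. by apply: measurableX; exact: measurable_itv. Qed.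

Lemma rect_lty a b c d : ((lam \x lam)%E (rect a b c d) < +oo)%E.
Proof.
rewrite product_measure1E//; try exact: measurable_itv.
by rewrite lte_mul_pinfty ?ge0_fin_numE ?lebesgue_itv_lty.
Qed.

Definition mrect a b c d : {finite_measure set (mR * mR)%type -> \bar R} :=
  mfrestr (measurable_rect a b c d) (rect_lty a b c d).

#[global] Instance mI_filter a b : Filter (nbhs (almost_everywhere (mI a b))) :=
  ae_filter_ringOfSetsType (mI a b).

#[global] Instance mrect_filter a b c d :
    Filter (nbhs (almost_everywhere (mrect a b c d))) :=
  ae_filter_ringOfSetsType (mrect a b c d).

(** By uniqueness of product measures it suffices to compare rectangles. Every use of Fubini on the
    domain goes through this identification. *)
Lemma mrectE a b c d A : measurable A -> mrect a b c d A = (mI a b \x mI c d)%E A.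
Proof.
move=> mA; apply/esym; apply: (@product_measure_unique _ _ _ _ _ (mI a b) (mI c d) (mrect a b c d)) => //.
move=> B C mB mC; rewrite /= /mfrestr /mrestr /rect -setXI product_measure1E//.
- by apply: measurableI => //; exact: measurable_itv.
- by apply: measurableI => //; exact: measurable_itv.
Qed.

End rectangle.

(** * Absolutely continuous functions of one variable *)

(** Dominated convergence speaks of sequences, so the continuity of integrals depending on a
    parameter is obtained sequentially. *)
Lemma seq_continuous {R : realType} {X : pseudoMetricType R} (f : X -> R) (x : X) :
  (forall u : nat -> X, u @ \oo --> x -> f (u n) @[n --> \oo] --> f x) ->
  {for x, continuous f}.
Proof.
move=> seqf; apply/cvgrPdist_lt => e e0; apply: contrapT => nnear.
have ex (n : nat) : exists y, ball x n.+1%:R^-1 y /\ ~ `|f x - f y| < e.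
  apply: contrapT => /forallNP h; apply: nnear; apply/nbhs_ballP.
  exists n.+1%:R^-1; first by rewrite /= invr_gt0 ltr0Sn.
  by move=> y xy; have /not_andP[//|/contrapT] := h y.
have [u hu] := choice ex.
have ux : u @ \oo --> x.
  apply/cvg_ballP => d d0; have [N _ hN] := near_infty_natSinv_lt (PosNum d0).
  exists N => // n Nn; have [xn _] := hu n.
  by apply: le_ball xn; apply: ltW; exact: hN.
have /cvgrPdist_lt/(_ _ e0)[N _ /(_ N (leqnn N))] := seqf u ux.
by have [_] := hu N.
Qed.

Section one_dim.
Context {R : realType}.
Local Notation lam := (@lebesgue_measure R).
Local Notation mR := (measurableTypeR R).
Implicit Types (a b s x : R) (f g w r : R -> R).

Definition chi s x : R := (x < s)%R%:R.

Lemma chi_norm_le1 s x : `|chi s x| <= 1.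
Proof. by rewrite /chi; case: ltP => _; rewrite ?normr1// normr0. Qed.

Lemma chi_trans s x y : chi x y * (chi s x * chi s y) = chi x y * chi s x.
Proof.
rewrite /chi; case: (ltP y x) => yx; last by rewrite !mul0r.
case: (ltP x s) => xs; last by rewrite mul0r.
by rewrite (lt_trans yx xs) !mulr1.
Qed.

Lemma chi_compl x y : y != x -> 1 - chi y x = chi x y.
Proof. by rewrite /chi; case: (ltgtP y x) => // _ _; rewrite ?subrr ?subr0. Qed.

Lemma measurable_chi2 d (T : measurableType d) (f g : T -> mR) :
  measurable_fun setT f -> measurable_fun setT g ->
  measurable_fun setT (fun z => chi (f z) (g z)).
Proof.
move=> mf mg; rewrite (_ : (fun z => _) = (fun b : bool => b%:R : R) \o (fun z => g z < f z))//.
by apply: measurableT_comp => //; exact: measurable_fun_ltr.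
Qed.

Lemma measurable_chi s : measurable_fun [set: mR] (chi s).
Proof. by apply: (@measurable_chi2 _ _ (fun=> s) id). Qed.

Section ab.
Context (a b : R).
Local Notation m := (mI a b).

(** Putting the upper limit into the integrand keeps the domain fixed, which suits dominated
    convergence and Fubini; [prim f] is then defined for all real [s] and constant outside []a,
    b[]. *)
Definition prim f s := \int[m]_x (chi s x * f x).

Lemma mint_chi s f : mint m f -> mint m (fun x => chi s x * f x).
Proof.
move=> mf; apply: (@mint_mul_bounded _ _ _ _ 1) => //; first exact: measurable_chi.
exact: chi_norm_le1.
Qed.

Lemma mI_in : {ae m, forall x, a < x < b}.
Proof.
have h : {ae m, forall x, [set` `]a, b[] x} := restr_in lam (measurable_oo a b).
by apply: filterS h => x /=; rewrite in_itv.
Qed.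

Lemma mI_neq s : {ae m, forall x, x != s}.
Proof.
apply/(restr_ae lam (measurable_oo a b)); exists [set s]; split => //.
  exact: lebesgue_measure_set1.
by move=> x /= /not_implyP[_ /negP]; rewrite negbK => /eqP.
Qed.

Lemma prim_ge f s : mint m f -> b <= s -> prim f s = \int[m]_x f x.
Proof.
move=> mf bs; apply: Rint_ae_eq.
- by apply: mint_measurable; exact: mint_chi.
- exact: mint_measurable mf.
- apply: filterS mI_in => x /andP[_ xb].
  by rewrite /chi (lt_le_trans xb bs) mul1r.
Qed.

Lemma prim_lin k f g s : mint m f -> mint m g ->
  prim (fun x => k * f x + g x) s = k * prim f s + prim g s.
Proof.
move=> mf mg; rewrite /prim -Rint_lin; [|exact: mint_chi..].
by apply: eq_Rintegral => x _; ring.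
Qed.

Lemma prim_norm f s : mint m f -> `|prim f s| <= \int[m]_x `|f x|.
Proof.
move=> mf; apply: le_trans (le_normr_Rintegral _ (mint_chi s mf)) _ => //.
apply: le_Rintegral => //; first exact: (mint_norm (mint_chi s mf)).
  exact: mint_norm.
by move=> x _; rewrite normrM ler_piMl// chi_norm_le1.
Qed.

Lemma chi_cvg (u : nat -> R) s x : u @ \oo --> s -> x != s ->
  chi (u n) x @[n --> \oo] --> chi s x.
Proof.
move=> us xs; apply: cvg_near_cst; rewrite /chi.
case: (ltgtP x s) xs => // xs _.
- by apply: filterS (cvgr_gt _ us x xs) => n ->.
- by apply: filterS (cvgr_lt _ us x xs) => n h; rewrite ltNge (ltW h).
Qed.

Lemma prim_continuous f : mint m f -> continuous (prim f).
Proof.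
move=> mf s; apply: seq_continuous => u us.
apply: (@Rint_cvg _ _ _ m (fun n x => chi (u n) x * f x) (fun x => chi s x * f x)
  (fun x => `|f x|)).
- by move=> n; apply: mint_measurable; exact: mint_chi.
- by apply: mint_measurable; exact: mint_chi.
- apply: filterS (mI_neq s) => x xs.
  by apply: cvgM; [exact: chi_cvg|exact: cvg_cst].
- exact: mint_norm.
- by move=> n; apply: aeW => x; rewrite normrM ler_piMl// chi_norm_le1.
Qed.

Lemma measurable_prim f : mint m f -> measurable_fun [set: mR] (prim f).
Proof. by move=> mf; apply: continuous_measurable_fun; exact: prim_continuous. Qed.

Lemma mint_prim f : mint m f -> mint m (prim f).
Proof.
move=> mf; apply: (mint_le (measurable_prim mf) (mint_cst m (\int[m]_x `|f x|))).
by move=> s; exact: prim_norm.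
Qed.

Lemma mint_mul_prim w r : mint m w -> mint m r -> mint m (fun x => prim w x * r x).
Proof.
move=> mw mr; apply: (mint_mul_bounded (measurable_prim mw) _ mr).
by move=> x; exact: prim_norm.
Qed.

(** Integration by parts for absolutely continuous functions, without differentiating: the product
    is an integral over a square, which the diagonal cuts into two triangles, each computed by
    Fubini in its own order. *)
Lemma prim_mul w r s : mint m w -> mint m r ->
  prim w s * prim r s = prim (fun x => w x * prim r x + prim w x * r x) s.
Proof.
move=> mw mr.
have mwc := mint_chi s mw; have mrc := mint_chi s mr.
have i0 := mint_tensor mwc mrc.
have iG (G : mR * mR -> R) : measurable_fun setT G -> (forall z, `|G z| <= 1) ->
    mint (m \x m)%E (fun z => G z * ((chi s z.1 * w z.1) * (chi s z.2 * r z.2))).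
  by move=> mG G1; apply: (mint_mul_bounded mG G1 i0).
(* The two triangles. The diagonal belongs to [G2]; it is discarded slice by slice through
   [mI_neq]. *)
pose G1 (z : mR * mR) := chi z.1 z.2; pose G2 (z : mR * mR) := 1 - chi z.1 z.2.
have mG1 : measurable_fun setT G1 by exact: measurable_chi2.
have mG2 : measurable_fun setT G2 by exact: measurable_funB.
have G1le z : `|G1 z| <= 1 by exact: chi_norm_le1.
have G2le z : `|G2 z| <= 1.
  by rewrite /G2 /chi; case: ltP => _; rewrite ?subrr ?normr0// subr0 normr1.
have i1 := iG _ mG1 G1le; have i2 := iG _ mG2 G2le.
have -> : prim w s * prim r s =
    \int[(m \x m)%E]_z ((chi s z.1 * w z.1) * (chi s z.2 * r z.2)).
  rewrite (fubini_R1 i0) /prim -RintegralZr//.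
  by apply: eq_Rintegral => x _ /=; rewrite RintegralZl.
have -> : \int[(m \x m)%E]_z ((chi s z.1 * w z.1) * (chi s z.2 * r z.2)) =
    \int[(m \x m)%E]_z (G1 z * ((chi s z.1 * w z.1) * (chi s z.2 * r z.2))) +
    \int[(m \x m)%E]_z (G2 z * ((chi s z.1 * w z.1) * (chi s z.2 * r z.2))).
  by rewrite -RintegralD//; apply: eq_Rintegral => z _; rewrite /G2 /G1; ring.
rewrite (fubini_R1 i1) (fubini_R2 i2).
have mwQ : mint m (fun x => w x * prim r x).
  by have := mint_mul_prim mr mw; congr (mint _ _); apply/funext => x; rewrite mulrC.
have mWr := mint_mul_prim mw mr.
have -> : prim (fun x => w x * prim r x + prim w x * r x) s =
    prim (fun x => w x * prim r x) s + prim (fun x => prim w x * r x) s.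
  by rewrite -[X in X + _]mul1r -prim_lin//; congr prim; apply/funext => x; rewrite mul1r.
congr (_ + _); apply: eq_Rintegral => x _ /=; rewrite /G1 /G2 /=.
- rewrite {1}/prim [RHS]mulrA -RintegralZl; [|by []|exact: mint_chi].
  apply: eq_Rintegral => y _.
  transitivity (chi x y * (chi s x * chi s y) * (w x * r y)); first by ring.
  by rewrite chi_trans; ring.
- rewrite [RHS](_ : _ = (chi s x * r x) * prim w x); last by ring.
  rewrite {1}/prim -RintegralZl; [|by []|exact: mint_chi].
  apply: Rint_ae_eq.
  + have := measurable_sec2 x (mint_measurable i2); exact.
  + apply: mint_measurable; apply: mintZ; exact: mint_chi.
  apply: filterS (mI_neq x) => y yx /=.
  transitivity ((1 - chi y x) * (chi s x * chi s y) * (w y * r x)); first by ring.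
  by rewrite chi_compl// chi_trans; ring.
Qed.

Lemma chi_indic s x : a < x < b -> chi s x = \1_(`]a, s[%classic : set R) x.
Proof.
move=> /andP[ax xb]; rewrite indicE /chi; case: (ltP x s) => xs.
  by rewrite mem_set//= in_itv/= ax.
by rewrite memNset//= in_itv/= ax ltNge xs.
Qed.

Lemma prim_lebesgue f s : mint m f -> s <= b ->
  prim f s = \int[lam]_(x in `]a, s[) f x.
Proof.
move=> mf sb; have mf' := mint_measurable mf.
rewrite /prim restr_Rint; last by apply: mint_measurable; exact: mint_chi.
rewrite [RHS]Rintegral_mkcond Rintegral_mkcond; apply: eq_Rintegral => x _.
rewrite !patchE; case: ifPn => [|xab]; last first.
  rewrite ifF//; apply: contraNF xab; rewrite !inE/= !in_itv/= => /andP[-> xs].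
  exact: lt_le_trans xs sb.
rewrite inE/= in_itv/= => xab; rewrite chi_indic// indicE.
by case: ifPn; rewrite ?mul1r ?mul0r.
Qed.

End ab.
End one_dim.

Section one_dim_tests.
Context {R : realType} (a b : R).
Hypothesis ab : a < b.
Local Notation lam := (@lebesgue_measure R).
Local Notation mR := (measurableTypeR R).
Local Notation m := (mI a b).
Implicit Types (f g w r : R -> R).

(** Lebesgue differentiation: extended by zero to the line, [f] is a.e. the derivative of its
    primitive, here locally constant. *)
Lemma prim_cst_ae0 f c : mint m f -> (forall s, a < s < b -> prim a b f s = c) ->
  {ae m, forall x, f x = 0}.
Proof.
move=> mf fc; have mf' := mint_measurable mf.
pose ft := f \_ [set` `]a, b[].
have ift : lam.-integrable setT (EFin \o ft).
  rewrite /ft -restrict_EFin; apply/(integrable_mkcond _ (measurable_oo a b)).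
  exact/(restr_mint lam (measurable_oo a b) mf').
have loc : locally_integrable [set: R] ft.
  apply: integrable_locally; first exact: measurable_oo.
  exact/(restr_mint lam (measurable_oo a b) mf').
have ifty (y : R) : lam.-integrable [set` Interval -oo%O (BRight y)] (EFin \o ft).
  by apply: integrableS ift => //; exact: measurable_itv.
have FP s : a < s < b -> \int[lam]_(t in [set` Interval -oo%O (BRight s)]) ft t = c.
  move=> asb; rewrite -(fc s asb) (prim_lebesgue mf); last by case/andP: asb => _ /ltW.
  rewrite Rintegral_itv_bndo_bndc; last first.
    apply/(restr_mint lam (measurable_oo a s) mf').
    apply/(restr_mint lam (measurable_oo a s) mf').
    have /(restr_mint lam (measurable_oo a b) mf') := mf.
    apply: integrableS; [exact: measurable_oo|exact: measurable_oo|].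
    by move=> x /=; rewrite !in_itv/= => /andP[-> xs]; case/andP: asb => _; exact: lt_trans.
  rewrite /ft -Rintegral_mkcondr; congr (Rintegral _ _ _).
  apply/seteqP; split => x /=; rewrite !in_itv/=.
    by move=> [-> /andP[-> _]].
  move=> /andP[ax xs]; split=> //; rewrite ax /=.
  by case/andP: asb => _; exact: le_lt_trans.
apply/(restr_ae lam (measurable_oo a b)).
have := FTC1Ny ifty loc; apply: filterS; first exact: (ae_filter_ringOfSetsType lam).
move=> x [dF F'] /=; rewrite in_itv/= => axb.
have <- : ft x = f x by rewrite /ft patchE mem_set//= in_itv/=.
rewrite -F' derive1E (@near_eq_derive _ _ _ _ (cst c)); first by rewrite derive_cst.
have /andP[ax xb] := axb; near=> s; apply: FP; apply/andP; split.
- by near: s; exact: lt_nbhsr.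
- by near: s; exact: lt_nbhsl.
Unshelve. all: by end_near. Qed.

Lemma prim_bump0 f (p q : R) : mint m f -> a < p -> p < q -> q < b ->
  (forall n, \int[m]_x (f x * bump p q n x) = 0) -> prim a b f p = prim a b f q.
Proof.
move=> mf ap pq qb h; apply/esym/eqP; rewrite -subr_eq0; apply/eqP.
have mf' := mint_measurable mf.
rewrite /prim -RintegralB//; [|exact: mint_chi..].
have mind : measurable_fun [set: mR] (\1_([set` `]p, q[]) : R -> R).
  by apply: measurable_indic; exact: measurable_oo.
have -> : \int[m]_x (chi q x * f x - chi p x * f x) =
    \int[m]_x (f x * \1_([set` `]p, q[]) x).
  apply: Rint_ae_eq.
  - by apply: measurable_funB; apply: (@mint_measurable _ _ _ m); exact: mint_chi.
  - exact: measurable_funM.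
  apply: filterS (mI_neq a b p) => x xp; rewrite -mulrBl mulrC; congr (_ * _).
  rewrite indicE /chi; case: (ltgtP x p) xp => // xp _.
    by rewrite (lt_trans xp pq) subrr memNset//= in_itv/= ltNge (ltW xp).
  rewrite subr0; case: (ltP x q) => xq; first by rewrite mem_set//= in_itv/= xp.
  by rewrite memNset//= in_itv/= xp ltNge xq.
have cv : \int[m]_x (f x * bump p q n x) @[n --> \oo] -->
    \int[m]_x (f x * \1_([set` `]p, q[]) x).
  apply: (@Rint_cvg _ _ _ m (fun n x => f x * bump p q n x)
    (fun x => f x * \1_([set` `]p, q[]) x) (fun x => `|f x|)).
  - move=> n; apply: measurable_funM => //; apply: continuous_measurable_fun.
    exact: (sm_continuous (smooth_bump p q n 0)).
  - exact: measurable_funM.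
  - by apply: aeW => x; apply: cvgM; [exact: cvg_cst|exact: bump_cvg].
  - exact: mint_norm.
  - by move=> n; apply: aeW => x; rewrite normrM ler_piMr// bump_norm_le1.
have : \int[m]_x (f x * bump p q n x) @[n --> \oo] --> (0 : R).
  by under eq_fun do rewrite h; exact: cvg_cst.
by move=> /(cvg_unique _ cv); apply.
Qed.

(** The bumps tend to indicators, so the primitive takes equal values at rational points, and by
    continuity everywhere. Rational endpoints keep the family of tests countable. *)
Lemma du_bois_reymond f : mint m f ->
  (forall (p q : rat) n, a < ratr p -> ratr p < ratr q :> R -> ratr q < b ->
     \int[m]_x (f x * bump (ratr p) (ratr q) n x) = 0) ->
  {ae m, forall x, f x = 0}.
Proof.
move=> mf h; have cP := prim_continuous mf.
have [p0] := rat_in_itvoo ab; rewrite in_itv/= => /andP[ap0 p0b].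
have ratP (p q : rat) : a < ratr p < b -> a < ratr q < b ->
    prim a b f (ratr p) = prim a b f (ratr q).
  move=> /andP[ap pb] /andP[aq qb].
  case: (ltgtP (ratr p : R) (ratr q)) => [pq|qp|->//].
    by apply: prim_bump0 => // n; exact: h.
  by apply/esym; apply: prim_bump0 => // n; exact: h.
apply: (@prim_cst_ae0 f (prim a b f (ratr p0))) => // s /andP[as_ sb].
apply/eqP; rewrite -subr_eq0 -normr_le0; apply/ler_addgt0Pr => e e0; rewrite add0r.
have /cvgrPdist_lt/(_ _ e0) := cP s.
rewrite -nbhs_ballE => -[d /= d0 hd].
have [|q] := @rat_in_itvoo R s (Num.min b (s + d)).
  by rewrite lt_min sb ltrDl.
rewrite in_itv/= lt_min => /and3P[sq qb qd].
rewrite (ratP p0 q); [|by rewrite ap0 p0b|by rewrite (lt_trans as_ sq) qb].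
apply: ltW; apply: hd; rewrite /ball/= distrC gtr0_norm ?subr_gt0//.
by rewrite ltrBlDl.
Qed.

Definition test1 (A : R -> R) := smooth A /\
  exists p q : R, [/\ a < p, p < q, q < b & forall x, x \notin `]p, q[ -> A x = 0].

Lemma test1_bump (p q : R) n : a < p -> p < q -> q < b -> test1 (bump p q n).
Proof.
move=> ap pq qb; split; first exact: smooth_bump.
by exists p, q; split => // x; exact: bump_out.
Qed.

Lemma test1_lin k A B : test1 A -> test1 B -> test1 (fun x => k * A x + B x).
Proof.
move=> [sA [p [q [ap pq qb A0]]]] [sB [r [t [ar pt tb B0]]]]; split.
  by move=> n; apply: sm_lin.
exists (Num.min p r), (Num.max q t); split.
- by rewrite lt_min ap ar.
- by rewrite gt_min !lt_max pq.
- by rewrite gt_max qb tb.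
- move=> x; rewrite in_itv/= gt_min lt_max negb_and !negb_or -!leNgt => h.
  have [/negbT xp /negbT xq] : (x \in `]p, q[) = false /\ (x \in `]r, t[) = false.
    split; apply/negbTE; rewrite in_itv/= negb_and -!leNgt;
    by case/orP: h => /andP[h1 h2]; rewrite ?h1 ?h2 ?orbT.
  by rewrite A0// B0// mulr0 addr0.
Qed.

Lemma test1_continuous A : test1 A -> continuous A.
Proof. by move=> [sA _]; exact: (sm_continuous (sA 0%N)). Qed.

Lemma test1_lam A : test1 A -> lam.-integrable setT (EFin \o A).
Proof.
move=> tA; have cA := test1_continuous tA; move: tA => [sA [p [q [ap pq qb A0]]]].
rewrite (_ : EFin \o A = (EFin \o A) \_ `[p, q]%classic).
  apply/integrable_restrict => //; rewrite setTI.
  apply: continuous_compact_integrable; first exact: segment_compact.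
  exact: continuous_subspaceT.
apply/funext => x; rewrite patchE; case: ifPn => //=; rewrite notin_setE/= => xpq.
rewrite A0//; apply/negP => xpq'; apply: xpq; exact: subset_itv_oo_cc xpq'.
Qed.

Lemma test1_mint A : test1 A -> mint m A.
Proof.
move=> tA; have mA : measurable_fun [set: mR] A.
  by apply: continuous_measurable_fun; exact: test1_continuous.
apply/(restr_mint lam (measurable_oo a b) mA).
by apply: integrableS (test1_lam tA) => //; exact: measurable_oo.
Qed.

Lemma test1_Rint_subset A (D : set R) : test1 A -> measurable (D : set mR) ->
  (forall p q, (forall x, x \notin `]p, q[ -> A x = 0) -> a < p -> q < b ->
     [set` `]p, q[] `<=` D) ->
  \int[lam]_(x in D) A x = \int[lam]_x A x.
Proof.
move=> [sA [p [q [ap pq qb A0]]]] mD pqD; rewrite Rintegral_mkcond.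
apply: eq_Rintegral => x _; rewrite patchE; case: ifPn => //; rewrite notin_setE => nDx.
by rewrite A0//; apply/negP => xpq; apply: nDx; exact: (pqD p q A0 ap qb).
Qed.

(** The primitive from [-oo] vanishes to the left of the support, and to its right because the total
    integral is 0. *)
Lemma test1_primitive A : test1 A -> \int[m]_x A x = 0 ->
  exists2 B : R -> R, test1 B & forall x : R, is_derive x 1 B (A x).
Proof.
move=> tA IA; have cA := test1_continuous tA; have iA := test1_lam tA.
have mA : measurable_fun [set: mR] A by exact: continuous_measurable_fun.
have IA0 : \int[lam]_x A x = 0.
  rewrite -[RHS]IA (restr_Rint lam (measurable_oo a b))//.
  rewrite test1_Rint_subset//.
  by move=> p q _ ap qb x /=; rewrite !in_itv/= => /andP[/(lt_trans ap)-> /lt_trans->].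
pose B x := \int[lam]_(t in [set` Interval -oo%O (BRight x)]) A t.
have dB (x : R) : is_derive x 1 B (A x).
  have [|||dB B'] := @continuous_FTC1 R A -oo%O x (x + 1) _ _ _ (cA x).
  - by rewrite ltrDl.
  - by apply: integrableS iA => //; exact: measurable_itv.
  - by rewrite ltNyr.
  exact: (DeriveDef dB (etrans (esym (derive1E _ _)) B')).
exists B => //; split.
  move=> n; have [sA _] := tA.
  by case: n => [|n]; exists A => //; exact: sA.
have [sA [p [q [ap pq qb A0]]]] := tA.
exists p, q; split => // x; rewrite in_itv/= negb_and -!leNgt => /orP[xp|qx].
  transitivity (\int[lam]_(t in [set` Interval -oo%O (BRight x)]) (0 : R)); last first.
    by rewrite Rintegral_cst ?mul0r.
  apply: eq_Rintegral => t; rewrite inE/= in_itv/= => tx; apply: A0.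
  by rewrite in_itv/= negb_and -leNgt (le_trans tx xp).
rewrite /B -[RHS]IA0 Rintegral_mkcond; apply: eq_Rintegral => t _.
rewrite patchE; case: ifPn => //; rewrite notin_setE/= in_itv/= => /negP.
rewrite -ltNge => xt; rewrite A0// in_itv/= negb_and -!leNgt.
by rewrite (le_trans qx (ltW xt)) orbT.
Qed.

End one_dim_tests.

Section ac1.
Context {R : realType} (a b : R).
Hypothesis ab : a < b.
Local Notation lam := (@lebesgue_measure R).
Local Notation mR := (measurableTypeR R).
Local Notation m := (mI a b).
Implicit Types (f g w r : R -> R).

(** Absolute continuity with derivative [g], up to a null set, since [f] will be a slice of a
    function known only a.e. *)
Definition ac1 f g := mint m g /\ exists k, {ae m, forall s, f s = k + prim a b g s}.

(* The kernel recovering a function from its mean value and its derivative, see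
   [ac1_avg]. *)
Definition kap s x := chi s x - (b - x) / (b - a).

(** Product rule: expanding the product of the two representations leaves one nontrivial term, the
    product of primitives, given by [prim_mul]. *)
Lemma ac1_mul f g f' g' : measurable_fun [set: mR] f -> measurable_fun [set: mR] f' ->
  ac1 f g -> ac1 f' g' -> ac1 (fun x => f x * f' x) (fun x => g x * f' x + f x * g' x).
Proof.
move=> mf mf' [ig [k fE]] [ig' [k' fE']].
have mg := mint_measurable ig; have mg' := mint_measurable ig'.
pose h x := k' * g x + (k * g' x + (g x * prim a b g' x + prim a b g x * g' x)).
have iP : mint m (fun x => g x * prim a b g' x + prim a b g x * g' x).
  apply: mintD; last exact: mint_mul_prim.
  by have := mint_mul_prim ig' ig; congr (mint _ _); apply/funext => x; rewrite mulrC.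
have ih : mint m h by do 2 apply: mint_lin => //.
have hE : {ae m, forall x, h x = g x * f' x + f x * g' x}.
  by apply: filterS2 fE fE' => x -> ->; rewrite /h; ring.
have mh' : measurable_fun [set: mR] (fun x => g x * f' x + f x * g' x).
  by apply: measurable_funD; apply: measurable_funM.
split; first exact: ae_eq_mint mh' hE ih.
exists (k * k'); apply: filterS2 fE fE' => s -> ->.
have -> : prim a b (fun x => g x * f' x + f x * g' x) s = prim a b h s.
  apply: Rint_ae_eq.
  - by apply: measurable_funM => //; exact: measurable_chi.
  - by apply: measurable_funM; [exact: measurable_chi|exact: (mint_measurable ih)].
  - by apply: filterS hE => x ->.
rewrite /h prim_lin//; last exact: mint_lin.
by rewrite prim_lin// -prim_mul//; ring.
Qed.

Lemma prim_derive (A A' : R -> R) s : (forall x : R, is_derive x 1 A (A' x)) ->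
  continuous A' -> A a = 0 -> mint m A' -> a < s -> s <= b -> prim a b A' s = A s.
Proof.
move=> dA cA' Aa iA' as_ sb; rewrite (prim_lebesgue iA' sb).
have cs : {within `[a, s], continuous A'} by exact: continuous_subspaceT.
have ics : lam.-integrable `[a, s] (EFin \o A').
  by apply: continuous_compact_integrable => //; exact: segment_compact.
rewrite Rintegral_itv_bndo_bndc; last first.
  by apply: integrableS ics => //; exact: subset_itv_oo_cc.
rewrite Rintegral_itv_obnd_cbnd; last first.
  by apply: integrableS ics => //; exact: subset_itv_oc_cc.
rewrite /Rintegral (@continuous_FTC2 _ _ A) ?Aa ?sube0//=.
- split.
  + by move=> x _; have [] := dA x.
  + apply: cvg_at_right_filter; apply: differentiable_continuous.
    by apply/derivable1_diffP; have [] := dA a.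
  + apply: cvg_at_left_filter; apply: differentiable_continuous.
    by apply/derivable1_diffP; have [] := dA s.
- by move=> x _; rewrite derive1E; have [_ ->] := dA x.
Qed.

Lemma ac1_parts f g (A A' : R -> R) : measurable_fun [set: mR] f -> ac1 f g ->
  (forall x : R, is_derive x 1 A (A' x)) -> continuous A' -> A a = 0 -> A b = 0 ->
  mint m (fun x => f x * A' x) /\ \int[m]_x (f x * A' x) = - \int[m]_x (g x * A x).
Proof.
move=> mf [ig [k fE]] dA cA' Aa Ab.
have cA : continuous A.
  move=> x; apply: differentiable_continuous.
  by apply/derivable1_diffP; have [] := dA x.
have iA' : mint m A'.
  have mA' : measurable_fun [set: mR] A' by exact: continuous_measurable_fun.
  apply/(restr_mint lam (measurable_oo a b) mA').
  have icc : lam.-integrable `[a, b] (EFin \o A').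
    apply: continuous_compact_integrable; first exact: segment_compact.
    exact: continuous_subspaceT.
  by apply: integrableS icc => //; exact: subset_itv_oo_cc.
have mA : measurable_fun [set: mR] A by exact: continuous_measurable_fun.
have AE : {ae m, forall x, A x = prim a b A' x}.
  apply: filterS (mI_in a b) => x /andP[ax xb].
  by rewrite (prim_derive dA)// ltW.
(* At [s = b] the primitive of [A'] is [A b = 0], so the product rule loses its boundary term. *)
have := prim_mul b ig iA'; rewrite (prim_derive dA cA' Aa iA' ab (lexx b)) Ab mulr0.
have igP : mint m (fun x => g x * prim a b A' x).
  by have := mint_mul_prim iA' ig; congr (mint _ _); apply/funext => x; rewrite mulrC.
have iPA := mint_mul_prim ig iA'.
rewrite (prim_ge (mintD igP iPA) (lexx b)) RintegralD// => /eqP.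
rewrite eq_sym addrC addr_eq0 => /eqP E1.
have mfA' : measurable_fun [set: mR] (fun x => f x * A' x).
  by apply: measurable_funM => //; exact: (mint_measurable iA').
have fA'E : {ae m, forall x, k * A' x + prim a b g x * A' x = f x * A' x}.
  by apply: filterS fE => x ->; rewrite mulrDl.
split; first exact: (ae_eq_mint mfA' fA'E (mint_lin k iA' iPA)).
rewrite -(Rint_ae_eq (mint_measurable (mint_lin k iA' iPA)) mfA' fA'E).
rewrite Rint_lin// E1 -(prim_ge iA' (lexx b)) (prim_derive dA)// Ab mulr0 add0r.
congr (- _); apply: Rint_ae_eq.
- exact: mint_measurable igP.
- by apply: measurable_funM => //; exact: mint_measurable ig.
- by apply: filterS AE => x ->.
Qed.

Lemma prim1 s : a < s -> s <= b -> prim a b (fun=> 1) s = s - a.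
Proof.
move=> as_ sb; have dA (x : R) : is_derive x 1 (fun t => t - a) 1.
  rewrite -[X in is_derive _ _ _ X]subr0; exact: (is_deriveB (is_derive_id x 1)).
rewrite (prim_derive dA) ?subrr//; first by move=> x; exact: cvg_cst.
exact: mint_cst.
Qed.

Lemma mass_mI : \int[m]_x (1 : R) = b - a.
Proof. by rewrite -(prim_ge (mint_cst _ 1) (lexx b)) prim1. Qed.

Lemma kap_norm_le1 s x : a < x < b -> `|kap s x| <= 1.
Proof.
move=> /andP[ax xb]; rewrite /kap.
have ba0 : 0 < b - a by rewrite subr_gt0.
have h0 : 0 <= (b - x) / (b - a) by rewrite divr_ge0 ?subr_ge0 ?ltW.
have h1 : (b - x) / (b - a) <= 1 by rewrite ler_pdivrMr// mul1r lerD2l lerN2 ltW.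
by rewrite ler_norml /chi; case: ltP => _ /=; apply/andP; split; lra.
Qed.

Lemma measurable_kap s : measurable_fun [set: mR] (kap s).
Proof.
apply: measurable_funB; first exact: measurable_chi.
by apply: measurable_funM => //; apply: measurable_funB.
Qed.

Lemma mint_kap s g : mint m g -> mint m (fun x => kap s x * g x).
Proof.
move=> ig; have mg := mint_measurable ig.
apply: (mint_ae_le _ (mint_norm ig)).
  by apply: measurable_funM => //; exact: measurable_kap.
apply: filterS (mI_in a b) => x xab.
by rewrite normrM ler_piMl// kap_norm_le1.
Qed.

Lemma kap_norm s g : mint m g -> `|\int[m]_x (kap s x * g x)| <= \int[m]_x `|g x|.
Proof.
move=> ig; apply: le_trans (le_normr_Rintegral _ (mint_kap s ig)) _ => //.
apply: Rint_ae_le; [exact: (mint_norm (mint_kap s ig))|exact: mint_norm|].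
apply: filterS (mI_in a b) => x xab.
by rewrite normrM ler_piMl// kap_norm_le1.
Qed.

(* The mean value of [prim g] is obtained by integrating it by parts against
   the primitive [s - a] of 1. *)
Lemma ac1_avg f g : measurable_fun [set: mR] f -> ac1 f g ->
  {ae m, forall s, f s = (b - a)^-1 * \int[m]_x f x + \int[m]_x (kap s x * g x)}.
Proof.
move=> mf [ig [k fE]]; have ba0 : b - a != 0 by rewrite subr_eq0 gt_eqF.
have i1 := mint_cst m (1 : R); have iP := mint_prim ig.
have igx : mint m (fun x => g x * (x - a)).
  have mgx : measurable_fun [set: mR] (fun x => g x * (x - a)).
    by apply: measurable_funM; [exact: mint_measurable ig|exact: measurable_funB].
  apply: (mint_ae_le mgx (mintZ (b - a) (mint_norm ig))).
  apply: filterS (mI_in a b) => x /andP[ax xb]; rewrite normrM mulrC.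
  by rewrite ler_wpM2r// ger0_norm ?subr_ge0 ?ltW// ltrD2r.
have E1 : prim a b g b * (b - a) = \int[m]_x (g x * (x - a)) + \int[m]_x prim a b g x.
  have := prim_mul b ig i1; rewrite prim1// => ->.
  have ig1 : mint m (fun x => g x * prim a b (fun=> 1) x).
    by have := mint_mul_prim i1 ig; congr (mint _ _); apply/funext => x; rewrite mulrC.
  have iP1 := mint_mul_prim ig i1.
  rewrite (prim_ge (mintD ig1 iP1) (lexx b)) RintegralD//; congr (_ + _).
    apply: Rint_ae_eq; [exact: mint_measurable ig1|exact: mint_measurable igx|].
    by apply: filterS (mI_in a b) => x /andP[ax xb]; rewrite prim1// ltW.
  by apply: eq_Rintegral => x _; rewrite mulr1.
have If : \int[m]_x f x = k * (b - a) + \int[m]_x prim a b g x.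
  rewrite -mass_mI -(Rint_lin k i1 iP).
  apply: Rint_ae_eq => //; first exact: mint_measurable (mint_lin k i1 iP).
  by apply: filterS fE => x ->; rewrite mulr1.
apply: filterS fE => s ->; rewrite If.
have -> : \int[m]_x (kap s x * g x) =
    - (b - a)^-1 * (prim a b g b * (b - a) - \int[m]_x (g x * (x - a))) + prim a b g s.
  have -> : \int[m]_x (kap s x * g x) =
      \int[m]_x (- 1 * g x + ((b - a)^-1 * (g x * (x - a)) + chi s x * g x)).
    by apply: eq_Rintegral => x _; rewrite /kap; field.
  have ic := mint_chi s ig.
  rewrite Rint_lin//; last exact: mint_lin.
  by rewrite Rint_lin// -(prim_ge ig (lexx b)) /prim; field.
rewrite E1; by field.
Qed.

End ac1.

(** * Weak derivatives and slices *)

Section test_families.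
Context {R : realType} (a b : R).
Hypothesis ab : a < b.
Local Notation mR := (measurableTypeR R).
Local Notation m := (mI a b).
Implicit Types (f g : R -> R).

Lemma test1_0 : test1 a b (fun=> 0).
Proof.
split; first by move=> n; exact: sm_cst.
exists (a + (b - a) / 3), (b - (b - a) / 3); split => //; move: ab; lra.
Qed.

Lemma test1_bounded B : test1 a b B -> exists M, forall x, a < x < b -> `|B x| <= M.
Proof.
move=> tB; have /compact_bounded [M [_ hM]] : compact (B @` `[a, b]%classic).
  apply: continuous_compact; last exact: segment_compact.
  apply: continuous_subspaceT; exact: test1_continuous tB.
exists (M + 1) => x /andP[ax xb]; apply: hM; first by rewrite ltrDl.
by exists x => //=; rewrite in_itv/= !ltW.
Qed.

(** Bumps with rational endpoints, indexed by codes, invalid codes giving 0. With a sequence of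
    tests, the quantifier over tests commutes with the one over almost every slice. *)
Lemma test_family0 : exists al : nat -> R -> R, (forall i, test1 a b (al i)) /\
  forall f, mint m f -> (forall i, \int[m]_x (f x * al i x) = 0) ->
    {ae m, forall x, f x = 0}.
Proof.
pose al (i : nat) : R -> R :=
  if unpickle i is Some (p, q, n) then
    if [&& a < ratr p, ratr p < ratr q :> R & ratr q < b] then
      bump (ratr p : R) (ratr q) n else fun=> 0
  else fun=> 0.
exists al; split.
  move=> i; rewrite /al; case: unpickle => [[[p q] n]|]; last exact: test1_0.
  by case: ifPn => [/and3P[? ? ?]|_]; [exact: test1_bump|exact: test1_0].
move=> f mf h; apply: (du_bois_reymond ab mf) => p q n ap pq qb.
have := h (pickle (p, q, n) : nat); rewrite /al pickleK.
by rewrite ap pq qb.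
Qed.

(** If every test of the family had integral 0, the constant 1 would vanish a.e. on an interval of
    positive length. *)
Lemma test_unit_mass : exists2 eta, test1 a b eta & \int[m]_x eta x = 1.
Proof.
have [al [tal hal]] := test_family0.
have [i ci] : exists i, \int[m]_x al i x != 0.
  apply: contrapT => /forallNP h.
  have := hal (fun=> 1) (mint_cst m 1).
  have h1 i : \int[m]_x (1 * al i x) = 0.
    by under eq_Rintegral do rewrite mul1r; have /negP := h i; rewrite negbK => /eqP.
  move=> /(_ h1) h2.
  have mc (k : R) : measurable_fun [set: mR] (fun _ : mR => k) by exact: measurable_cst.
  have := @Rint_ae_eq _ _ _ m (fun=> 1) (fun=> 0) (mc 1) (mc 0) h2.
  rewrite mass_mI// Rintegral_cst// mul0r => /eqP; rewrite subr_eq0 gt_eqF//.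
set k := \int[m]_x al i x in ci.
exists (fun x => k^-1 * al i x + 0); first exact: (test1_lin k^-1 (tal i) test1_0).
under eq_Rintegral do rewrite addr0.
by rewrite RintegralZl//; [rewrite mulVf|exact: test1_mint].
Qed.

(** In one variable, a weak derivative against countably many tests already gives absolute
    continuity. *)
Lemma test_family1 : exists A A' : nat -> R -> R,
  (forall i, [/\ test1 a b (A i), test1 a b (A' i) &
     forall x : R, is_derive x 1 (A i) (A' i x)]) /\
  forall f g, mint m f -> mint m g ->
    (forall i, \int[m]_x (f x * A' i x) = - \int[m]_x (g x * A i x)) -> ac1 a b f g.
Proof.
have [al [tal hal]] := test_family0; have [eta teta Ieta] := test_unit_mass.
(* Subtracting the mass carried by [eta] gives mean zero, the condition for having a primitive among
   the tests. *)
pose A' i x := - (\int[m]_x al i x) * eta x + al i x.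
have tA' i : test1 a b (A' i) by exact: test1_lin.
have IA' i : \int[m]_x A' i x = 0.
  rewrite /A' Rint_lin ?Ieta; [by rewrite mulr1 addNr|exact: test1_mint|exact: test1_mint].
have ex i : exists B, test1 a b B /\ forall x : R, is_derive x 1 B (A' i x).
  by have [B tB dB] := test1_primitive (tA' i) (IA' i); exists B.
have [A hA] := choice ex.
exists A, A'; split; first by move=> i; have [tA dA] := hA i; split.
move=> f g mf mg h; split => //.
have iP := mint_prim mg; have imP := mintB mf iP.
have mul_test F B : mint m F -> test1 a b B -> mint m (fun x => F x * B x).
  move=> iF tB; have iB := test1_mint tB.
  have mFB : measurable_fun [set: mR] (fun x => F x * B x).
    by apply: measurable_funM; [exact: mint_measurable iF|exact: mint_measurable iB].
  have [M hM] := test1_bounded tB.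
  apply: (mint_ae_le mFB (mintZ M (mint_norm iF))).
  apply: filterS (mI_in a b) => x /hM; rewrite normrM mulrC.
  exact: ler_wpM2r.
have PA i : \int[m]_x (prim a b g x * A' i x) = - \int[m]_x (g x * A i x).
  have [[sA [p [q [ap pq qb A0]]]] dA] := hA i.
  apply: (ac1_parts ab _ _ dA _ _ _).2.
  - exact: mint_measurable iP.
  - by split => //; exists 0; apply: aeW => x; rewrite add0r.
  - exact: test1_continuous (tA' i).
  - by apply: A0; rewrite in_itv/= negb_and -leNgt (ltW ap).
  - by apply: A0; rewrite in_itv/= negb_and -!leNgt (ltW qb) orbT.
(* Orthogonality of [f - prim g] to every [A' i] means that its integral against [al i] is [k] times
   that of [al i]; hence [f - prim g - k] is orthogonal to the whole family. *)
pose k := \int[m]_x ((f x - prim a b g x) * eta x); exists k.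
have ik := mint_cst m k.
have : {ae m, forall x, f x - prim a b g x - k = 0}.
  apply: hal; first exact: mintB.
  move=> i.
  have -> : \int[m]_x ((f x - prim a b g x - k) * al i x) =
     \int[m]_x (- k * al i x + (f x - prim a b g x) * al i x).
    by apply: eq_Rintegral => x _; ring.
  rewrite Rint_lin; [|exact: test1_mint|exact: mul_test].
  have -> : \int[m]_x ((f x - prim a b g x) * al i x) =
     \int[m]_x (\int[m]_x al i x * ((f x - prim a b g x) * eta x) +
        (f x * A' i x - prim a b g x * A' i x)).
    by apply: eq_Rintegral => x _; rewrite /A'; ring.
  rewrite Rint_lin; [|exact: mul_test|by apply: mintB; exact: mul_test].
  rewrite RintegralB; [|by []|exact: mul_test|exact: mul_test].
  by rewrite h PA -/k; ring.
by apply: filterS => x /eqP; rewrite -addrA -opprD subr_eq0 addrC => /eqP.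
Qed.

End test_families.

Section rect_fubini.
Context {R : realType} (a b c d : R).
Local Notation mR := (measurableTypeR R).
Local Notation mx := (mI a b).
Local Notation my := (mI c d).
Local Notation m := (mrect a b c d).
Local Notation mxy := (mx \x my)%E.
Implicit Types (F G v w : R * R -> R).

Lemma mrect_mint F : mint m F <-> mint mxy F.
Proof.
by split; apply: eq_measure_mint => A mA; [|apply/esym]; exact: mrectE.
Qed.

Lemma mrect_ae (P : R * R -> Prop) : {ae m, forall z, P z} <-> {ae mxy, forall z, P z}.
Proof. by split; apply: eq_measure_ae => A mA; [|apply/esym]; exact: mrectE. Qed.

Lemma mrect_Rint F : \int[m]_z F z = \int[mxy]_z F z.
Proof. by apply: eq_measure_Rint => A mA; exact: mrectE. Qed.

Lemma rect_Rint1 F : mint m F -> \int[m]_z F z = \int[mx]_x \int[my]_y F (x, y).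
Proof. by move=> /mrect_mint iF; rewrite mrect_Rint fubini_R1. Qed.

Lemma rect_Rint2 F : mint m F -> \int[m]_z F z = \int[my]_y \int[mx]_x F (x, y).
Proof. by move=> /mrect_mint iF; rewrite mrect_Rint fubini_R2. Qed.

Lemma rect_sec1 F : mint m F -> {ae mx, forall x, mint my (fun y => F (x, y))}.
Proof. by move=> /mrect_mint; exact: mint_sec1. Qed.

Lemma rect_sec2 F : mint m F -> {ae my, forall y, mint mx (fun x => F (x, y))}.
Proof. by move=> /mrect_mint; exact: mint_sec2. Qed.

Lemma rect_mint1 F : mint m F -> mint mx (fun x => \int[my]_y F (x, y)).
Proof. by move=> /mrect_mint; exact: mint_Rint1. Qed.

Lemma rect_mint2 F : mint m F -> mint my (fun y => \int[mx]_x F (x, y)).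
Proof. by move=> /mrect_mint; exact: mint_Rint2. Qed.

Lemma rect_tensor (f g : R -> R) : mint mx f -> mint my g ->
  mint m (fun z => f z.1 * g z.2).
Proof. by move=> mf mg; apply/mrect_mint; exact: mint_tensor. Qed.

Lemma rect_ae1 (P : R * R -> Prop) : {ae m, forall z, P z} ->
  {ae mx, forall x, {ae my, forall y, P (x, y)}}.
Proof. by move=> /mrect_ae; exact: ae_sec1. Qed.

Lemma rect_ae2 (P : R * R -> Prop) : {ae m, forall z, P z} ->
  {ae my, forall y, {ae mx, forall x, P (x, y)}}.
Proof. by move=> /mrect_ae; exact: ae_sec2. Qed.

Lemma rect_ae_eq2 F G : measurable_fun [set: mR * mR] F ->
  measurable_fun [set: mR * mR] G ->
  {ae my, forall y, {ae mx, forall x, F (x, y) = G (x, y)}} ->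
  {ae m, forall z, F z = G z}.
Proof. by move=> mF mG h; apply/mrect_ae; exact: ae_eq_prod2. Qed.

Lemma rect_in : {ae m, forall z, a < z.1 < b /\ c < z.2 < d}.
Proof.
have h : {ae m, forall z, rect a b c d z} := restr_in _ (measurable_rect a b c d).
by apply: filterS h => z [/=]; rewrite !in_itv.
Qed.

End rect_fubini.

Section wdx.
Context {R : realType} (a b c d : R).
Hypotheses (ab : a < b) (cd : c < d).
Local Notation mR := (measurableTypeR R).
Local Notation mx := (mI a b).
Local Notation my := (mI c d).
Local Notation m := (mrect a b c d).
Implicit Types (F G v w : R * R -> R) (f g : R -> R).

(* [w] is the x-derivative of [v] in the sense of absolutely continuous slices; this
   is equivalent to the weak sense ([weak_wdx], [wdx_weak]). *)
Definition wdx v w :=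
  {ae my, forall y, ac1 a b (fun x => v (x, y)) (fun x => w (x, y))}.

Lemma mint_mul_test2 v f g : mint m v -> test1 a b f -> test1 c d g ->
  mint m (fun z => v z * (f z.1 * g z.2)).
Proof.
move=> iv tf tg; have [M hM] := test1_bounded tf; have [N hN] := test1_bounded tg.
have mf : measurable_fun [set: mR] f.
  by apply: continuous_measurable_fun; exact: test1_continuous tf.
have mg : measurable_fun [set: mR] g.
  by apply: continuous_measurable_fun; exact: test1_continuous tg.
have mF : measurable_fun [set: mR * mR] (fun z => v z * (f z.1 * g z.2)).
  apply: measurable_funM; first exact: mint_measurable iv.
  by apply: measurable_funM; [exact: measurableT_comp|exact: measurableT_comp].
apply: (mint_ae_le mF (mintZ (M * N) (mint_norm iv))).
apply: filterS (rect_in a b c d) => z [/hM h1 /hN h2].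
by rewrite normrM mulrC ler_wpM2r// normrM ler_pM.
Qed.

Lemma mint_mul_test1 v f : mint m v -> test1 a b f -> mint m (fun z => v z * f z.1).
Proof.
move=> iv tf; have [M hM] := test1_bounded tf.
have mf : measurable_fun [set: mR] f.
  by apply: continuous_measurable_fun; exact: test1_continuous tf.
have mF : measurable_fun [set: mR * mR] (fun z => v z * f z.1).
  apply: measurable_funM; [exact: mint_measurable iv|exact: measurableT_comp].
apply: (mint_ae_le mF (mintZ M (mint_norm iv))).
apply: filterS (rect_in a b c d) => z [/hM h1 _].
by rewrite normrM mulrC ler_wpM2r.
Qed.

Lemma slices_ae0 F f : mint m F -> test1 a b f ->
  (forall g, test1 c d g -> \int[m]_z (F z * (f z.1 * g z.2)) = 0) ->
  {ae my, forall y, \int[mx]_x (F (x, y) * f x) = 0}.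
Proof.
move=> iF tf h; have [al [tal hal]] := test_family0 cd.
have iFf := mint_mul_test1 iF tf.
apply: hal; first exact: rect_mint2 iFf.
move=> j; rewrite -[RHS](h _ (tal j)) rect_Rint2; last exact: mint_mul_test2.
apply: Rint_ae_eq.
- apply: measurable_funM; first exact: mint_measurable (rect_mint2 iFf).
  by apply: continuous_measurable_fun; exact: test1_continuous (tal j).
- exact: mint_measurable (rect_mint2 (mint_mul_test2 iF tf (tal j))).
apply: filterS (rect_sec2 iFf) => y iy.
rewrite -RintegralZr//; apply: eq_Rintegral => x _ /=; ring.
Qed.

Lemma rect_du_bois_reymond F : mint m F ->
  (forall f g, test1 a b f -> test1 c d g -> \int[m]_z (F z * (f z.1 * g z.2)) = 0) ->
  {ae m, forall z, F z = 0}.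
Proof.
move=> iF h; have [al [tal hal]] := test_family0 ab.
have hs i := slices_ae0 iF (tal i) (fun g => h _ g (tal i)).
apply: rect_ae_eq2; [exact: mint_measurable iF|exact: measurable_cst|].
apply: filterS2 (ae_foralln hs) (rect_sec2 iF) => y hy iy.
exact: hal.
Qed.

(** Tensor tests suffice. For each pair of [test_family1], varying [g] yields the one-dimensional
    weak identity on almost every slice; the family being countable, one null set of [y] serves all
    pairs. *)
Lemma weak_wdx v w : mint m v -> mint m w ->
  (forall A A' g, test1 a b A -> test1 a b A' -> (forall x : R, is_derive x 1 A (A' x)) ->
     test1 c d g ->
     \int[m]_z (v z * (A' z.1 * g z.2)) = - \int[m]_z (w z * (A z.1 * g z.2))) ->
  wdx v w.
Proof.
move=> iv iw h; have [A [A' [hA hac]]] := test_family1 ab.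
have [al [tal hal]] := test_family0 cd.
have hs i : {ae my, forall y, \int[mx]_x (v (x, y) * A' i x) =
    - \int[mx]_x (w (x, y) * A i x)}.
  have [tA tA' dA] := hA i.
  have i1 := mint_mul_test1 iv tA'; have i2 := mint_mul_test1 iw tA.
  have : {ae my, forall y, \int[mx]_x (v (x, y) * A' i x) + \int[mx]_x (w (x, y) * A i x) = 0}.
    apply: hal; first by apply: mintD; [exact: rect_mint2 i1|exact: rect_mint2 i2].
    move=> j; have := h _ _ _ tA tA' dA (tal j).
    have j1 := mint_mul_test2 iv tA' (tal j); have j2 := mint_mul_test2 iw tA (tal j).
    rewrite (rect_Rint2 j1) (rect_Rint2 j2) => /eqP.
    rewrite -addr_eq0 => /eqP E; rewrite -[RHS]E.
    rewrite -RintegralD//; [|exact: rect_mint2 j1|exact: rect_mint2 j2].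
    apply: Rint_ae_eq.
    - apply: measurable_funM; last first.
        by apply: continuous_measurable_fun; exact: test1_continuous (tal j).
      by apply: measurable_funD; [exact: mint_measurable (rect_mint2 i1)|
        exact: mint_measurable (rect_mint2 i2)].
    - by apply: measurable_funD; [exact: mint_measurable (rect_mint2 j1)|
        exact: mint_measurable (rect_mint2 j2)].
    apply: filterS2 (rect_sec2 i1) (rect_sec2 i2) => y iy1 iy2.
    rewrite mulrDl -!RintegralZr//; congr (_ + _);
      by apply: eq_Rintegral => x _ /=; ring.
  by apply: filterS => y /eqP; rewrite addr_eq0 => /eqP.
apply: filterS3 (ae_foralln hs) (rect_sec2 iv) (rect_sec2 iw) => y hy iy1 iy2.
exact: hac.
Qed.

Lemma wdx_weak v w (phi psi : R * R -> R) :
  measurable_fun [set: mR * mR] v -> wdx v w ->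
  (forall y (x : R), is_derive x 1 (fun x => phi (x, y)) (psi (x, y))) ->
  (forall y, continuous (fun x => psi (x, y))) ->
  (forall y, phi (a, y) = 0 /\ phi (b, y) = 0) ->
  mint m (fun z => v z * psi z) -> mint m (fun z => w z * phi z) ->
  \int[m]_z (v z * psi z) = - \int[m]_z (w z * phi z).
Proof.
move=> mv vw dphi cpsi phi0 i1 i2; rewrite (rect_Rint2 i1) (rect_Rint2 i2).
rewrite -[RHS]mulN1r -RintegralZl//; last exact: rect_mint2 i2.
apply: Rint_ae_eq.
- exact: mint_measurable (rect_mint2 i1).
- exact: mint_measurable (mintZ (-1) (rect_mint2 i2)).
apply: filterS vw => y vwy; rewrite mulN1r.
exact: (ac1_parts ab (measurable_sec2 y mv) vwy (dphi y) (cpsi y) (phi0 y).1 (phi0 y).2).2.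
Qed.

Lemma wdx_mul v w v' w' : measurable_fun [set: mR * mR] v ->
  measurable_fun [set: mR * mR] v' -> wdx v w -> wdx v' w' ->
  wdx (fun z => v z * v' z) (fun z => w z * v' z + v z * w' z).
Proof.
move=> mv mv' vw vw'; apply: filterS2 vw vw' => y h h'.
by apply: ac1_mul => //; exact: measurable_sec2.
Qed.

Definition avg1 v y := (b - a)^-1 * \int[mx]_x v (x, y).
Definition kap1 w z := \int[mx]_x (kap a b z.1 x * w (x, z.2)).

Lemma measurable_avg1 v : measurable_fun [set: mR * mR] v ->
  measurable_fun [set: mR] (avg1 v).
Proof. by move=> mv; apply: measurable_funM => //; exact: measurable_Rint2. Qed.

(** The kernel involves both [z.1] and the integration variable, so the integrand is treated as a
    function on the plane times a line, with the point of the plane as parameter. *)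
Lemma measurable_kap1 w : measurable_fun [set: mR * mR] w ->
  measurable_fun [set: mR * mR] (kap1 w).
Proof.
move=> mw; apply: (measurable_Rint1 mx
  (F := fun t : (mR * mR) * mR => kap a b t.1.1 t.2 * w (t.2, t.1.2))).
apply: measurable_funM.
- apply: measurable_funB; first by apply: measurable_chi2 => //; exact: measurableT_comp.
  by apply: measurable_funM => //; apply: measurable_funB.
- apply: (measurableT_comp mw); apply: measurable_fun_pair => //.
  exact: measurableT_comp.
Qed.

Lemma wdx_avg v w : measurable_fun [set: mR * mR] v ->
  measurable_fun [set: mR * mR] w -> wdx v w ->
  {ae m, forall z, v z = avg1 v z.2 + kap1 w z}.
Proof.
move=> mv mw vw; apply: rect_ae_eq2 => //.
- apply: measurable_funD; last exact: measurable_kap1.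
  by apply: measurableT_comp => //; exact: measurable_avg1.
- apply: filterS vw => y h; exact: (ac1_avg ab (measurable_sec2 y mv) h).
Qed.

End wdx.

(** * The plane: Borel sets, exchange of variables, tensor products *)

Section plane.
Context {R : realType}.
Local Notation mR := (measurableTypeR R).

Definition box (t : rat * rat * (rat * rat)) : set (R * R) :=
  [set` `]ratr t.1.1, ratr t.1.2[] `*` [set` `]ratr t.2.1, ratr t.2.2[].

(** The sigma-algebra of the plane is the product one, so an open set has to be written as a
    countable union of boxes, here with rational corners. *)
Lemma open_measurable2 (U : set (R * R)) : open U -> measurable (U : set (mR * mR)).
Proof.
move=> oU.
pose B (n : nat) : set (R * R) := if unpickle n is Some t then
  if `[< box t `<=` U >] then box t else set0 else set0.
have -> : U = \bigcup_n B n.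
  apply/seteqP; split => [z Uz|z [n _]]; last first.
    by rewrite /B; case: unpickle => // t; case: ifPn => // /asboolP; exact.
  have := open_nbhs_nbhs (conj oU Uz); rewrite -nbhs_ballE => -[e /= e0 he].
  have rats (x : R) : exists p q : rat, [/\ ratr p < x, x < ratr q, x - e < ratr p & ratr q < x + e].
    have [|p] := @rat_in_itvoo R (x - e) x; first by rewrite gtrBl.
    have [|q] := @rat_in_itvoo R x (x + e); first by rewrite ltrDl.
    by rewrite !in_itv/= => /andP[? ?] /andP[? ?]; exists p, q.
  have [p [q [px xq pe qe]]] := rats z.1; have [r [s [rz zs re se]]] := rats z.2.
  have sub : box (p, q, (r, s)) `<=` U; last first.
    exists (pickle (p, q, (r, s))); first exact: I.
    rewrite /B pickleK asboolT//.
    by split; rewrite /= in_itv/= ?px ?rz.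
  move=> t [/=]; rewrite !in_itv/= => /andP[t1 t2] /andP[t3 t4].
  by apply: he; split; rewrite /ball/= ltr_norml; apply/andP; split; lra.
apply: bigcup_measurable => n _; rewrite /B; case: unpickle => [t|]; last exact: measurable0.
case: ifPn => _; last exact: measurable0.
by apply: measurableX; exact: measurable_itv.
Qed.

Lemma continuous_measurable2 (f : R * R -> R) : continuous f ->
  measurable_fun [set: mR * mR] f.
Proof.
move=> cf; apply: (measurability _ (RGenOpens.measurableE R)) => _ [_ [p [q ->]] <-].
rewrite setTI; apply: open_measurable2; apply: open_comp; last exact: interval_open.
by move=> z _; exact: cf.
Qed.

(** Statements on y-derivatives are the x-statements read after this exchange, so each is proved
    once. *)
Definition swp (z : R * R) : R * R := (z.2, z.1).

Lemma measurable_swp (f : R * R -> R) : measurable_fun [set: mR * mR] f ->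
  measurable_fun [set: mR * mR] (fun z => f (swp z)).
Proof. by move=> mf; apply: (measurableT_comp mf); exact: measurable_swap. Qed.

Lemma mrect_swp_mint a b c d (F : R * R -> R) : mint (mrect a b c d) F ->
  mint (mrect c d a b) (fun z => F (swp z)).
Proof.
move=> iF; have mF := mint_measurable iF; move/mrect_mint : iF => iF; apply/mrect_mint.
have mFE : measurable_fun setT (EFin \o F) by exact/measurable_EFinP.
have h := (@integrable21ltyP _ _ _ _ _ (mI a b) (mI c d) (EFin \o F) mFE).1 iF.
apply/integrable12ltyP => //; apply/measurable_EFinP; exact: measurable_swp.
Qed.

Lemma mrect_swp_Rint a b c d (F : R * R -> R) : mint (mrect a b c d) F ->
  \int[mrect a b c d]_z F z = \int[mrect c d a b]_z F (swp z).
Proof.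
by move=> iF; rewrite rect_Rint2// rect_Rint1//; exact: mrect_swp_mint.
Qed.

Lemma mrect_swp_ae_eq a b c d (F G : R * R -> R) :
  measurable_fun [set: mR * mR] F -> measurable_fun [set: mR * mR] G ->
  {ae mrect a b c d, forall z, F z = G z} ->
  {ae mrect c d a b, forall z, F (swp z) = G (swp z)}.
Proof.
move=> mF mG /rect_ae1 FG; apply: rect_ae_eq2 => //; exact: measurable_swp.
Qed.

Lemma mrect_swp_L2 a b c d (F : R * R -> R) : L2 (mrect a b c d) F ->
  L2 (mrect c d a b) (fun z => F (swp z)).
Proof.
move=> /L2P[mF iF]; apply/L2P; split; first exact: measurable_swp.
exact: (mrect_swp_mint iF).
Qed.

Lemma derivable_slice1 (phi : R * R -> R) z :
  derivable phi z (1, 0) = derivable (fun x => phi (x, z.2)) z.1 1 /\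
  dx phi z = 'D_1 (fun x => phi (x, z.2)) z.1.
Proof.
have E : (fun h : R => h^-1 *: ((phi \o shift z) (h *: ((1 : R), (0 : R))) - phi z)) =
  (fun h : R => h^-1 *: (((fun x => phi (x, z.2)) \o shift z.1) (h *: (1 : R)) -
     phi (z.1, z.2))).
  apply/funext => h /=; rewrite /shift/=; congr (_ *: (phi _ - phi _)).
    by rewrite [LHS]surjective_pairing/= scaler0 add0r.
  by case: z.
by rewrite /dx /derive /derivable E.
Qed.

Lemma derivable_slice2 (phi : R * R -> R) z :
  derivable phi z (0, 1) = derivable (fun y => phi (z.1, y)) z.2 1 /\
  dy phi z = 'D_1 (fun y => phi (z.1, y)) z.2.
Proof.
have E : (fun h : R => h^-1 *: ((phi \o shift z) (h *: ((0 : R), (1 : R))) - phi z)) =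
  (fun h : R => h^-1 *: (((fun y => phi (z.1, y)) \o shift z.2) (h *: (1 : R)) -
     phi (z.1, z.2))).
  apply/funext => h /=; rewrite /shift/=; congr (_ *: (phi _ - phi _)).
    by rewrite [LHS]surjective_pairing/= scaler0 add0r.
  by case: z.
by rewrite /dy /derive /derivable E.
Qed.

Definition tens (A B : R -> R) : R * R -> R := fun z => A z.1 * B z.2.

Lemma smooth_derive (A : R -> R) : smooth A ->
  smooth (derive1 A) /\ forall x : R, is_derive x 1 A ((derive1 A) x).
Proof.
move=> sA.
have dA x : derivable A x 1 by have [g dg _] := sA 0%N; have [] := dg x.
split; last by move=> x; apply: DeriveDef => //; rewrite derive1E.
move=> n; have [g dg sg] := sA n.+1.
suff -> : (derive1 A) = g by [].
by apply/funext => x; rewrite derive1E; have [_ ->] := dg x.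
Qed.

Lemma dx_tens (A B : R -> R) : smooth A ->
  (forall z : R * R, derivable (tens A B) z (1, 0)) /\ dx (tens A B) = tens (derive1 A) B.
Proof.
move=> /smooth_derive[_ dA].
have h (z : R * R) : is_derive z.1 1 (fun x => tens A B (x, z.2)) ((derive1 A) z.1 * B z.2).
  have := is_deriveM (dA z.1) (is_derive_cst (B z.2) z.1 1).
  by rewrite scaler0 add0r [_ *: _]mulrC.
split=> [z|]; first by have [-> _] := derivable_slice1 (tens A B) z; have [] := h z.
by apply/funext => z; have [_ ->] := derivable_slice1 (tens A B) z; have [_ ->] := h z.
Qed.

Lemma dy_tens (A B : R -> R) : smooth B ->
  (forall z : R * R, derivable (tens A B) z (0, 1)) /\ dy (tens A B) = tens A (derive1 B).
Proof.
move=> /smooth_derive[_ dB].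
have h (z : R * R) : is_derive z.2 1 (fun y => tens A B (z.1, y)) (A z.1 * (derive1 B) z.2).
  have := is_deriveM (is_derive_cst (A z.1) z.2 1) (dB z.2).
  by rewrite scaler0 addr0.
split=> [z|]; first by have [-> _] := derivable_slice2 (tens A B) z; have [] := h z.
by apply/funext => z; have [_ ->] := derivable_slice2 (tens A B) z; have [_ ->] := h z.
Qed.

Lemma tens_continuous (A B : R -> R) : continuous A -> continuous B -> continuous (tens A B).
Proof.
move=> cA cB z; apply: cvgM.
- by apply: (continuous_comp (f := fst) (g := A)); [exact: cvg_fst|exact: cA].
- by apply: (continuous_comp (f := snd) (g := B)); [exact: cvg_snd|exact: cB].
Qed.

Lemma is_Cn_tens n (A B : R -> R) : smooth A -> smooth B -> is_Cn n (tens A B).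
Proof.
elim: n A B => [|n IH] A B sA sB /=.
all: have c : continuous (tens A B) by
  apply: tens_continuous; [exact: (sm_continuous (sA 0%N))|exact: (sm_continuous (sB 0%N))].
- by [].
- have [dA dxE] := dx_tens B sA; have [dB dyE] := dy_tens A sB.
  split=> //; split; first by move=> z; split; [exact: dA|exact: dB].
  rewrite dxE dyE; have [sA' _] := smooth_derive sA; have [sB' _] := smooth_derive sB.
  by split; exact: IH.
Qed.

End plane.

Section tests.
Context {R : realType} (l : R).
Local Notation mR := (measurableTypeR R).

Lemma test_fun_tens (A B : R -> R) : test1 0 pi A -> test1 (- l) l B ->
  test_fun l (tens A B).
Proof.
move=> [sA [p [q [ap pq qb A0]]]] [sB [r [t [ar rt tb B0]]]]; split.
  by move=> n; exact: is_Cn_tens.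
exists ([set` `[p, q]] `*` [set` `[r, t]]); split.
- by apply: compact_setX; exact: segment_compact.
- move=> z [/=]; rewrite /Omega/= !in_itv/= => /andP[z1 z2] /andP[z3 z4]; split => /=;
  apply/andP; split; lra.
- move=> z nKz; rewrite /tens; have [zpq|zpq] := boolP (z.1 \in `]p, q[ ).
    have [zrt|zrt] := boolP (z.2 \in `]r, t[ ); last by rewrite (B0 _ zrt) mulr0.
    by case: nKz; split; [exact: subset_itv_oo_cc zpq|exact: subset_itv_oo_cc zrt].
  by rewrite (A0 _ zpq) mul0r.
Qed.

Lemma derive_local0 (f : R -> R) (x : R) : (\forall t \near x, f t = 0) -> 'D_1 f x = 0.
Proof.
move=> h; rewrite (@near_eq_derive _ _ _ _ (cst (0 : R))) ?derive_cst//.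
Qed.

(** The complement of the compact set is open, so [phi] vanishes around each of its points and the
    same compact set serves for the derivative. *)
Lemma test_fun_dx phi : test_fun l phi -> test_fun l (dx phi).
Proof.
move=> [sphi [K [cK KO K0]]]; split.
  by move=> n; have [_ [_ []]] := sphi n.+1.
exists K; split => // z nKz; have [_ ->] := derivable_slice1 phi z.
apply: derive_local0; have oK : open (~` K).
  by rewrite openC; apply: compact_closed => //; exact: norm_hausdorff.
have := open_nbhs_nbhs (conj oK nKz); rewrite -nbhs_ballE => -[e /= e0 he].
exists e => //= t zt; apply: K0; apply: he; split => //=; exact: ballxx.
Qed.

Lemma test_fun_dy phi : test_fun l phi -> test_fun l (dy phi).
Proof.
move=> [sphi [K [cK KO K0]]]; split.
  by move=> n; have [_ [_ []]] := sphi n.+1.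
exists K; split => // z nKz; have [_ ->] := derivable_slice2 phi z.
apply: derive_local0; have oK : open (~` K).
  by rewrite openC; apply: compact_closed => //; exact: norm_hausdorff.
have := open_nbhs_nbhs (conj oK nKz); rewrite -nbhs_ballE => -[e /= e0 he].
exists e => //= t zt; apply: K0; apply: he; split => //=; exact: ballxx.
Qed.

Lemma test_fun_iter i j phi : test_fun l phi -> test_fun l (iter i dx (iter j dy phi)).
Proof.
move=> tphi; have : test_fun l (iter j dy phi).
  by elim: j => //= j IH; exact: test_fun_dy.
by move=> h; elim: i => //= i IH; exact: test_fun_dx.
Qed.

Lemma test_fun_continuous phi : test_fun l phi -> continuous phi.
Proof. by move=> [sphi _]; have [] := sphi 0%N. Qed.

Lemma test_fun_measurable phi : test_fun l phi -> measurable_fun [set: mR * mR] phi.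
Proof. by move=> tphi; apply: continuous_measurable2; exact: test_fun_continuous. Qed.

Lemma test_fun_bounded phi : test_fun l phi -> exists M, forall z, `|phi z| <= M.
Proof.
move=> tphi; have cphi := test_fun_continuous tphi; move: tphi => [_ [K [cK _ K0]]].
have /compact_bounded [M [_ hM]] : compact (phi @` K).
  by apply: continuous_compact => //; exact: continuous_subspaceT.
exists (`|M| + 1) => z; have [Kz|nKz] := pselect (K z).
  apply: hM; last by exists z.
  by rewrite (le_lt_trans (ler_norm M))// ltrDl.
by rewrite K0// normr0 addr_ge0.
Qed.

Lemma test_fun_derive phi : test_fun l phi ->
  (forall y (x : R), is_derive x 1 (fun x => phi (x, y)) (dx phi (x, y))) /\
  (forall x (y : R), is_derive y 1 (fun y => phi (x, y)) (dy phi (x, y))).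
Proof.
move=> [sphi _]; have [_ [dphi _]] := sphi 1%N; split=> [y x|x y].
- have [E1 E2] := derivable_slice1 phi (x, y); apply: DeriveDef; last by rewrite E2.
  by have [h _] := dphi (x, y); rewrite E1 in h.
- have [E1 E2] := derivable_slice2 phi (x, y); apply: DeriveDef; last by rewrite E2.
  by have [_ h] := dphi (x, y); rewrite E1 in h.
Qed.

Lemma test_fun_out phi z : test_fun l phi -> ~ Omega l z -> phi z = 0.
Proof. by move=> [_ [K [_ KO K0]]] nO; apply: K0 => /KO. Qed.

Lemma slice_continuous1 (phi : R * R -> R) y : continuous phi ->
  continuous (fun x => phi (x, y)).
Proof.
move=> cphi x; apply: (continuous_comp (f := fun x => (x, y)) (g := phi)); last exact: cphi.
exact: (cvg_pair cvg_id (cvg_cst y)).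
Qed.

Lemma slice_continuous2 (phi : R * R -> R) x : continuous phi ->
  continuous (fun y => phi (x, y)).
Proof.
move=> cphi y; apply: (continuous_comp (f := fun y => (x, y)) (g := phi)); last exact: cphi.
exact: (cvg_pair (cvg_cst x) cvg_id).
Qed.

End tests.

(** Proof irrelevance of the axioms. It rewrites [dO] as the finite measure [mrect], on which the L2
    theory is available. *)
Lemma measure_ext d (T : measurableType d) (R : realType) (m1 m2 : {measure set T -> \bar R}) :
  m1 = m2 :> (set T -> \bar R) -> m1 = m2.
Proof.
destruct m1 as [f1 [m11 m12]], m2 as [f2 [m21 m22]] => /= E; destruct E.
have e1 : m11 = m21.
  by destruct m11, m21; congr (isContent.Axioms_ _ _); exact: Prop_irrelevance.
destruct e1.
have -> // : m12 = m22.
by destruct m12, m22; congr (Content_isMeasure.Axioms_ _); exact: Prop_irrelevance.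
Qed.

Lemma dO_mrect (R : realType) (l : R) : dO l = mrect 0 pi (- l) l.
Proof. exact: measure_ext. Qed.

Lemma L2_dO (R : realType) (l : R) u :
  (u \in Lfun (dO l) 2%:E) = L2 (mrect 0 pi (- l) l) u :> Prop.
Proof. by rewrite dO_mrect. Qed.

(** * Weak derivatives up to order two *)

Section jets.
Context {R : realType} (l : R).
Hypothesis l0 : 0 < l.
Local Notation mR := (measurableTypeR R).
Local Notation mO := (mrect 0 pi (- l) l).
Local Notation mO' := (mrect (- l) l 0 pi).
Implicit Types (u v w : R * R -> R) (phi : R * R -> R).

Let pi0 : (0 : R) < pi. Proof. exact: pi_gt0. Qed.
Let ll : - l < l. Proof. by move: l0; lra. Qed.

Lemma dO_Rint (f : R * R -> R) : \int[dO l]_z f z = \int[mO]_z f z.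
Proof. by []. Qed.

Definition wx v w := wdx 0 pi (- l) l v w.
Definition wy v w := wdx (- l) l 0 pi (fun z => v (swp z)) (fun z => w (swp z)).

Lemma mint_test v phi : mint mO v -> test_fun l phi -> mint mO (fun z => v z * phi z).
Proof.
move=> iv tphi; have [M hM] := test_fun_bounded tphi.
have := mint_mul_bounded (test_fun_measurable tphi) hM iv.
by congr (mint _ _); apply/funext => z; rewrite mulrC.
Qed.

Lemma iter_tens i j (A B : R -> R) : smooth A -> smooth B ->
  iter i dx (iter j dy (tens A B)) = tens (iter i (@derive1 R R) A) (iter j (@derive1 R R) B).
Proof.
move=> sA sB; have siter k C : smooth C -> smooth (iter k (@derive1 R R) C).
  by move=> sC; elim: k => //= k /smooth_derive[].
have -> : iter j dy (tens A B) = tens A (iter j (@derive1 R R) B).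
  by elim: j => //= j ->; have [_ ->] := dy_tens A (siter j _ sB).
by elim: i => //= i ->; have [_ ->] := dx_tens (iter j (@derive1 R R) B) (siter i _ sA).
Qed.

Lemma weak_unique i j u v w : L2 mO v -> L2 mO w ->
  is_weak_deriv l i j u v -> is_weak_deriv l i j u w -> {ae mO, forall z, v z = w z}.
Proof.
move=> Lv Lw hv hw; have iv := L2_mint Lv; have iw := L2_mint Lw.
have h : {ae mO, forall z, v z - w z = 0}.
  apply: (rect_du_bois_reymond pi0 ll (mintB iv iw)) => f g tf tg.
  have tfg := test_fun_tens tf tg.
  have jv := mint_test iv tfg; have jw := mint_test iw tfg.
  have : \int[mO]_z (v z * tens f g z) = \int[mO]_z (w z * tens f g z).
    have := hv _ tfg; rewrite (hw _ tfg) !dO_Rint => /(congr1 (fun x => (-1) ^+ (i + j) * x)).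
    by rewrite !mulrA -expr2 sqrr_sign !mul1r => ->.
  move=> E; rewrite -[RHS](subrr (\int[mO]_z (w z * tens f g z))) -{1}E -RintegralB//.
  by apply: eq_Rintegral => z _; rewrite /tens; ring.
by apply: filterS h => z /eqP; rewrite subr_eq0 => /eqP.
Qed.

Lemma derive1E_test (A A' : R -> R) : (forall x : R, is_derive x 1 A (A' x)) ->
  A' = derive1 A.
Proof. by move=> dA; apply/funext => x; rewrite derive1E; have [_ ->] := dA x. Qed.

(** Testing [v] with the tensor of [A'] and [g], and [w] with that of [A] and [g], puts the same
    derivative of a test function against [u]; comparing the signs leaves the first-order
    identity. *)
Lemma weak_wx i j u v w : L2 mO v -> L2 mO w ->
  is_weak_deriv l i j u v -> is_weak_deriv l i.+1 j u w -> wx v w.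
Proof.
move=> Lv Lw hv hw; apply: (weak_wdx pi0 ll (L2_mint Lv) (L2_mint Lw)).
move=> A A' g tA tA' dA tg; have sA := tA.1; have sg := tg.1.
have := hv _ (test_fun_tens tA' tg); have := hw _ (test_fun_tens tA tg).
have E : iter i.+1 dx (iter j dy (tens A g)) = iter i dx (iter j dy (tens A' g)).
  rewrite !iter_tens//; last exact: tA'.1.
  by rewrite (derive1E_test dA) iterSr.
rewrite !dO_Rint E => -> /(congr1 (fun x => (-1) ^+ (i + j) * x)).
rewrite addSn exprS mulN1r mulNr mulrN !mulrA -expr2 sqrr_sign !mul1r => <-.
by [].
Qed.

Lemma weak_wy i j u v w : L2 mO v -> L2 mO w ->
  is_weak_deriv l i j u v -> is_weak_deriv l i j.+1 u w -> wy v w.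
Proof.
move=> Lv Lw hv hw.
apply: (weak_wdx ll pi0 (mrect_swp_mint (L2_mint Lv)) (mrect_swp_mint (L2_mint Lw))).
move=> A A' g tA tA' dA tg; have sA := tA.1; have sg := tg.1.
have t1 := test_fun_tens tg tA'; have t2 := test_fun_tens tg tA.
have -> : \int[mO']_z (v (swp z) * (A' z.1 * g z.2)) = \int[mO]_z (v z * tens g A' z).
  rewrite (mrect_swp_Rint (mint_test (L2_mint Lv) t1)).
  by apply: eq_Rintegral => z _; rewrite /tens/=; ring.
have -> : \int[mO']_z (w (swp z) * (A z.1 * g z.2)) = \int[mO]_z (w z * tens g A z).
  rewrite (mrect_swp_Rint (mint_test (L2_mint Lw) t2)).
  by apply: eq_Rintegral => z _; rewrite /tens/=; ring.
have := hv _ t1; have := hw _ t2.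
have E : iter i dx (iter j.+1 dy (tens g A)) = iter i dx (iter j dy (tens g A')).
  rewrite !iter_tens//; last exact: tA'.1.
  by rewrite (derive1E_test dA) iterSr.
rewrite !dO_Rint E => -> /(congr1 (fun x => (-1) ^+ (i + j) * x)).
rewrite addnS exprS mulN1r mulNr mulrN !mulrA -expr2 sqrr_sign !mul1r => <-.
by [].
Qed.

Lemma notin_Omega z : ~ (0 < z.1 < pi) \/ ~ (- l < z.2 < l) -> ~ Omega l z.
Proof. by move=> h [/=]; rewrite !in_itv/= => h1 h2; case: h. Qed.

Lemma wx_parts v w phi : L2 mO v -> L2 mO w -> wx v w -> test_fun l phi ->
  \int[mO]_z (v z * dx phi z) = - \int[mO]_z (w z * phi z).
Proof.
move=> Lv Lw vw tphi; have tdx := test_fun_dx tphi.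
apply: (wdx_weak pi0 (L2_measurable Lv) vw).
- by move=> y x; exact: (test_fun_derive tphi).1.
- by move=> y; apply: slice_continuous1; exact: test_fun_continuous tdx.
- move=> y; split; apply: (test_fun_out tphi); apply: notin_Omega; left => /=;
  by rewrite ltxx ?andbF.
- exact: mint_test (L2_mint Lv) tdx.
- exact: mint_test (L2_mint Lw) tphi.
Qed.

Lemma wy_parts v w phi : L2 mO v -> L2 mO w -> wy v w -> test_fun l phi ->
  \int[mO]_z (v z * dy phi z) = - \int[mO]_z (w z * phi z).
Proof.
move=> Lv Lw vw tphi; have tdy := test_fun_dy tphi.
have i1 := mint_test (L2_mint Lv) tdy; have i2 := mint_test (L2_mint Lw) tphi.
rewrite (mrect_swp_Rint i1) (mrect_swp_Rint i2).
apply: (wdx_weak ll (measurable_swp (L2_measurable Lv)) vw).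
- by move=> y x; exact: (test_fun_derive tphi).2.
- by move=> y; exact: (@slice_continuous2 _ (dy phi) y (test_fun_continuous tdy)).
- move=> y; split; apply: (test_fun_out tphi); apply: notin_Omega; right => /=;
  by rewrite ltxx ?andbF.
- exact: mrect_swp_mint i1.
- exact: mrect_swp_mint i2.
Qed.

(** Any family of weak derivatives, not the chosen [wD]: sums, products and limits come with
    explicit candidates, which [jet_H2] afterwards identifies a.e. with [wD]. *)
Record jet u (w : nat -> nat -> R * R -> R) : Prop := Jet {
  jet_L2 : forall i j, (i + j <= 2)%N -> L2 mO (w i j);
  jet_weak : forall i j, (i + j <= 2)%N -> is_weak_deriv l i j u (w i j) }.

Lemma weak00 u : is_weak_deriv l 0 0 u u.
Proof. by move=> phi _; rewrite expr0 mul1r. Qed.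

Lemma H2_L2 u : H2 l u -> L2 mO u.
Proof. by case=> + _; rewrite L2_dO. Qed.

Lemma H2_jet u : H2 l u -> jet u (fun i j => wD l i j u).
Proof.
move=> [Lu hu].
have h i j : (i + j <= 2)%N -> L2 mO (wD l i j u) /\ is_weak_deriv l i j u (wD l i j u).
  move=> ij; have [w Lw hw] := hu i j ij; rewrite -L2_dO.
  exact: (@xgetPex _ (cst 0) [set w | w \in Lfun (dO l) 2%:E /\ is_weak_deriv l i j u w]
    (ex_intro _ w (conj Lw hw))).
by split=> i j /h[].
Qed.

Lemma jet_H2 u (w : nat -> nat -> R * R -> R) : L2 mO u -> jet u w -> H2 l u /\
  forall i j, (i + j <= 2)%N -> {ae mO, forall z, wD l i j u z = w i j z}.
Proof.
move=> Lu [Lw hw]; have H2u : H2 l u.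
  split=> [|i j ij]; first by rewrite L2_dO.
  by exists (w i j); [rewrite L2_dO; exact: Lw|exact: hw].
split=> // i j ij; have [Lw' hw'] := H2_jet H2u.
exact: weak_unique (Lw' _ _ ij) (Lw _ _ ij) (hw' _ _ ij) (hw _ _ ij).
Qed.

Definition jetf u w10 w01 w20 w11 w02 (i j : nat) : R * R -> R :=
  match i, j with
  | 0%N, 0%N => u | 1%N, 0%N => w10 | 0%N, 1%N => w01
  | 2%N, 0%N => w20 | 1%N, 1%N => w11 | 0%N, 2%N => w02 | _, _ => cst 0
  end.

(** Each second-order identity is two integrations by parts along slices. The mixed derivative needs
    one order only, as [x] comes before [y] in the definition of the weak derivative. *)
Lemma slices_jet u w10 w01 w20 w11 w02 :
  L2 mO u -> L2 mO w10 -> L2 mO w01 -> L2 mO w20 -> L2 mO w11 -> L2 mO w02 ->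
  wx u w10 -> wy u w01 -> wx w10 w20 -> wy w10 w11 -> wy w01 w02 ->
  jet u (jetf u w10 w01 w20 w11 w02).
Proof.
move=> L00 L10 L01 L20 L11 L02 x1 y1 x2 xy y2; split.
  by case=> [|[|[|i]]] [|[|[|j]]].
case=> [|[|[|i]]] [|[|[|j]]]//= _ phi tphi; rewrite !dO_Rint /=.
- by rewrite expr0 mul1r.
- by rewrite (wy_parts L00 L01 y1 tphi) expr1 mulN1r.
- rewrite (wy_parts L00 L01 y1 (test_fun_dy tphi)) (wy_parts L01 L02 y2 tphi).
  by rewrite opprK sqrrN expr1n mul1r.
- by rewrite (wx_parts L00 L10 x1 tphi) expr1 mulN1r.
- rewrite (wx_parts L00 L10 x1 (test_fun_dy tphi)) (wy_parts L10 L11 xy tphi).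
  by rewrite opprK sqrrN expr1n mul1r.
- rewrite (wx_parts L00 L10 x1 (test_fun_dx tphi)) (wx_parts L10 L20 x2 tphi).
  by rewrite opprK sqrrN expr1n mul1r.
Qed.

Section jet_slices.
Context (u : R * R -> R) (w : nat -> nat -> R * R -> R).
Hypothesis (jw : jet u w).

Lemma jet_wx i j : (i + j <= 1)%N -> wx (w i j) (w i.+1 j).
Proof.
move=> ij; have ij2 : (i + j <= 2)%N by exact: leq_trans ij _.
have ij3 : (i.+1 + j <= 2)%N by rewrite addSn ltnS.
exact: (weak_wx (jet_L2 jw ij2) (jet_L2 jw ij3) (jet_weak jw ij2) (jet_weak jw ij3)).
Qed.

Lemma jet_wy i j : (i + j <= 1)%N -> wy (w i j) (w i j.+1).
Proof.
move=> ij; have ij2 : (i + j <= 2)%N by exact: leq_trans ij _.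
have ij3 : (i + j.+1 <= 2)%N by rewrite addnS ltnS.
exact: (weak_wy (jet_L2 jw ij2) (jet_L2 jw ij3) (jet_weak jw ij2) (jet_weak jw ij3)).
Qed.

Lemma jet_ae0 : L2 mO u -> {ae mO, forall z, u z = w 0 0 z}.
Proof.
move=> Lu; apply: (@weak_unique 0 0 u) => //; first exact: jet_L2 jw 0%N 0%N _.
  exact: weak00.
exact: (jet_weak jw).
Qed.

End jet_slices.

Lemma jet_lin k u v (w w' : nat -> nat -> R * R -> R) : L2 mO u -> L2 mO v -> jet u w -> jet v w' ->
  jet (fun z => k * u z + v z) (fun i j z => k * w i j z + w' i j z).
Proof.
move=> Lu Lv [Lw hw] [Lw' hw']; split=> i j ij; first by apply: L2_lin; [exact: Lw|exact: Lw'].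
move=> phi tphi; have := hw i j ij phi tphi; have := hw' i j ij phi tphi.
rewrite !dO_Rint => E1 E2; have ti := test_fun_iter i j tphi.
have -> : \int[mO]_z ((k * u z + v z) * iter i dx (iter j dy phi) z) =
    \int[mO]_z (k * (u z * iter i dx (iter j dy phi) z) + v z * iter i dx (iter j dy phi) z).
  by apply: eq_Rintegral => z _; ring.
rewrite Rint_lin; [|exact: mint_test (L2_mint Lu) ti|exact: mint_test (L2_mint Lv) ti].
have -> : \int[mO]_z ((k * w i j z + w' i j z) * phi z) =
    \int[mO]_z (k * (w i j z * phi z) + w' i j z * phi z).
  by apply: eq_Rintegral => z _; ring.
rewrite Rint_lin; [|exact: mint_test (L2_mint (Lw _ _ ij)) tphi|
  exact: mint_test (L2_mint (Lw' _ _ ij)) tphi].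
by rewrite E1 E2; ring.
Qed.

Lemma H2_lin k u v : H2 l u -> H2 l v -> H2 l (fun z => k * u z + v z) /\
  forall i j, (i + j <= 2)%N ->
    {ae mO, forall z, wD l i j (fun z => k * u z + v z) z = k * wD l i j u z + wD l i j v z}.
Proof.
move=> Hu Hv; have Lu := H2_L2 Hu; have Lv := H2_L2 Hv.
exact: jet_H2 (L2_lin k Lu Lv) (jet_lin k Lu Lv (H2_jet Hu) (H2_jet Hv)).
Qed.

End jets.

(** * Continuous representatives *)

Lemma ae_fst d1 d2 (T1 : measurableType d1) (T2 : measurableType d2) (R : realType)
    (m1 : {sigma_finite_measure set T1 -> \bar R})
    (m2 : {sigma_finite_measure set T2 -> \bar R}) (P : T1 -> Prop) :
  {ae m1, forall x, P x} -> {ae (m1 \x m2)%E, forall z, P z.1}.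
Proof.
move=> [N [mN N0 PN]]; exists (N `*` setT); split; first exact: measurableX.
  by rewrite product_measure1E// (_ : _ N = 0%E)// mul0e.
by move=> z /= nP; split => //; exact: PN.
Qed.

Lemma ae_snd d1 d2 (T1 : measurableType d1) (T2 : measurableType d2) (R : realType)
    (m1 : {sigma_finite_measure set T1 -> \bar R})
    (m2 : {sigma_finite_measure set T2 -> \bar R}) (P : T2 -> Prop) :
  {ae m2, forall x, P x} -> {ae (m1 \x m2)%E, forall z, P z.2}.
Proof.
move=> [N [mN N0 PN]]; exists (setT `*` N); split; first exact: measurableX.
  by rewrite product_measure1E// (_ : _ N = 0%E)// mule0.
by move=> z /= nP; split => //; exact: PN.
Qed.

Section sobolev_repr.
Context {R : realType} (a b c d : R).
Hypothesis (ab : a < b) (cd : c < d).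
Local Notation mR := (measurableTypeR R).
Local Notation mx := (mI a b).
Local Notation my := (mI c d).
Local Notation m := (mrect a b c d).
Implicit Types (u v w : R * R -> R).

Lemma kap_cvg (p q : R) (s_ : nat -> R) s x : s_ @ \oo --> s -> x != s ->
  kap p q (s_ n) x @[n --> \oo] --> kap p q s x.
Proof. by move=> ss xs; apply: cvgB; [exact: chi_cvg|exact: cvg_cst]. Qed.

Definition avgy v x := avg1 c d (fun z => v (swp z)) x.

(* The representation [ac1_avg] applied in both variables: it needs only u, its first
   derivatives and the mixed one, and is continuous up to the boundary. *)
Definition repr u w10 w01 w11 (z : R * R) : R :=
  (b - a)^-1 * ((d - c)^-1 * \int[m]_t u t) +
  \int[my]_y (kap c d z.2 y * avg1 a b w01 y) +
  \int[mx]_x (kap a b z.1 x * avgy w10 x) +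
  \int[m]_t (kap a b z.1 t.1 * (kap c d z.2 t.2 * w11 t)).

Lemma mint_avg1 v : mint m v -> mint my (avg1 a b v).
Proof. by move=> iv; apply: mintZ; exact: rect_mint2 iv. Qed.

Lemma mint_avgy v : mint m v -> mint mx (avgy v).
Proof. by move=> iv; apply: mintZ; exact: (rect_mint2 (mrect_swp_mint iv)). Qed.

Lemma measurable_kapkap s t : measurable_fun [set: mR * mR] (fun z => kap a b s z.1 * kap c d t z.2).
Proof.
apply: measurable_funM; [exact: (measurableT_comp (measurable_kap a b s))|].
exact: (measurableT_comp (measurable_kap c d t)).
Qed.

Lemma mint_kapkap w s t : mint m w ->
  mint m (fun z => kap a b s z.1 * (kap c d t z.2 * w z)).
Proof.
move=> iw; have mw := mint_measurable iw.
have mk : measurable_fun [set: mR * mR] (fun z => kap a b s z.1 * (kap c d t z.2 * w z)).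
  have := measurable_funM (measurable_kapkap s t) mw.
  by congr measurable_fun; apply/funext => z; rewrite mulrA.
apply: (mint_ae_le mk (mint_norm iw)).
apply: filterS (rect_in a b c d) => z [zx zy]; rewrite !normrM mulrA ler_piMl//.
by rewrite mulr_ile1// kap_norm_le1.
Qed.

(** Moving the point [z] changes only the kernels, which are bounded by 1 and discontinuous only
    across the two lines through [z], a null set; dominated convergence applies to each term. *)
Lemma repr_continuous u w10 w01 w11 : mint m w10 -> mint m w01 -> mint m w11 ->
  continuous (repr u w10 w01 w11).
Proof.
move=> i10 i01 i11 z; apply: seq_continuous => z_ zz.
have z1 : (z_ n).1 @[n --> \oo] --> z.1.
  by apply: (cvg_comp _ _ zz); exact: cvg_fst.
have z2 : (z_ n).2 @[n --> \oo] --> z.2.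
  by apply: (cvg_comp _ _ zz); exact: cvg_snd.
have ig1 := mint_avg1 i01; have ig2 := mint_avgy i10.
apply: cvgD; first apply: cvgD; first apply: cvgD; first exact: cvg_cst.
- apply: (@Rint_cvg _ _ _ my (fun n y => kap c d (z_ n).2 y * avg1 a b w01 y)
    (fun y => kap c d z.2 y * avg1 a b w01 y) (fun y => `|avg1 a b w01 y|)).
  + by move=> n; apply: mint_measurable; exact: mint_kap.
  + by apply: mint_measurable; exact: mint_kap.
  + by apply: filterS (mI_neq c d z.2) => y yz; apply: cvgM; [exact: kap_cvg|exact: cvg_cst].
  + exact: mint_norm.
  + by move=> n; apply: filterS (mI_in c d) => y yc; rewrite normrM ler_piMl// kap_norm_le1.
- apply: (@Rint_cvg _ _ _ mx (fun n x => kap a b (z_ n).1 x * avgy w10 x)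
    (fun x => kap a b z.1 x * avgy w10 x) (fun x => `|avgy w10 x|)).
  + by move=> n; apply: mint_measurable; exact: mint_kap.
  + by apply: mint_measurable; exact: mint_kap.
  + by apply: filterS (mI_neq a b z.1) => y yz; apply: cvgM; [exact: kap_cvg|exact: cvg_cst].
  + exact: mint_norm.
  + by move=> n; apply: filterS (mI_in a b) => y yc; rewrite normrM ler_piMl// kap_norm_le1.
- apply: (@Rint_cvg _ _ _ m (fun n t => kap a b (z_ n).1 t.1 * (kap c d (z_ n).2 t.2 * w11 t))
    (fun t => kap a b z.1 t.1 * (kap c d z.2 t.2 * w11 t)) (fun t => `|w11 t|)).
  + by move=> n; apply: mint_measurable; exact: mint_kapkap.
  + by apply: mint_measurable; exact: mint_kapkap.
  + have [n1 n2] : {ae m, forall t, t.1 != z.1} /\ {ae m, forall t, t.2 != z.2}.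
      split.
        by apply/mrect_ae; exact: ae_fst (mI_neq a b z.1).
      by apply/mrect_ae; exact: ae_snd (mI_neq c d z.2).
    apply: filterS2 n1 n2 => t t1 t2.
    by apply: cvgM; [exact: kap_cvg|apply: cvgM; [exact: kap_cvg|exact: cvg_cst]].
  + exact: mint_norm.
  + move=> n; apply: filterS (rect_in a b c d) => t [tx ty].
    by rewrite !normrM mulrA ler_piMl// mulr_ile1// kap_norm_le1.
Qed.

Lemma wdx_avg_y v w : measurable_fun [set: mR * mR] v ->
  measurable_fun [set: mR * mR] w ->
  wdx c d a b (fun z => v (swp z)) (fun z => w (swp z)) ->
  {ae my, forall y, {ae mx, forall x, v (x, y) = avgy v x + \int[my]_t (kap c d y t * w (x, t))}}.
Proof.
move=> mv mw vw; have msv := measurable_swp mv; have msw := measurable_swp mw.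
have h := wdx_avg cd msv msw vw.
have mr : measurable_fun [set: mR * mR]
    (fun z => avg1 c d (fun z => v (swp z)) z.2 + kap1 c d (fun z => w (swp z)) z).
  apply: measurable_funD; last exact: measurable_kap1.
  by apply: measurableT_comp => //; exact: measurable_avg1.
have /rect_ae2 := mrect_swp_ae_eq msv mr h.
exact.
Qed.


Lemma avg1_repr u w01 : mint m u -> mint m w01 ->
  wdx c d a b (fun z => u (swp z)) (fun z => w01 (swp z)) ->
  {ae my, forall y, avg1 a b u y = (b - a)^-1 * ((d - c)^-1 * \int[m]_t u t) +
     \int[my]_t (kap c d y t * avg1 a b w01 t)}.
Proof.
move=> iu iw uw; have mu := mint_measurable iu; have mw := mint_measurable iw.
have iY := mint_avgy iu.
apply: filterS2 (wdx_avg_y mu mw uw) (rect_sec2 iu) => y uE iuy.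
have ik : mint m (fun z => kap c d y z.2 * w01 z).
  have mk : measurable_fun [set: mR * mR] (fun z => kap c d y z.2 * w01 z).
    by apply: measurable_funM => //; exact: (measurableT_comp (measurable_kap c d y)).
  apply: (mint_ae_le mk (mint_norm iw)).
  by apply: filterS (rect_in a b c d) => z [_ zy]; rewrite normrM ler_piMl// kap_norm_le1.
rewrite /avg1 (Rint_ae_eq (mint_measurable iuy) _ uE); last first.
  by apply: mint_measurable; exact: mintD iY (rect_mint1 ik).
rewrite (RintegralD _ iY (rect_mint1 ik))//.
rewrite mulrDr; congr (_ + _).
  rewrite /avgy /avg1 RintegralZl//; last exact: (rect_mint2 (mrect_swp_mint iu)).
  by rewrite [in RHS]rect_Rint1.
rewrite -(rect_Rint1 ik) (rect_Rint2 ik) -RintegralZl//; last exact: rect_mint2 ik.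
apply: Rint_ae_eq.
- by apply: measurable_funM => //; apply: mint_measurable; exact: rect_mint2 ik.
- by apply: mint_measurable; apply: mint_kap => //; exact: mint_avg1.
apply: filterS (rect_sec2 iw) => t iwt /=; rewrite RintegralZl//; ring.
Qed.

(** The null set of [y] does not depend on [s]. This allows [s] to be an endpoint later, although a
    single abscissa is negligible. *)
Lemma kap1_repr w10 w11 : mint m w10 -> mint m w11 ->
  wdx c d a b (fun z => w10 (swp z)) (fun z => w11 (swp z)) ->
  {ae my, forall y, forall s, kap1 a b w10 (s, y) =
     \int[mx]_x (kap a b s x * avgy w10 x) +
     \int[m]_t (kap a b s t.1 * (kap c d y t.2 * w11 t))}.
Proof.
move=> iu iw uw; have mu := mint_measurable iu; have mw := mint_measurable iw.
have iY := mint_avgy iu.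
apply: filterS2 (wdx_avg_y mu mw uw) (rect_sec2 iu) => y uE iuy s.
have ik := mint_kapkap s y iw.
rewrite (rect_Rint1 ik) -RintegralD//; [|exact: mint_kap|exact: rect_mint1 ik].
apply: Rint_ae_eq.
- by apply: mint_measurable; exact: mint_kap.
- by apply: mint_measurable; apply: mintD; [exact: mint_kap|exact: rect_mint1 ik].
apply: filterS2 uE (rect_sec1 iw) => x /= -> iwx.
rewrite mulrDr; congr (_ + _); rewrite -RintegralZl//.
exact: mint_kap.
Qed.

Lemma repr_slice u w10 w01 w11 : mint m u -> mint m w10 -> mint m w01 -> mint m w11 ->
  wdx c d a b (fun z => u (swp z)) (fun z => w01 (swp z)) ->
  wdx c d a b (fun z => w10 (swp z)) (fun z => w11 (swp z)) ->
  {ae my, forall y, forall s,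
    repr u w10 w01 w11 (s, y) = avg1 a b u y + kap1 a b w10 (s, y)}.
Proof.
move=> iu i10 i01 i11 h1 h2.
apply: filterS2 (avg1_repr iu i01 h1) (kap1_repr i10 i11 h2) => y -> h s.
by rewrite h /repr/= !addrA.
Qed.

Lemma repr_ae u w10 w01 w11 : mint m u -> mint m w10 -> mint m w01 -> mint m w11 ->
  wdx a b c d u w10 ->
  wdx c d a b (fun z => u (swp z)) (fun z => w01 (swp z)) ->
  wdx c d a b (fun z => w10 (swp z)) (fun z => w11 (swp z)) ->
  {ae m, forall z, repr u w10 w01 w11 z = u z}.
Proof.
move=> iu i10 i01 i11 h0 h1 h2.
have mu := mint_measurable iu; have m10 := mint_measurable i10.
have /rect_ae2 := wdx_avg ab mu m10 h0 => h.
apply: rect_ae_eq2 => //; first by apply: continuous_measurable2; exact: repr_continuous.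
apply: filterS2 h (repr_slice iu i10 i01 i11 h1 h2) => y h h'.
by apply: filterS h => x ->; rewrite h'.
Qed.

Lemma repr_bound u w10 w01 w11 z : mint m u -> mint m w10 -> mint m w01 -> mint m w11 ->
  `|repr u w10 w01 w11 z| <= (b - a)^-1 * ((d - c)^-1 * \int[m]_t `|u t|) +
    (b - a)^-1 * (\int[m]_t `|w01 t|) + (d - c)^-1 * (\int[m]_t `|w10 t|) +
    \int[m]_t `|w11 t|.
Proof.
move=> iu i10 i01 i11.
have ba0 : 0 <= (b - a)^-1 by rewrite invr_ge0 subr_ge0 ltW.
have dc0 : 0 <= (d - c)^-1 by rewrite invr_ge0 subr_ge0 ltW.
have n1 : \int[my]_y `|avg1 a b w01 y| <= (b - a)^-1 * (\int[m]_t `|w01 t|).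
  have iI := rect_mint2 (mint_norm i01).
  rewrite (rect_Rint2 (mint_norm i01)) -RintegralZl//.
  apply: Rint_ae_le; [exact: mint_norm (mint_avg1 i01)|exact: mintZ|].
  apply: filterS (rect_sec2 i01) => y iy.
  by rewrite /avg1 normrM ger0_norm// ler_wpM2l// le_normr_Rintegral.
have n2 : \int[mx]_x `|avgy w10 x| <= (d - c)^-1 * (\int[m]_t `|w10 t|).
  have iI := rect_mint1 (mint_norm i10).
  rewrite (rect_Rint1 (mint_norm i10)) -RintegralZl//.
  apply: Rint_ae_le; [exact: mint_norm (mint_avgy i10)|exact: mintZ|].
  apply: filterS (rect_sec1 i10) => x ix.
  by rewrite /avgy /avg1 normrM ger0_norm// ler_wpM2l// le_normr_Rintegral.
rewrite /repr; apply: le_trans (ler_normD _ _) _; apply: lerD; last first.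
  have ik := mint_kapkap z.1 z.2 i11.
  apply: le_trans (le_normr_Rintegral _ ik) _ => //.
  apply: Rint_ae_le; [exact: mint_norm|exact: mint_norm|].
  apply: filterS (rect_in a b c d) => t [tx ty].
  by rewrite !normrM mulrA ler_piMl// mulr_ile1// kap_norm_le1.
apply: le_trans (ler_normD _ _) _; apply: lerD; last first.
  by apply: le_trans n2; apply: kap_norm => //; exact: mint_avgy.
apply: le_trans (ler_normD _ _) _; apply: lerD; last first.
  by apply: le_trans n1; apply: kap_norm => //; exact: mint_avg1.
rewrite !normrM (ger0_norm ba0) (ger0_norm dc0); do 2 apply: ler_wpM2l => //.
exact: le_normr_Rintegral.
Qed.

End sobolev_repr.

(** * A Poincare inequality *)

Section poincare.
Context {R : realType} (a b c d : R).
Hypothesis (ab : a < b) (cd : c < d).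
Local Notation mR := (measurableTypeR R).
Local Notation mx := (mI a b).
Local Notation my := (mI c d).
Local Notation m := (mrect a b c d).
Implicit Types (u v w f g : R * R -> R).

Definition xint g (y : R) := \int[mx]_x `|g (x, y)|.

Lemma xint_ge0 g y : 0 <= xint g y.
Proof. by apply: Rintegral_ge0 => x _. Qed.

Lemma kap1_xint w : mint m w ->
  {ae my, forall y, forall s, `|kap1 a b w (s, y)| <= xint w y}.
Proof. by move=> iw; apply: filterS (rect_sec2 iw) => y iy s; exact: kap_norm. Qed.

Lemma L2_sec2 g : L2 m g -> {ae my, forall y, L2 mx (fun x => g (x, y))}.
Proof.
move=> /L2P[mg ig]; apply: filterS (rect_sec2 ig) => y iy.
by apply/L2P; split => //; exact: measurable_sec2.
Qed.

Lemma rect_z2 (h : R -> R) : mint my h ->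
  mint m (fun z => h z.2) /\ \int[m]_z h z.2 = (b - a) * \int[my]_y h y.
Proof.
move=> ih; have i : mint m (fun z => h z.2).
  by have := rect_tensor (mint_cst mx (1 : R)) ih; congr (mint _ _); apply/funext => z; rewrite mul1r.
split => //; rewrite (rect_Rint2 i) -RintegralZl//.
by apply: eq_Rintegral => y _; rewrite -(mass_mI ab) -RintegralZr//=;
  [apply: eq_Rintegral => x _; rewrite mul1r|exact: mint_cst].
Qed.

(** One factor [b - a] comes from Cauchy-Schwarz on the slice, the other from integrating a function
    of [y] alone over the rectangle. *)
Lemma xint_bound f g k : L2 m f -> L2 m g -> {ae m, forall z, `|f z| <= k * xint g z.2} ->
  ip2 m f f <= (k * (b - a)) ^+ 2 * ip2 m g g.
Proof.
move=> Lf Lg fg; have igg := L2_mint_mul Lg Lg.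
have iG := rect_mint2 igg.
have [iG2 IG2] := rect_z2 iG.
have ba0 : 0 <= b - a by rewrite subr_ge0 ltW.
have hae : {ae my, forall y, (xint g y) ^+ 2 <= (b - a) * \int[mx]_x (g (x, y) * g (x, y))}.
  apply: filterS (L2_sec2 Lg) => y Ly; apply: le_trans (sqr_L1_le Ly) _.
  rewrite /ip2 -(mass_mI ab) /Rintegral /mass integral_cst//= mul1e//.
have hz : {ae m, forall z, (xint g z.2) ^+ 2 <= (b - a) * \int[mx]_x (g (x, z.2) * g (x, z.2))}.
  by apply/mrect_ae; exact: ae_snd hae.
have -> : (k * (b - a)) ^+ 2 * ip2 m g g =
    \int[m]_z (k ^+ 2 * (b - a) * \int[mx]_x (g (x, z.2) * g (x, z.2))).
  by rewrite RintegralZl// IG2 /ip2 (rect_Rint2 igg); ring.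
apply: Rint_ae_le; [exact: L2_mint_mul|exact: mintZ|].
apply: filterS2 fg hz => z fz gz; rewrite -mulrA -expr2 -(real_normK (num_real (f z))).
have h0 : `|f z| ^+ 2 <= (k * xint g z.2) ^+ 2.
  by rewrite lerXn2r// ?nnegrE// (le_trans (normr_ge0 _) fz).
by apply: le_trans h0 _; rewrite exprMn ler_wpM2l// sqr_ge0.
Qed.

Section boundary.
Context (u w10 w01 w20 w11 : R * R -> R).
Hypotheses (iu : mint m u) (i10 : mint m w10) (i01 : mint m w01) (i20 : mint m w20)
  (i11 : mint m w11).
Hypotheses (xu : wdx a b c d u w10) (x10 : wdx a b c d w10 w20) (x01 : wdx a b c d w01 w11)
  (yu : wdx c d a b (fun z => u (swp z)) (fun z => w01 (swp z)))
  (y10 : wdx c d a b (fun z => w10 (swp z)) (fun z => w11 (swp z))).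
Hypothesis ua0 : forall y, c < y < d -> repr a b c d u w10 w01 w11 (a, y) = 0.
Hypothesis ub0 : forall y, c < y < d -> repr a b c d u w10 w01 w11 (b, y) = 0.

Let slice := repr_slice ab cd iu i10 i01 i11 yu y10.

(** Vanishing at [x = a] expresses the mean of the slice by its kernel integral at [a], so [u] is a
    difference of two kernel integrals; hence the factor 2. *)
Lemma boundary_u : {ae m, forall z, `|u z| <= 2 * xint w10 z.2}.
Proof.
have h : {ae my, forall y, avg1 a b u y = - kap1 a b w10 (a, y)}.
  apply: filterS2 slice (mI_in c d) => y h /ua0; rewrite h => /eqP.
  by rewrite addr_eq0 => /eqP.
have [hz kz] : {ae m, forall z, avg1 a b u z.2 = - kap1 a b w10 (a, z.2)} /\
    {ae m, forall z, forall s, `|kap1 a b w10 (s, z.2)| <= xint w10 z.2}.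
  split; apply/mrect_ae; [exact: ae_snd h|exact: ae_snd (kap1_xint i10)].
have := wdx_avg ab (mint_measurable iu) (mint_measurable i10) xu.
apply: filterS3 hz kz => z h1 h2 ->; rewrite h1 mulr2n mulrDl !mul1r.
apply: le_trans (ler_normD _ _) _; rewrite normrN; apply: lerD => //.
by have := h2 z.1; rewrite -surjective_pairing.
Qed.

(** Equal values at both ends give [w10] mean zero on slices, so a single kernel integral remains;
    the factor 2 is kept so that the three bounds share one constant. *)
Lemma boundary_w10 : {ae m, forall z, `|w10 z| <= 2 * xint w20 z.2}.
Proof.
have h : {ae my, forall y, avg1 a b w10 y = 0}.
  have h0 := slice; have h1 := rect_sec2 i10.
  apply: filterS3 h0 h1 (mI_in c d) => y h iy yc; rewrite /avg1.
  have := etrans (ua0 yc) (esym (ub0 yc)); rewrite !h => /addrI; rewrite /kap1/= => E.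
  (* Inside the interval, the kernels at [b] and at [a] differ by exactly 1. *)
  have -> : \int[mx]_x w10 (x, y) =
      \int[mx]_x (- 1 * (kap a b a x * w10 (x, y)) + kap a b b x * w10 (x, y)).
    apply: Rint_ae_eq; first exact: mint_measurable iy.
      by apply: mint_measurable; apply: mint_lin; exact: mint_kap.
    apply: filterS (mI_in a b) => x /andP[ax xb].
    by rewrite /kap /chi (ltNge x a) (ltW ax) xb /=; ring.
  by rewrite Rint_lin; [rewrite E; ring|exact: mint_kap|exact: mint_kap].
have [hz kz] : {ae m, forall z, avg1 a b w10 z.2 = 0} /\
    {ae m, forall z, forall s, `|kap1 a b w20 (s, z.2)| <= xint w20 z.2}.
  split; apply/mrect_ae; [exact: ae_snd h|exact: ae_snd (kap1_xint i20)].
have := wdx_avg ab (mint_measurable i10) (mint_measurable i20) x10.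
apply: filterS3 hz kz => z h1 h2 ->; rewrite h1 add0r.
have := h2 z.1; rewrite -surjective_pairing => /le_trans; apply.
by rewrite ler_peMl ?xint_ge0// ler1n.
Qed.

(* On the side x = a, [repr] depends on y through the primitive of
   [avg1 w01 + kap1 w11 (a, .)], which therefore vanishes. *)
Lemma boundary_w01 : {ae m, forall z, `|w01 z| <= 2 * xint w11 z.2}.
Proof.
pose h t := avg1 a b w01 t + kap1 a b w11 (a, t).
have iavg : mint my (avg1 a b w01) by exact: mint_avg1.
have ika : mint m (fun z => kap a b a z.1 * w11 z).
  have mk : measurable_fun [set: mR * mR] (fun z => kap a b a z.1 * w11 z).
    apply: measurable_funM; last exact: mint_measurable i11.
    exact: (measurableT_comp (measurable_kap a b a)).
  apply: (mint_ae_le mk (mint_norm i11)).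
  by apply: filterS (rect_in a b c d) => z [zx _]; rewrite normrM ler_piMl// kap_norm_le1.
have ik : mint my (fun t => kap1 a b w11 (a, t)) by exact: rect_mint2 ika.
have ih : mint my h by exact: mintD.
pose K := (b - a)^-1 * ((d - c)^-1 * \int[m]_t u t) + \int[mx]_x (kap a b a x * avgy c d w10 x).
have rE y : repr a b c d u w10 w01 w11 (a, y) = K + \int[my]_t (kap c d y t * h t).
  have -> : \int[my]_t (kap c d y t * h t) =
      \int[my]_t (kap c d y t * avg1 a b w01 t) + \int[my]_t (kap c d y t * kap1 a b w11 (a, t)).
    rewrite -RintegralD//; [|exact: mint_kap|exact: mint_kap].
    by apply: eq_Rintegral => t _; rewrite /h mulrDr.
  have -> : \int[my]_t (kap c d y t * kap1 a b w11 (a, t)) =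
      \int[m]_t (kap a b a t.1 * (kap c d y t.2 * w11 t)).
    have ikk := mint_kapkap ab cd a y i11.
    rewrite (rect_Rint2 ikk); apply: Rint_ae_eq.
    - by apply: mint_measurable; exact: mint_kap.
    - by apply: mint_measurable; exact: rect_mint2 ikk.
    apply: filterS (rect_sec2 i11) => t it.
    rewrite /kap1 -RintegralZl//; last exact: mint_kap.
    by apply: eq_Rintegral => x _; ring.
  by rewrite /repr /K/=; ring.
(* Adding back the affine part of the kernel turns the kernel integral, equal to [- K] by the
   boundary condition, into the primitive of [h], which is thus this constant. *)
pose K' := - K + \int[my]_t ((d - t) / (d - c) * h t).
have iaff : mint my (fun t => (d - t) / (d - c) * h t).
  have := mintB (mint_chi d ih) (mint_kap cd d ih).
  by congr (mint _ _); apply/funext => t; rewrite /kap; ring.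
have h0 : {ae my, forall t, h t = 0}.
  apply: (prim_cst_ae0 (c := K') ih) => y yc.
  have := ua0 yc; rewrite rE => E.
  have -> : prim c d h y = \int[my]_t (kap c d y t * h t + (d - t) / (d - c) * h t).
    by apply: eq_Rintegral => t _; rewrite /kap; ring.
  rewrite RintegralD//; last exact: mint_kap.
  by move: E => /eqP; rewrite addrC addr_eq0 => /eqP ->.
have [hz kz] : {ae m, forall z, h z.2 = 0} /\
    {ae m, forall z, forall s, `|kap1 a b w11 (s, z.2)| <= xint w11 z.2}.
  split; apply/mrect_ae; [exact: ae_snd h0|exact: ae_snd (kap1_xint i11)].
have := wdx_avg ab (mint_measurable i01) (mint_measurable i11) x01.
apply: filterS3 hz kz => z h1 h2 ->; rewrite mulr2n mulrDl !mul1r.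
move/eqP: h1; rewrite /h addr_eq0 => /eqP ->.
apply: le_trans (ler_normD _ _) _; rewrite normrN; apply: lerD => //.
by have := h2 z.1; rewrite -surjective_pairing.
Qed.

End boundary.
End poincare.

Section crep.
Context {R : realType} (l : R).
Hypothesis l0 : 0 < l.
Local Notation mR := (measurableTypeR R).
Local Notation mO := (mrect 0 pi (- l) l).
Implicit Types (u v w : R * R -> R).

Let pi0 : (0 : R) < pi. Proof. exact: pi_gt0. Qed.
Let ll : - l < l. Proof. by move: l0; lra. Qed.

Lemma mI_ae_ex (a b p q : R) (P : R -> Prop) : a <= p -> p < q -> q <= b ->
  {ae mI a b, forall x, P x} -> exists2 x, p < x < q & P x.
Proof.
move=> ap pq qb /(restr_ae _ (measurable_oo a b))[N [mN N0 PN]].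
apply: contrapT => /forall2NP nex.
have sN : `]p, q[%classic `<=` N.
  move=> x /=; rewrite in_itv/= => pxq; apply: PN => /= h.
  have [//|nP] := nex x; apply: nP; apply: h; rewrite /= in_itv/=.
  by have /andP[px xq] := pxq; rewrite (le_lt_trans ap px) (lt_le_trans xq qb).
have mpq : measurable (`]p, q[%classic : set mR) by exact: measurable_itv.
have : (@lebesgue_measure R `]p, q[%classic <= 0)%E.
  by rewrite -N0; apply: le_measure => //; rewrite inE.
by rewrite lebesgue_measure_itv/= lte_fin pq -EFinB lee_fin subr_le0 leNgt pq.
Qed.

Lemma Omega_open : open (Omega l).
Proof.
rewrite /Omega (_ : _ `*` _ = fst @^-1` [set` `]0, pi[] `&` snd @^-1` [set` `]- l, l[])//.
by apply: openI; apply: open_comp => [z _|]; do ?[exact: cvg_fst|exact: cvg_snd|exact: interval_open].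
Qed.

Lemma ae_ex_open (U : set (R * R)) z (P : R * R -> Prop) : open U -> U z -> Omega l z ->
  {ae mO, forall z, P z} -> exists t, [/\ U t, Omega l t & P t].
Proof.
move=> oU Uz Oz aeP.
have : nbhs z (U `&` Omega l) by apply: open_nbhs_nbhs; split; [exact: openI oU Omega_open|].
move=> /nbhs_ballP[e /= e0 be].
have e1 : z.1 - e < z.1 + e by lra. have e2 : z.2 - e < z.2 + e by lra.
have h x y : z.1 - e < x < z.1 + e -> z.2 - e < y < z.2 + e -> U (x, y) /\ Omega l (x, y).
  move=> /andP[x1 x2] /andP[y1 y2]; apply: be; split; rewrite /ball/= ltr_norml;
  by apply/andP; split; lra.
have [Ox Oy] := Oz; rewrite /= !in_itv/= in Ox Oy.
pose p := Num.max (z.1 - e) 0; pose q := Num.min (z.1 + e) pi.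
pose p' := Num.max (z.2 - e) (- l); pose q' := Num.min (z.2 + e) l.
have pq : p < q by rewrite gt_max !lt_min; move: e1 Ox e0; lra.
have pq' : p' < q' by rewrite gt_max !lt_min; move: e2 Oy e0; lra.
have [||x] := mI_ae_ex _ pq _ (rect_ae1 aeP); rewrite ?le_max ?ge_min ?lexx ?orbT//.
rewrite gt_max lt_min => xpq.
move=> /(mI_ae_ex _ pq' _)[||y]; rewrite ?le_max ?ge_min ?lexx ?orbT//.
rewrite gt_max lt_min => ypq Pxy; exists (x, y).
by have [||? ?] := h x y; [move: xpq; lra|move: ypq; lra|].
Qed.

Lemma closure_OmegaP z : 0 <= z.1 <= pi -> - l <= z.2 <= l -> closure (Omega l) z.
Proof.
move=> z1 z2 B nB.
(* The segment towards the centre of the rectangle is interior for [0 < h < 1]. *)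
pose path (h : R) : R * R := (z.1 + h * (pi / 2 - z.1), z.2 + h * (- z.2)).
have cpath : path h @[h --> (0 : R)] --> z.
  rewrite [X in _ --> X](_ : z = (z.1 + 0 * (pi / 2 - z.1), z.2 + 0 * (- z.2))); last first.
    by rewrite !mul0r !addr0; exact: surjective_pairing.
  have h (x y : R) : x + h * y @[h --> (0 : R)] --> x + 0 * y.
    by apply: cvgD; [exact: cvg_cst|apply: cvgM; [exact: cvg_id|exact: cvg_cst]].
  exact: (cvg_pair (h z.1 (pi / 2 - z.1)) (h z.2 (- z.2))).
have n1 : \forall h \near (0 : R)^'+, B (path h).
  by apply: cvg_at_right_filter cpath _ nB.
have n2 : \forall h \near (0 : R)^'+, h < 1 by exact: nbhs_right_lt.
have n3 : \forall h \near (0 : R)^'+, 0 < h by exact: nbhs_right_gt.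
near (0 : R)^'+ => h.
have Bh : B (path h) by near: h.
have h1 : h < 1 by near: h.
have h0 : 0 < h by near: h.
exists (path h); split => //; split; rewrite /= in_itv/=.
  have p0 : 0 < pi / 2 :> R by rewrite divr_gt0.
  have a1 : 0 < h * (pi / 2) by exact: mulr_gt0.
  have a2 : 0 <= (1 - h) * z.1 by apply: mulr_ge0; move: z1; lra.
  have a3 : 0 <= (1 - h) * (pi - z.1) by apply: mulr_ge0; move: z1; lra.
  apply/andP; split.
    by rewrite (_ : _ + _ = h * (pi / 2) + (1 - h) * z.1); [lra|ring].
  by rewrite -subr_gt0 (_ : _ - _ = h * (pi / 2) + (1 - h) * (pi - z.1)); [lra|field].
have a1 : 0 < h * l by exact: mulr_gt0.
have a2 : 0 <= (1 - h) * (l + z.2) by apply: mulr_ge0; move: z2; lra.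
have a3 : 0 <= (1 - h) * (l - z.2) by apply: mulr_ge0; move: z2; lra.
apply/andP; split.
  by rewrite -subr_gt0 (_ : _ - _ = h * l + (1 - h) * (l + z.2)); [lra|ring].
by rewrite -subr_gt0 (_ : _ - _ = h * l + (1 - h) * (l - z.2)); [lra|ring].
Unshelve. all: by end_near.
Qed.

(** Near a point where the values differ by [e], both functions move by less than [e / 2]; yet every
    neighbourhood meets Omega in an open set, where a point of agreement exists. *)
Lemma cont_ae_eq v w : {within closure (Omega l), continuous v} ->
  {within closure (Omega l), continuous w} -> {ae mO, forall z, v z = w z} ->
  forall z, closure (Omega l) z -> v z = w z.
Proof.
move=> /subspace_continuousP cv /subspace_continuousP cw vw z cz.
apply: contrapT => /eqP; rewrite -subr_eq0 -normr_gt0 => e0.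
set e := `|v z - w z| in e0.
have e20 : 0 < e / 2 by exact: divr_gt0.
have /cvgrPdist_lt/(_ _ e20) nv := cv z cz; have /cvgrPdist_lt/(_ _ e20) nw := cw z cz.
have : within (closure (Omega l)) (nbhs z) [set t | `|v z - v t| < e / 2 /\ `|w z - w t| < e / 2].
  by apply: filterS2 nv nw => t; split.
rewrite /within/= nbhsE => -[U [oU Uz] hU].
have [t0 [Ot0 Ut0]] := cz U (open_nbhs_nbhs (conj oU Uz)).
have [t [Ut Ot E]] := ae_ex_open oU Ut0 Ot0 vw.
have [h1 h2] := hU t Ut (subset_closure Ot).
have : e < e / 2 + e / 2.
  apply: le_lt_trans (ltrD h1 h2); rewrite /e.
  rewrite (_ : v z - w z = (v z - v t) - (w z - w t)); last by rewrite E; ring.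
  by rewrite -[X in _ <= _ + X]normrN; exact: ler_normD.
by lra.
Qed.

Definition reprw (w : nat -> nat -> R * R -> R) : R * R -> R :=
  repr 0 pi (- l) l (w 0 0)%N (w 1 0)%N (w 0 1)%N (w 1 1)%N.

Lemma jet_repr u (w : nat -> nat -> R * R -> R) : L2 mO u -> jet l u w ->
  continuous (reprw w) /\ {ae mO, forall z, reprw w z = u z}.
Proof.
move=> Lu jw; have L i j (ij : (i + j <= 2)%N) : mint mO (w i j).
  by apply: L2_mint; exact: (jet_L2 jw ij).
have i00 := L 0%N 0%N isT; have i10 := L 1%N 0%N isT; have i01 := L 0%N 1%N isT.
have i11 := L 1%N 1%N isT.
split; first exact: repr_continuous.
have h := repr_ae pi0 ll i00 i10 i01 i11 (jet_wx l0 jw (i := 0) (j := 0) isT)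
  (jet_wy l0 jw (i := 0) (j := 0) isT) (jet_wy l0 jw (i := 1) (j := 0) isT).
by apply: filterS2 h (jet_ae0 l0 jw Lu) => z h1 ->.
Qed.

Lemma crepP u : H2 l u -> {within closure (Omega l), continuous (crep l u)} /\
  {ae mO, forall z, crep l u z = u z}.
Proof.
move=> Hu; have [c e] := jet_repr (H2_L2 Hu) (H2_jet Hu).
have := @xgetPex _ (cst 0) [set v | {within closure (Omega l), continuous v} /\
    {ae dO l, forall z, v z = u z}]; rewrite dO_mrect; apply.
exists (reprw (fun i j => wD l i j u)); split => //.
exact: continuous_subspaceT.
Qed.

Lemma crep_unique u v : H2 l u -> {within closure (Omega l), continuous v} ->
  {ae mO, forall z, v z = u z} -> forall z, closure (Omega l) z -> crep l u z = v z.
Proof.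
move=> Hu cv vu; have [c e] := crepP Hu; apply: cont_ae_eq => //.
by apply: filterS2 e vu => z -> ->.
Qed.

(** Makes the chosen representative an explicit integral, up to the boundary; the sup bound and the
    boundary condition are exploited through this formula. *)
Lemma crepE u (w : nat -> nat -> R * R -> R) : L2 mO u -> jet l u w ->
  forall z, closure (Omega l) z -> crep l u z = reprw w z.
Proof.
move=> Lu jw; have [Hu _] := jet_H2 l0 Lu jw; have [c e] := jet_repr Lu jw.
by apply: crep_unique => //; exact: continuous_subspaceT.
Qed.

Lemma crep_lin k u v : H2 l u -> H2 l v -> forall z, closure (Omega l) z ->
  crep l (fun z => k * u z + v z) z = k * crep l u z + crep l v z.
Proof.
move=> Hu Hv; have [Huv _] := H2_lin l0 k Hu Hv.
have [cu eu] := crepP Hu; have [cv ev] := crepP Hv.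
apply: crep_unique => //; last by apply: filterS2 eu ev => z -> ->.
move=> z; apply: cvgD; last exact: cv.
by apply: cvgM; [exact: cvg_cst|exact: cu].
Qed.

Lemma crep_mul u v : H2 l u -> H2 l v -> H2 l (u \* v) -> forall z, closure (Omega l) z ->
  crep l (u \* v) z = crep l u z * crep l v z.
Proof.
move=> Hu Hv Huv; have [cu eu] := crepP Hu; have [cv ev] := crepP Hv.
apply: crep_unique => //; last by apply: filterS2 eu ev => z /= -> ->.
by move=> z; apply: cvgM; [exact: cu|exact: cv].
Qed.

End crep.

(** * H^2 as a complete semi-inner product space *)

Section sobolev_hilbert.
Context {R : realType} (l : R).
Hypothesis l0 : 0 < l.
Local Notation mR := (measurableTypeR R).
Local Notation mO := (mrect 0 pi (- l) l).
Implicit Types (u v w : R * R -> R).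

Definition sob_idx : seq (nat * nat) := [:: (0, 0); (1, 0); (0, 1); (2, 0); (1, 1); (0, 2)]%N.

Definition sob_dot u v := \sum_(k <- sob_idx) ip2 mO (wD l k.1 k.2 u) (wD l k.1 k.2 v).

Lemma sob_idx_le k : k \in sob_idx -> (k.1 + k.2 <= 2)%N.
Proof. by rewrite !inE => /or4P[|||/or3P[]] /eqP->. Qed.

Lemma L2_wD i j u : (i + j <= 2)%N -> H2 l u -> L2 mO (wD l i j u).
Proof. by move=> ij Hu; exact: (jet_L2 (H2_jet Hu) ij). Qed.

Lemma H2_normE u : H2_norm l u = Num.sqrt (sob_dot u u).
Proof.
have sumE (F : nat -> nat -> R) : \sum_(i < 3) \sum_(j < 3 | (i + j <= 2)%N) F i j =
    \sum_(k <- sob_idx) F k.1 k.2.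
  under eq_bigr do rewrite big_mkcond; rewrite !big_cons big_nil !big_ord_recl !big_ord0/=.
  by rewrite /bump/=; ring.
rewrite /H2_norm (sumE (fun i j => \int[dO l]_z (wD l i j u z ^+ 2))).
by [].
Qed.

Lemma sob_ip : semi_ip (H2 l) sob_dot.
Proof.
split.
- by move=> k u v Hu Hv; have [] := H2_lin l0 k Hu Hv.
- move=> k u v w Hu Hv Hw; have [Huv wE] := H2_lin l0 k Hu Hv.
  rewrite /sob_dot mulr_sumr -big_split/=; apply: eq_big_seq => i /sob_idx_le hi.
  rewrite -(ip_lin (L2_ip mO)); [|exact: L2_wD..].
  apply: ip2_ae_eq; [exact: L2_wD| |exact: L2_wD|exact: L2_wD|exact: wE|exact: aeW].
  by apply: L2_lin; exact: L2_wD.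
- move=> u v Hu Hv; apply: eq_big_seq => i /sob_idx_le hi.
  by apply: (ip_sym (L2_ip mO)); exact: L2_wD.
- move=> u Hu; rewrite /sob_dot big_seq; apply: sumr_ge0 => i /sob_idx_le hi.
  by apply: (ip_ge0 (L2_ip mO)); exact: L2_wD.
Qed.

Lemma wD_comb i j k k' u v : (i + j <= 2)%N -> H2 l u -> H2 l v ->
  {ae mO, forall z, wD l i j (comb k k' u v) z = comb k k' (wD l i j u) (wD l i j v) z}.
Proof.
move=> ij Hu Hv; rewrite combE; have [Hv' E'] := H2_lin l0 (k' - 1) Hv Hv.
have [_ E] := H2_lin l0 k Hu Hv'.
apply: filterS2 (E _ _ ij) (E' _ _ ij) => z -> ->; rewrite /comb; ring.
Qed.

Lemma sob_sqdist u v : H2 l u -> H2 l v ->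
  sqdist sob_dot u v = \sum_(k <- sob_idx) sqdist (ip2 mO) (wD l k.1 k.2 u) (wD l k.1 k.2 v).
Proof.
move=> Hu Hv; apply: eq_big_seq => i /sob_idx_le hi.
have L : L2 mO (wD l i.1 i.2 (comb 1 (-1) u v)).
  by apply: L2_wD => //; exact: ip_comb sob_ip _ _ _ _ Hu Hv.
have L' : L2 mO (comb 1 (-1) (wD l i.1 i.2 u) (wD l i.1 i.2 v)).
  by apply: (ip_comb (L2_ip mO)); exact: L2_wD.
by apply: ip2_ae_eq => //; exact: wD_comb.
Qed.

Lemma sob_term (F : nat * nat -> R) k : (forall k, k \in sob_idx -> 0 <= F k) ->
  k \in sob_idx -> F k <= \sum_(k <- sob_idx) F k.
Proof.
move=> F0 hk; rewrite (big_rem k hk) lerDl [X in 0 <= X]big_seq; apply: sumr_ge0 => i /mem_rem.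
exact: F0.
Qed.

Lemma mem_sob_idx i j : (i + j <= 2)%N -> (i, j) \in sob_idx.
Proof. by case: i j => [|[|[|i]]] [|[|[|j]]]. Qed.

Lemma wD_sqdist_le i j u v : (i + j <= 2)%N -> H2 l u -> H2 l v ->
  sqdist (ip2 mO) (wD l i j u) (wD l i j v) <= sqdist sob_dot u v.
Proof.
move=> ij Hu Hv; rewrite sob_sqdist//.
apply: (@sob_term (fun k => sqdist (ip2 mO) (wD l k.1 k.2 u) (wD l k.1 k.2 v)) (i, j)).
  by move=> k /sob_idx_le hk; apply: (sqdist_ge0 (L2_ip mO)); exact: L2_wD.
exact: mem_sob_idx.
Qed.

Lemma sob_ge_ip2 i j u : (i + j <= 2)%N -> H2 l u ->
  ip2 mO (wD l i j u) (wD l i j u) <= sob_dot u u.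
Proof.
move=> ij Hu.
apply: (@sob_term (fun k => ip2 mO (wD l k.1 k.2 u) (wD l k.1 k.2 u)) (i, j)).
  by move=> k /sob_idx_le hk; apply: (ip_ge0 (L2_ip mO)); exact: L2_wD.
exact: mem_sob_idx.
Qed.

Lemma sqcvg_Rint (s : nat -> R * R -> R) u g : (forall n, L2 mO (s n)) -> L2 mO u -> L2 mO g ->
  sqcvg (ip2 mO) s u -> \int[mO]_z (s n z * g z) @[n --> \oo] --> \int[mO]_z (u z * g z).
Proof.
move=> Ls Lu Lg su; apply/cvgrPdist_lt => e e0.
have gg0 := ip_ge0 (L2_ip mO) Lg.
have d0 : 0 < e ^+ 2 / (ip2 mO g g + 1) by rewrite divr_gt0 ?exprn_gt0//; lra.
have [N hN] := su _ d0; exists N => // n /= Nn.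
have Lc : L2 mO (comb 1 (-1) (s n) u) by exact: (ip_comb (L2_ip mO)).
have := ip_cs (L2_ip mO) Lc Lg; rewrite (ip_combl (L2_ip mO))// mul1r mulN1r => h.
rewrite distrC -(@ltr_pXn2r _ 2)// ?nnegrE// ?ltW// real_normK ?num_real//.
apply: le_lt_trans h _; have := hN n Nn; rewrite /sqdist.
have := ip_ge0 (L2_ip mO) Lc; move: (ip2 _ (comb _ _ _ _) _) => D D0.
rewrite ltr_pdivlMr; last by lra.
apply: le_lt_trans; rewrite ler_wpM2l//; lra.
Qed.

Lemma L2_bounded_fun (phi : R * R -> R) : measurable_fun [set: mR * mR] phi ->
  (exists M : R, forall z, `|phi z| <= M) -> L2 mO phi.
Proof.
move=> mphi [M hM]; have hM' : {ae mO, forall z, `|phi z| <= M} by exact: aeW.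
have := L2_mul_bounded mphi hM' (L2_cst mO 1).
by congr (L2 _ _); apply/funext => z; rewrite mulr1.
Qed.

(** For a fixed test function both sides of the weak identity are L2 pairings, so they pass to the
    limit, and the limits of the derivatives are derivatives of the limit. *)
Lemma sob_limit (s : nat -> R * R -> R) (w : nat -> nat -> R * R -> R) :
  (forall n, H2 l (s n)) ->
  (forall i j, (i + j <= 2)%N -> L2 mO (w i j) /\
     sqcvg (ip2 mO) (fun n => wD l i j (s n)) (w i j)) ->
  H2 l (w 0 0)%N /\ sqcvg sob_dot s (w 0 0)%N.
Proof.
move=> Hs hw; have Lw i j (ij : (i + j <= 2)%N) : L2 mO (w i j) by have [] := hw i j ij.
have jw : jet l (w 0 0)%N w.
  split=> // i j ij phi tphi; have tij := test_fun_iter i j tphi.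
  have Lt f : test_fun l f -> L2 mO f.
    by move=> tf; apply: L2_bounded_fun; [exact: test_fun_measurable tf|exact: test_fun_bounded tf].
  have [_ c0] := hw 0%N 0%N isT; have [_ c1] := hw i j ij.
  have k0 := sqcvg_Rint (fun n => @L2_wD 0 0 _ isT (Hs n)) (Lw 0%N 0%N isT) (Lt _ tij) c0.
  have k1 := sqcvg_Rint (fun n => L2_wD ij (Hs n)) (Lw i j ij) (Lt _ tphi) c1.
  have k2 : ((-1) ^+ (i + j) * \int[mO]_z (wD l i j (s n) z * phi z)) @[n --> \oo] -->
      (-1) ^+ (i + j) * \int[mO]_z (w i j z * phi z).
    by apply: cvgM; [exact: cvg_cst|exact: k1].
  have E n : \int[mO]_z (wD l 0 0 (s n) z * iter i dx (iter j dy phi) z) =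
      (-1) ^+ (i + j) * \int[mO]_z (wD l i j (s n) z * phi z).
    have jn := H2_jet (Hs n); have := jet_weak jn ij tphi; rewrite !dO_Rint => <-.
    apply: Rint_ae_eq.
    - apply: measurable_funM; last exact: test_fun_measurable tij.
      by apply: L2_measurable; exact: L2_wD.
    - apply: measurable_funM; last exact: test_fun_measurable tij.
      exact: L2_measurable (H2_L2 (Hs n)).
    by apply: filterS (jet_ae0 l0 jn (H2_L2 (Hs n))) => z ->.
  rewrite (funext E) in k0; rewrite !dO_Rint.
  exact: (cvg_unique _ k0 k2).
have [H E] := jet_H2 l0 (Lw 0%N 0%N isT) jw; split => //.
move=> e e0; have e6 : 0 < e / 6 by rewrite divr_gt0.
have hN k : exists N, k \in sob_idx -> forall n, (N <= n)%N ->
    sqdist (ip2 mO) (wD l k.1 k.2 (s n)) (w k.1 k.2) < e / 6.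
  case: (boolP (k \in sob_idx)) => hk; last by exists 0%N.
  by have [_ /(_ _ e6)[N hN]] := hw k.1 k.2 (sob_idx_le hk); exists N.
have [N hNk] := choice hN; exists (\max_(k <- sob_idx) N k) => n Nn.
rewrite sob_sqdist//; have -> : e = \sum_(k <- sob_idx) (e / 6).
  by rewrite !big_cons big_nil; field.
rewrite big_seq [ltRHS]big_seq; apply: ltr_sum.
  by [].
move=> k hk; apply: le_lt_trans (hNk k hk n _); last first.
  by apply: leq_trans Nn; exact: leq_bigmax_seq.
have Lk := L2_wD (sob_idx_le hk) (Hs n); have Lk' := L2_wD (sob_idx_le hk) H.
have Lk'' := Lw _ _ (sob_idx_le hk).
rewrite le_eqVlt; apply/orP; left; apply/eqP.
have L1 := ip_comb (L2_ip mO) 1 (-1) Lk Lk'; have L2' := ip_comb (L2_ip mO) 1 (-1) Lk Lk''.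
by apply: ip2_ae_eq => //; apply: filterS (E _ _ (sob_idx_le hk)) => z; rewrite /comb => ->.
Qed.

Lemma sob_complete : complete_ip (H2 l) sob_dot.
Proof.
move=> s Hs cs.
have ex k : exists w, (k.1 + k.2 <= 2)%N ->
    L2 mO w /\ sqcvg (ip2 mO) (fun n => wD l k.1 k.2 (s n)) w.
  case: (boolP (k.1 + k.2 <= 2)%N) => ij; last by exists (cst 0).
  have [|e e0|w Lw cw] := L2_complete (mu := mO) (s := fun n => wD l k.1 k.2 (s n)).
  - by move=> n; exact: L2_wD.
  - have [N hN] := cs e e0; exists N => p q Np Nq; apply: le_lt_trans (hN p q Np Nq).
    exact: wD_sqdist_le.
  by exists w.
have [w hw] := choice ex.
have [H c] := sob_limit Hs (fun i j ij => hw (i, j) ij).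
by exists (w (0, 0)%N).
Qed.

End sobolev_hilbert.

(** * The plate form *)

Lemma Rint_form d (T : measurableType d) (R : realType) (mu : {finite_measure set T -> \bar R})
    (s : R) (a b c a' b' c' : T -> R) :
  L2 mu a -> L2 mu b -> L2 mu c -> L2 mu a' -> L2 mu b' -> L2 mu c' ->
  \int[mu]_z ((a z + b z) * (a' z + b' z) +
     (1 - s) * (2 * c z * c' z - a z * b' z - b z * a' z)) =
  ip2 mu a a' + ip2 mu b b' + s * (ip2 mu a b' + ip2 mu b a') + 2 * (1 - s) * ip2 mu c c'.
Proof.
move=> La Lb Lc La' Lb' Lc'.
have i1 := L2_mint_mul La La'; have i2 := L2_mint_mul Lb Lb'; have i3 := L2_mint_mul La Lb'.
have i4 := L2_mint_mul Lb La'; have i5 := L2_mint_mul Lc Lc'.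
transitivity (\int[mu]_z (s * (a z * b' z) + (s * (b z * a' z) +
    (2 * (1 - s) * (c z * c' z) + (1 * (a z * a' z) + b z * b' z))))).
  by apply: eq_Rintegral => z _; ring.
have j1 := mint_lin 1 i1 i2; have j2 := mint_lin (2 * (1 - s)) i5 j1.
have j3 := mint_lin s i4 j2.
by rewrite (Rint_lin s i3 j3) (Rint_lin s i4 j2) (Rint_lin _ i5 j1) (Rint_lin 1 i1 i2) /ip2; ring.
Qed.

(** Positivity on [a + b] and [a - b] bounds twice the cross product by the sum of squares, which
    costs a factor between [1 - s] and [1 + s]. *)
Lemma form_bounds d (T : measurableType d) (R : realType) (mu : {finite_measure set T -> \bar R})
    (s : R) (a b c : T -> R) : 0 < s < 2^-1 -> L2 mu a -> L2 mu b -> L2 mu c ->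
  let F := ip2 mu a a + ip2 mu b b + s * (ip2 mu a b + ip2 mu b a) + 2 * (1 - s) * ip2 mu c c in
  (1 - s) * (ip2 mu a a + ip2 mu b b + ip2 mu c c) <= F /\
  F <= 2 * (ip2 mu a a + ip2 mu b b + ip2 mu c c).
Proof.
move=> s01 La Lb Lc; have I := L2_ip mu.
have := ip_ge0 I (ip_comb I 1 1 La Lb); have := ip_ge0 I (ip_comb I 1 (-1) La Lb).
have := ip_ge0 I Lc; rewrite !(ip_comb2 I)// (ip_sym I Lb La).
move: (ip2 mu a a) (ip2 mu b b) (ip2 mu a b) (ip2 mu c c) => A B D C hC h1 h2.
by split; nra.
Qed.

(** [A], [B], [C] are the squared norms of [u_xx], [u_yy], [u_xy], while [D], [E], [F] are those of
    [u_x], [u_y], [u]. Chaining the Poincare bounds gives the factor [1 + k + k + k * k]. *)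
Lemma coercive_arith (R : realFieldType) (k s A B C D E F H : R) : 0 <= k -> 0 < s ->
  F <= k * D -> D <= k * A -> E <= k * C ->
  s * (A + B + C) <= H -> 0 <= A -> 0 <= B -> 0 <= C ->
  F + (D + (E + (A + (C + (B + 0))))) <= s^-1 * (1 + k + k + k * k) * H.
Proof.
move=> k0 s0 f1 f2 f3 f4 A0 B0' C0; have f5 := ler_wpM2l k0 f2.
have f6 : A + B + C <= s^-1 * H by rewrite ler_pdivlMl.
have K0 : 0 <= 1 + k + k + k * k by rewrite !addr_ge0// mulr_ge0.
rewrite mulrAC; apply: le_trans (ler_wpM2r K0 f6).
have q1 := mulr_ge0 k0 A0; have q2 := mulr_ge0 k0 B0'; have q3 := mulr_ge0 k0 C0.
have q4 := mulr_ge0 k0 q2; have q5 := mulr_ge0 k0 q3; have q6 := mulr_ge0 k0 q1.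
have -> : (A + B + C) * (1 + k + k + k * k) = A + B + C + k * A + k * A + k * B + k * B +
  k * C + k * C + k * (k * A) + k * (k * B) + k * (k * C) by ring.
move: f1 f2 f3 f5 q1 q2 q3 q4 q5 q6.
move: (k * (k * A)) (k * (k * B)) (k * (k * C)) (k * D) => a1 a2 a3 a4.
move: (k * A) (k * B) (k * C) => a5 a6 a7; lra.
Qed.

Section plate_form.
Context {R : realType} (l sigma : R).
Hypotheses (l0 : 0 < l) (hsigma : 0 < sigma < 2^-1).
Local Notation mR := (measurableTypeR R).
Local Notation mO := (mrect 0 pi (- l) l).
Local Notation ip := (ip2 mO).
Implicit Types (u v w : R * R -> R).

Let pi0 : (0 : R) < pi. Proof. exact: pi_gt0. Qed.
Let ll : - l < l. Proof. by move: l0; lra. Qed.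
Let ipO := L2_ip mO.
Let s1 : 0 < 1 - sigma. Proof. by case/andP: hsigma => h1 h2; lra. Qed.

Lemma sob_ge0 u : H2 l u -> 0 <= sob_dot l u u.
Proof. exact: (ip_ge0 (sob_ip l0)). Qed.

Lemma L1_wD_le i j u : (i + j <= 2)%N -> H2 l u ->
  \int[mO]_z `|wD l i j u z| <= Num.sqrt (mass mO * sob_dot l u u).
Proof.
move=> ij Hu; have L := L2_wD ij Hu.
have I0 : 0 <= \int[mO]_z `|wD l i j u z| by apply: Rintegral_ge0.
rewrite -(ler_pXn2r (ltn0Sn 1)) ?nnegrE ?sqrtr_ge0// sqr_sqrtr; last first.
  by rewrite mulr_ge0 ?mass_ge0 ?sob_ge0.
apply: le_trans (sqr_L1_le L) _; rewrite ler_wpM2l ?mass_ge0//.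
exact: sob_ge_ip2.
Qed.

Lemma crep_bound : exists2 C, 0 <= C & forall u z, H2 l u -> closure (Omega l) z ->
  crep l u z ^+ 2 <= C * sob_dot l u u.
Proof.
pose k : R := (pi - 0)^-1 * (l - - l)^-1 + (pi - 0)^-1 + (l - - l)^-1 + 1.
have p0 : 0 <= (pi - 0)^-1 :> R by rewrite invr_ge0 subr_ge0 ltW.
have q0 : 0 <= (l - - l)^-1 :> R by rewrite invr_ge0 subr_ge0 ltW.
have k0 : 0 <= k by rewrite !addr_ge0// mulr_ge0.
exists (k ^+ 2 * mass mO); first by rewrite mulr_ge0 ?mass_ge0 ?sqr_ge0.
move=> u z Hu cz; rewrite (crepE l0 (H2_L2 Hu) (H2_jet Hu) cz).
have L i j (ij : (i + j <= 2)%N) : mint mO (wD l i j u) by apply: L2_mint; exact: L2_wD.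
have := repr_bound pi0 ll z (L 0%N 0%N isT) (L 1%N 0%N isT) (L 0%N 1%N isT) (L 1%N 1%N isT).
have b00 := @L1_wD_le 0 0 _ isT Hu; have b10 := @L1_wD_le 1 0 _ isT Hu.
have b01 := @L1_wD_le 0 1 _ isT Hu; have b11 := @L1_wD_le 1 1 _ isT Hu.
set S := Num.sqrt _ in b00 b10 b01 b11; move=> h.
have S0 : 0 <= S by exact: sqrtr_ge0.
have {}h : `|reprw l (fun i j => wD l i j u) z| <= k * S.
  have aux (p q a b c d T x : R) : 0 <= p -> 0 <= q -> a <= T -> b <= T -> c <= T -> d <= T ->
      x <= p * (q * a) + p * b + q * c + d -> x <= (p * q + p + q + 1) * T.
    move=> P Q A B C D /le_trans; apply; rewrite !mulrDl mul1r -mulrA.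
    by do 3?[apply: lerD => //]; do ?[apply: ler_wpM2l => //].
  exact: aux p0 q0 b00 b01 b10 b11 h.
rewrite -(real_normK (num_real _)) -mulrA.
rewrite -[mass mO * _]sqr_sqrtr; last by rewrite mulr_ge0 ?mass_ge0 ?sob_ge0.
by rewrite -exprMn ler_pXn2r// ?nnegrE// mulr_ge0.
Qed.

Lemma H2s_H2 u : H2s l u -> H2 l u. Proof. by case. Qed.

Lemma ip_wD_lin i j i' j' k u v w : (i + j <= 2)%N -> (i' + j' <= 2)%N ->
  H2 l u -> H2 l v -> H2 l w ->
  ip (wD l i j (fun z => k * u z + v z)) (wD l i' j' w) =
  k * ip (wD l i j u) (wD l i' j' w) + ip (wD l i j v) (wD l i' j' w).
Proof.
move=> ij ij' Hu Hv Hw; have [Huv wE] := H2_lin l0 k Hu Hv.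
rewrite -(ip_lin ipO); [|exact: L2_wD..].
apply: ip2_ae_eq; [exact: L2_wD| |exact: L2_wD|exact: L2_wD|exact: wE|exact: aeW].
by apply: L2_lin; exact: L2_wD.
Qed.

Lemma H2s_dotE u v : H2 l u -> H2 l v -> H2s_dot l sigma u v =
  ip (wD l 2 0 u) (wD l 2 0 v) + ip (wD l 0 2 u) (wD l 0 2 v) +
  sigma * (ip (wD l 2 0 u) (wD l 0 2 v) + ip (wD l 0 2 u) (wD l 2 0 v)) +
  2 * (1 - sigma) * ip (wD l 1 1 u) (wD l 1 1 v).
Proof.
move=> Hu Hv; have L i j (ij : (i + j <= 2)%N) f (Hf : H2 l f) : L2 mO (wD l i j f) := L2_wD ij Hf.
exact: (Rint_form sigma (L 2%N 0%N isT u Hu) (L 0%N 2%N isT u Hu) (L 1%N 1%N isT u Hu)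
  (L 2%N 0%N isT v Hv) (L 0%N 2%N isT v Hv) (L 1%N 1%N isT v Hv)).
Qed.

Lemma H2s_dot_ge u : H2 l u -> (1 - sigma) * (ip (wD l 2 0 u) (wD l 2 0 u) +
  ip (wD l 0 2 u) (wD l 0 2 u) + ip (wD l 1 1 u) (wD l 1 1 u)) <= H2s_dot l sigma u u.
Proof.
move=> Hu; rewrite (H2s_dotE Hu Hu).
by have [] := form_bounds hsigma (@L2_wD _ _ 2 0 _ isT Hu)%N (@L2_wD _ _ 0 2 _ isT Hu)%N
  (@L2_wD _ _ 1 1 _ isT Hu)%N.
Qed.

Lemma H2s_dot_le u : H2 l u -> H2s_dot l sigma u u <= 2 * sob_dot l u u.
Proof.
move=> Hu; rewrite (H2s_dotE Hu Hu).
have [_ /le_trans] := form_bounds hsigma (@L2_wD _ _ 2 0 _ isT Hu)%N (@L2_wD _ _ 0 2 _ isT Hu)%N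
  (@L2_wD _ _ 1 1 _ isT Hu)%N; apply.
have g i j (ij : (i + j <= 2)%N) := ip_ge0 ipO (L2_wD ij Hu).
have := g 0%N 0%N isT; have := g 1%N 0%N isT; have := g 0%N 1%N isT.
rewrite /sob_dot !big_cons big_nil/=.
have aux (a b c d e f : R) : 0 <= a -> 0 <= b -> 0 <= c ->
    2 * (d + e + f) <= 2 * (c + (b + (a + (d + (f + (e + 0)))))) by lra.
exact: aux.
Qed.

Lemma coercive : exists2 C, 0 <= C & forall u, H2s l u ->
  sob_dot l u u <= C * H2s_dot l sigma u u.
Proof.
(* The constant of [xint_bound] for the factor 2 of the boundary lemmas and the length of []0,
   pi[]. *)
pose k : R := (2 * (pi - 0)) ^+ 2; have k0 : 0 <= k by exact: sqr_ge0.
exists ((1 - sigma)^-1 * (1 + k + k + k * k)).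
  apply: mulr_ge0; last by rewrite !addr_ge0// mulr_ge0.
  by rewrite invr_ge0 ltW.
move=> u [Hu bu]; have jw := H2_jet Hu.
have L i j (ij : (i + j <= 2)%N) : L2 mO (wD l i j u) by exact: L2_wD.
have i00 := L2_mint (@L 0 0 isT)%N; have i10 := L2_mint (@L 1 0 isT)%N.
have i01 := L2_mint (@L 0 1 isT)%N; have i20 := L2_mint (@L 2 0 isT)%N.
have i11 := L2_mint (@L 1 1 isT)%N.
have x00 := jet_wx l0 jw (i := 0) (j := 0) isT; have x10 := jet_wx l0 jw (i := 1) (j := 0) isT.
have x01 := jet_wx l0 jw (i := 0) (j := 1) isT; have y00 := jet_wy l0 jw (i := 0) (j := 0) isT.
have y10 := jet_wy l0 jw (i := 1) (j := 0) isT.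
have ba y : - l < y < l -> reprw l (fun i j => wD l i j u) (0, y) = 0.
  move=> yl; rewrite -(crepE l0 (H2_L2 Hu) jw) ?(bu y yl).1//.
  by apply: (closure_OmegaP l0) => /=; move: yl pi0; lra.
have bb y : - l < y < l -> reprw l (fun i j => wD l i j u) (pi, y) = 0.
  move=> yl; rewrite -(crepE l0 (H2_L2 Hu) jw) ?(bu y yl).2//.
  by apply: (closure_OmegaP l0) => /=; move: yl pi0; lra.
have B0 := boundary_u pi0 ll i00 i10 i01 i11 x00 y00 y10 ba.
have B1 := boundary_w10 pi0 ll i00 i10 i01 i20 i11 x10 y00 y10 ba bb.
have B2 := boundary_w01 pi0 ll i01 i11 x01 ba.
have e0 := xint_bound pi0 (@L 0 0 isT)%N (@L 1 0 isT)%N B0.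
have e1 := xint_bound pi0 (@L 1 0 isT)%N (@L 2 0 isT)%N B1.
have e2 := xint_bound pi0 (@L 0 1 isT)%N (@L 1 1 isT)%N B2.
rewrite -/k in e0 e1 e2.
have g20 := ip_ge0 ipO (@L 2 0 isT)%N; have g02 := ip_ge0 ipO (@L 0 2 isT)%N.
have g11 := ip_ge0 ipO (@L 1 1 isT)%N; have h := H2s_dot_ge Hu.
rewrite /sob_dot !big_cons big_nil/=; exact: coercive_arith k0 s1 e0 e1 e2 h g20 g02 g11.
Qed.

Lemma H2s_lin k u v : H2s l u -> H2s l v -> H2s l (fun z => k * u z + v z).
Proof.
move=> [Hu bu] [Hv bv]; have [Huv _] := H2_lin l0 k Hu Hv; split => // y yl.
have [u1 u2] := bu y yl; have [v1 v2] := bv y yl.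
by rewrite !(crep_lin l0 k Hu Hv) ?u1 ?u2 ?v1 ?v2 ?mulr0 ?addr0//;
  apply: (closure_OmegaP l0) => /=; move: yl pi0; lra.
Qed.

Lemma H2s_semi_ip : semi_ip (H2s l) (H2s_dot l sigma).
Proof.
split.
- exact: H2s_lin.
- move=> k u v w /H2s_H2 Hu /H2s_H2 Hv /H2s_H2 Hw; have [Huv _] := H2_lin l0 k Hu Hv.
  have E i j i' j' h h' := @ip_wD_lin i j i' j' k u v w h h' Hu Hv Hw.
  have e1 := E 2%N 0%N 2%N 0%N isT isT; have e2 := E 0%N 2%N 0%N 2%N isT isT.
  have e3 := E 2%N 0%N 0%N 2%N isT isT; have e4 := E 0%N 2%N 2%N 0%N isT isT.
  have e5 := E 1%N 1%N 1%N 1%N isT isT.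
  have aux (t a1 a2 a3 a4 a5 b1 b2 b3 b4 b5 x1 x2 x3 x4 x5 F G H : R) :
      H = x1 + x2 + sigma * (x3 + x4) + t * x5 -> F = a1 + a2 + sigma * (a3 + a4) + t * a5 ->
      G = b1 + b2 + sigma * (b3 + b4) + t * b5 ->
      x1 = k * a1 + b1 -> x2 = k * a2 + b2 -> x3 = k * a3 + b3 -> x4 = k * a4 + b4 ->
      x5 = k * a5 + b5 -> H = k * F + G.
    by move=> -> -> -> -> -> -> -> ->; ring.
  exact: aux (H2s_dotE Huv Hw) (H2s_dotE Hu Hw) (H2s_dotE Hv Hw) e1 e2 e3 e4 e5.
- move=> u v _ _; apply: eq_Rintegral => z _.
  have aux (t a b c a' b' c' : R) :
      (a + b) * (a' + b') + t * (2 * c * c' - a * b' - b * a') =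
      (a' + b') * (a + b) + t * (2 * c' * c - a' * b - b' * a) by ring.
  exact: aux.
- move=> u /H2s_H2 Hu; apply: le_trans (H2s_dot_ge Hu); apply: mulr_ge0.
    exact: ltW.
  by rewrite !addr_ge0//; apply: (ip_ge0 ipO); exact: L2_wD.
Qed.

(** By [crep_bound], point values are continuous for the Sobolev norm, so zero boundary values
    persist in the limit. *)
Lemma H2s_closed : closed_ip (H2 l) (sob_dot l) (H2s l).
Proof.
move=> s u hs Hu su; split => // y yl.
have [C C0 hC] := crep_bound.
have key z : closure (Omega l) z -> (forall n, crep l (s n) z = 0) -> crep l u z = 0.
  move=> cz sz; apply/eqP; rewrite -sqrf_eq0 eq_le sqr_ge0 andbT.
  apply/ler_addgt0Pr => e e0; rewrite add0r.
  have d0 : 0 < e / (C + 1) by rewrite divr_gt0//; move: C0; lra.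
  have [N /(_ N (leqnn N)) hN] := su _ d0.
  have [Hs _] := hs N.
  have Hc := ip_comb (sob_ip l0) 1 (-1) Hs Hu.
  have := hC _ z Hc cz; rewrite combE.
  have [Hu' _] := H2_lin l0 (- 1 - 1) Hu Hu.
  rewrite !(crep_lin l0)// sz mulr0 add0r -combE.
  rewrite (_ : (- 1 - 1) * crep l u z + crep l u z = - crep l u z); last by ring.
  rewrite sqrrN => /le_trans; apply.
  move: hN; rewrite /sqdist ltr_pdivlMr; last by move: C0; lra.
  have := sob_ge0 Hc; move: (sob_dot l _ _) => D D0; move: C0; nra.
have hn n := (hs n).2 y yl.
split; apply: key => [|n]; do ?[by have [] := hn n];
  by apply: (closure_OmegaP l0) => /=; move: yl pi0; lra.
Qed.

(** Coercivity makes a Cauchy sequence for the form Cauchy in H^2; the upper bound on the form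
    brings the convergence back. *)
Lemma H2s_complete : complete_ip (H2s l) (H2s_dot l sigma).
Proof.
move=> s hs cs; have [C C0 hC] := coercive.
have Hs n : H2 l (s n) by exact: H2s_H2.
have [e e0|u Hu su] := sob_complete l0 Hs.
  have d0 : 0 < e / (C + 1) by rewrite divr_gt0//; move: C0; lra.
  have [N hN] := cs _ d0; exists N => m n Nm Nn.
  have Hc := ip_comb H2s_semi_ip 1 (-1) (hs m) (hs n).
  apply: le_lt_trans (hC _ Hc) _; have := hN m n Nm Nn; rewrite /sqdist.
  have := ip_ge0 H2s_semi_ip Hc; rewrite ltr_pdivlMr; last by move: C0; lra.
  by move: (H2s_dot _ _ _ _) => D D0; move: C0; nra.
have Hsu := H2s_closed hs Hu su; exists u => // e e0.
have [N hN] := su (e / 2) (divr_gt0 e0 (ltr0Sn _ 1)).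
exists N => n Nn; have := hN n Nn; rewrite /sqdist.
have := H2s_dot_le (ip_comb (sob_ip l0) 1 (-1) (Hs n) Hu).
by move: (H2s_dot _ _ _ _) (sob_dot _ _ _) => A B; lra.
Qed.

End plate_form.

(** * Products *)

Section ladyzhenskaya.
Context {R : realType}.
Local Notation mR := (measurableTypeR R).
Implicit Types (f g : R * R -> R).

Lemma ac1_add (a b : R) (f g f' g' : R -> R) : ac1 a b f g -> ac1 a b f' g' ->
  ac1 a b (fun x => f x + f' x) (fun x => g x + g' x).
Proof.
move=> [ig [k fE]] [ig' [k' fE']]; split; first exact: mintD.
exists (k + k'); apply: filterS2 fE fE' => s -> ->.
have -> : prim a b (fun x => g x + g' x) s = prim a b (fun x => 1 * g x + g' x) s.
  by congr prim; apply/funext => x; rewrite mul1r.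
by rewrite prim_lin//; ring.
Qed.

Lemma wdx_add (a b c d : R) f g f' g' : wdx a b c d f g -> wdx a b c d f' g' ->
  wdx a b c d (fun z => f z + f' z) (fun z => g z + g' z).
Proof. by apply: filterS2 => y; exact: ac1_add. Qed.

Lemma mrect_swp_ae_le a b c d f g : measurable_fun [set: mR * mR] f ->
  measurable_fun [set: mR * mR] g -> {ae mrect a b c d, forall z, f z <= g z} ->
  {ae mrect c d a b, forall z, f (swp z) <= g (swp z)}.
Proof.
move=> mf mg fg; have mm : measurable_fun [set: mR * mR] (fun z => Num.max (f z) (g z)).
  exact: measurable_maxr.
have : {ae mrect a b c d, forall z, Num.max (f z) (g z) = g z}.
  by apply: filterS fg => z /max_idPr.
move=> /(mrect_swp_ae_eq mm mg); apply: filterS => z <-.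
by rewrite le_max lexx.
Qed.

(** On a slice, [|f|] is at most its mean modulus plus the integral of [|g|]; squaring costs 2 and
    Cauchy-Schwarz gives [(b - a)^-1] and [b - a]. The bound [Q] depends on [y] only. *)
Lemma wdx_sq_bound (a b c d : R) f g : a < b -> L2 (mrect a b c d) f -> L2 (mrect a b c d) g ->
  wdx a b c d f g -> exists Q : R -> R, [/\ mint (mI c d) Q, forall y, 0 <= Q y,
    {ae mrect a b c d, forall z, f z ^+ 2 <= Q z.2} &
    \int[mI c d]_y Q y <= 2 * ((b - a)^-1 + (b - a)) *
      (ip2 (mrect a b c d) f f + ip2 (mrect a b c d) g g)].
Proof.
move=> ab Lf Lg fg; have iff := L2_mint_mul Lf Lf; have igg := L2_mint_mul Lg Lg.
have q0 : 0 < b - a by rewrite subr_gt0.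
have q1 : 0 < (b - a)^-1 by rewrite invr_gt0.
pose F y := \int[mI a b]_x (f (x, y) * f (x, y)).
pose G y := \int[mI a b]_x (g (x, y) * g (x, y)).
have iF : mint (mI c d) F by exact: rect_mint2 iff.
have iG : mint (mI c d) G by exact: rect_mint2 igg.
exists (fun y => 2 * (b - a)^-1 * F y + 2 * (b - a) * G y); split.
- by apply: mint_lin => //; exact: mintZ.
- have sq0 (h : R * R -> R) y : 0 <= \int[mI a b]_x (h (x, y) * h (x, y)).
    by apply: Rintegral_ge0 => x _; rewrite -expr2 sqr_ge0.
  by move=> y; rewrite addr_ge0// mulr_ge0 ?sq0// mulr_ge0// ltW.
- have sq h : L2 (mrect a b c d) h -> {ae mrect a b c d, forall z,
      (xint a b h z.2) ^+ 2 <= (b - a) * \int[mI a b]_x (h (x, z.2) * h (x, z.2))}.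
    move=> Lh; have hae : {ae mI c d, forall y,
        (xint a b h y) ^+ 2 <= (b - a) * \int[mI a b]_x (h (x, y) * h (x, y))}.
      apply: filterS (L2_sec2 Lh) => y Ly; apply: le_trans (sqr_L1_le Ly) _.
      by rewrite /ip2 -(mass_mI ab) /Rintegral /mass integral_cst//= mul1e.
    by apply/mrect_ae; exact: ae_snd hae.
  have k1 : {ae mrect a b c d, forall z, `|kap1 a b g z| <= xint a b g z.2}.
    have : {ae mrect a b c d, forall z, forall s, `|kap1 a b g (s, z.2)| <= xint a b g z.2}.
      by apply/mrect_ae; exact: ae_snd (kap1_xint ab (L2_mint Lg)).
    by apply: filterS => z /(_ z.1); rewrite -surjective_pairing.
  have k2 : {ae mrect a b c d, forall z, `|avg1 a b f z.2| <= (b - a)^-1 * xint a b f z.2}.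
    have h : {ae mI c d, forall y, `|avg1 a b f y| <= (b - a)^-1 * xint a b f y}.
      apply: filterS (rect_sec2 (L2_mint Lf)) => y iy.
      rewrite /avg1 normrM (ger0_norm (ltW q1)) ler_wpM2l ?(ltW q1)//.
      exact: le_normr_Rintegral.
    by apply/mrect_ae; exact: ae_snd h.
  have avg := wdx_avg ab (L2_measurable Lf) (L2_measurable Lg) fg.
  have k12 : {ae mrect a b c d, forall z,
      `|f z| <= (b - a)^-1 * xint a b f z.2 + xint a b g z.2}.
    apply: filterS3 avg k1 k2 => z -> h1 h2; apply: le_trans (ler_normD _ _) _.
    exact: lerD.
  apply: filterS3 k12 (sq f Lf) (sq g Lg) => z; rewrite -/(F z.2) -/(G z.2).
  move: (xint a b f z.2) (xint a b g z.2) (F z.2) (G z.2) (f z) => X Y A B e h hX hY.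
  have h1 : e ^+ 2 <= ((b - a)^-1 * X + Y) ^+ 2.
    rewrite -(real_normK (num_real e)) lerXn2r// ?nnegrE//.
    exact: le_trans (normr_ge0 _) h.
  have h2 : ((b - a)^-1 * X) ^+ 2 <= (b - a)^-1 * A.
    rewrite exprMn expr2 -mulrA ler_wpM2l ?(ltW q1)//.
    by rewrite mulrC ler_pdivrMr// mulrC.
  apply: le_trans h1 _; have := sqr_ge0 ((b - a)^-1 * X - Y).
  rewrite -!mulrA; move: ((b - a)^-1 * X) ((b - a)^-1 * A) ((b - a) * B) h2 hY => x a' b'.
  by nra.
rewrite Rint_lin//; last exact: mintZ.
rewrite RintegralZl// -(rect_Rint2 iff) -(rect_Rint2 igg).
have aux (A B s t : R) : 0 <= A -> 0 <= B -> 0 < s -> 0 < t ->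
    2 * t * A + 2 * s * B <= 2 * (t + s) * (A + B).
  move=> A0 B0 s0 t0; have := mulr_ge0 A0 (ltW s0); have := mulr_ge0 B0 (ltW t0); nra.
exact: aux (ip_ge0 (L2_ip _) Lf) (ip_ge0 (L2_ip _) Lg) q0 q1.
Qed.

(* f is controlled by a square integrable function of y
   alone and g by one of x alone. *)
Lemma ladyzhenskaya (a b c d : R) f fx g gy : a < b -> c < d ->
  L2 (mrect a b c d) f -> L2 (mrect a b c d) fx -> wdx a b c d f fx ->
  L2 (mrect a b c d) g -> L2 (mrect a b c d) gy ->
  wdx c d a b (fun z => g (swp z)) (fun z => gy (swp z)) ->
  L2 (mrect a b c d) (fun z => f z * g z) /\
  ip2 (mrect a b c d) (fun z => f z * g z) (fun z => f z * g z) <=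
    (2 * ((b - a)^-1 + (b - a))) * (2 * ((d - c)^-1 + (d - c))) *
    ((ip2 (mrect a b c d) f f + ip2 (mrect a b c d) fx fx) *
     (ip2 (mrect a b c d) g g + ip2 (mrect a b c d) gy gy)).
Proof.
move=> ab cd Lf Lfx hf Lg Lgy hg.
have [Q [iQ pQ fQ IQ]] := wdx_sq_bound ab Lf Lfx hf.
have [P [iP pP gP IP]] := wdx_sq_bound cd (mrect_swp_L2 Lg) (mrect_swp_L2 Lgy) hg.
have mg := L2_measurable Lg.
have gP' : {ae mrect a b c d, forall z, g z ^+ 2 <= P z.1}.
  have mP : measurable_fun [set: mR * mR] (fun z : R * R => P z.2).
    by apply: measurableT_comp; [exact: mint_measurable iP|exact: measurable_snd].
  have mg2 : measurable_fun [set: mR * mR] (fun z => g (swp z) ^+ 2).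
    by apply: measurable_funX; exact: measurable_swp.
  by apply: filterS (mrect_swp_ae_le mg2 mP gP) => -[x y].
have mfg : measurable_fun [set: mR * mR] (fun z => f z * g z).
  by apply: measurable_funM => //; exact: L2_measurable Lf.
have iPQ := rect_tensor iP iQ.
have hle : {ae mrect a b c d, forall z, (f z * g z) * (f z * g z) <= P z.1 * Q z.2}.
  apply: filterS2 fQ gP' => z h1 h2.
  by rewrite mulrACA -!expr2 mulrC ler_pM// sqr_ge0.
have Lfg : L2 (mrect a b c d) (fun z => f z * g z).
  apply/L2P; split => //; apply: mint_ae_le iPQ _; first exact: measurable_funX.
  by apply: filterS hle => z; rewrite ger0_norm ?sqr_ge0// expr2.
split => //; apply: le_trans (_ : _ <= \int[mrect a b c d]_z (P z.1 * Q z.2)) _.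
  by apply: Rint_ae_le => //; exact: L2_mint_mul.
have Egg h : L2 (mrect a b c d) h -> ip2 (mrect c d a b) (fun z => h (swp z)) (fun z => h (swp z)) =
    ip2 (mrect a b c d) h h.
  by move=> Lh; rewrite /ip2 (mrect_swp_Rint (L2_mint_mul Lh Lh)).
rewrite !Egg// in IP; rewrite (rect_Rint1 iPQ).
have -> : \int[mI a b]_x \int[mI c d]_y (P x * Q y) =
    \int[mI a b]_x P x * \int[mI c d]_y Q y.
  by rewrite -RintegralZr//; apply: eq_Rintegral => x _; rewrite RintegralZl.
have Q0 : 0 <= \int[mI c d]_y Q y by exact: Rintegral_ge0.
have P0 : 0 <= \int[mI a b]_x P x by exact: Rintegral_ge0.
by rewrite mulrC mulrACA; apply: ler_pM.
Qed.

End ladyzhenskaya.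

Section L2le.
Context d (T : measurableType d) (R : realType) (mu : {finite_measure set T -> \bar R}).
Implicit Types (f g : T -> R).

Definition L2le f (K : R) := L2 mu f /\ ip2 mu f f <= K.

Lemma L2le_add f g K : L2le f K -> L2le g K -> L2le (fun z => f z + g z) (4 * K).
Proof.
move=> [Lf fK] [Lg gK]; have I := L2_ip mu.
have E k : (fun z => f z + k * g z) = comb 1 k f g.
  by apply/funext => z; rewrite /comb mul1r.
have -> : (fun z => f z + g z) = comb 1 1 f g by apply/funext => z; rewrite /comb !mul1r.
split; first exact: (ip_comb I).
have := ip_ge0 I (ip_comb I 1 (-1) Lf Lg); rewrite !(ip_comb2 I)//; lra.
Qed.

Lemma L2le_mul_bounded (p f : T -> R) (M K : R) : measurable_fun [set: T] p -> 0 <= M ->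
  {ae mu, forall z, p z ^+ 2 <= M} -> L2le f K -> L2le (fun z => p z * f z) (M * K).
Proof.
move=> mp M0 pM [Lf fK].
have bp : {ae mu, forall z, `|p z| <= Num.sqrt M}.
  by apply: filterS pM => z h; rewrite -sqrtr_sqr ler_wsqrtr.
have Lpf := L2_mul_bounded mp bp Lf.
split => //; apply: le_trans (ler_wpM2l M0 fK).
have iff := L2_mint_mul Lf Lf.
rewrite /ip2 -RintegralZl//; apply: Rint_ae_le; [exact: L2_mint_mul|exact: mintZ|].
by apply: filterS pM => z h; rewrite mulrACA -!expr2 ler_wpM2r// sqr_ge0.
Qed.

Lemma L2le_ext f g K : (forall z, f z = g z) -> L2le f K -> L2le g K.
Proof. by move=> /funext ->. Qed.

Lemma L2le_le f K K' : K <= K' -> L2le f K -> L2le f K'.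
Proof. by move=> KK [Lf fK]; split => //; exact: le_trans KK. Qed.

End L2le.

Lemma lady_arith (F : realFieldType) (K M P V a b c d : F) : 0 <= K -> 4 * K <= M ->
  0 <= a -> 0 <= b -> 0 <= c -> 0 <= d -> a <= P -> b <= P -> c <= V -> d <= V ->
  K * ((a + b) * (c + d)) <= M * (P * V).
Proof.
move=> K0 KM a0 b0 c0 d0 aP bP cV dV.
have q : (a + b) * (c + d) <= (P + P) * (V + V).
  by apply: ler_pM; [exact: addr_ge0|exact: addr_ge0|exact: lerD|exact: lerD].
apply: le_trans (ler_wpM2l K0 q) _.
rewrite (_ : K * _ = 4 * K * (P * V)); last by ring.
by apply: ler_wpM2r => //; rewrite mulr_ge0// (le_trans a0 aP, le_trans c0 cV).
Qed.

Section product.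
Context {R : realType} (l : R).
Hypothesis l0 : 0 < l.
Local Notation mR := (measurableTypeR R).
Local Notation mO := (mrect 0 pi (- l) l).
Implicit Types (u v p : R * R -> R).

Let pi0 : (0 : R) < pi. Proof. exact: pi_gt0. Qed.
Let ll : - l < l. Proof. by move: l0; lra. Qed.

(** At order zero this is [u] itself rather than the a.e. equal [wD l 0 0 u], so the Leibniz
    formulas start from [p \* v] literally. *)
Definition jd u (i j : nat) := if (i + j == 0)%N then u else wD l i j u.

Lemma jet_jd u : H2 l u -> jet l u (jd u).
Proof.
move=> Hu; have jw := H2_jet Hu; split=> i j ij; rewrite /jd; case: ifPn => h.
- exact: H2_L2.
- exact: L2_wD.
- by move: h; rewrite addn_eq0 => /andP[/eqP -> /eqP ->]; exact: weak00.
- exact: (jet_weak jw).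
Qed.

Lemma jd_le u i j : (i + j <= 2)%N -> H2 l u -> L2le mO (jd u i j) (sob_dot l u u).
Proof.
move=> ij Hu; split; first exact: (jet_L2 (jet_jd Hu)).
apply: le_trans (sob_ge_ip2 ij Hu); rewrite le_eqVlt; apply/orP; left; apply/eqP.
have E : {ae mO, forall z, jd u i j z = wD l i j u z}.
  by apply: (weak_unique l0 (jet_L2 (jet_jd Hu) ij) (L2_wD ij Hu));
    [exact: (jet_weak (jet_jd Hu))|exact: (jet_weak (H2_jet Hu))].
by apply: ip2_ae_eq => //; do ?[exact: L2_wD|exact: (jet_L2 (jet_jd Hu) ij)].
Qed.

(** Leibniz rule term by term: an undifferentiated factor is bounded by the Sobolev embedding, and a
    product of two first derivatives is controlled by [ladyzhenskaya]. *)
Lemma product_H2 : exists2 C, 0 <= C & forall p v, H2 l p -> H2 l v ->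
  H2 l (p \* v) /\ sob_dot l (p \* v) (p \* v) <= C * (sob_dot l p p * sob_dot l v v).
Proof.
have le4 (x : R) : 0 <= x -> x <= 4 * x by move=> x0; lra.
have le24 (x : R) : 0 <= x -> 4 * x <= 4 * (4 * x) by move=> x0; lra.
have exM (x y : R) : 0 <= x -> 0 <= y -> exists2 M, 0 <= M & x <= M /\ 4 * y <= M.
  by move=> x0 y0; exists (x + 4 * y); lra.
have sum6 (x : R) : x + (x + (x + (x + (x + (x + 0))))) = 6 * x by ring.
have [C C0 hC] := crep_bound l0.
have [K K0 ladK] : exists2 K, 0 <= K & forall f fx g gy, L2 mO f -> L2 mO fx -> wx l f fx ->
    L2 mO g -> L2 mO gy -> wy l g gy -> L2 mO (fun z => f z * g z) /\
    ip2 mO (fun z => f z * g z) (fun z => f z * g z) <=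
      K * ((ip2 mO f f + ip2 mO fx fx) * (ip2 mO g g + ip2 mO gy gy)).
  eexists; last by move=> f fx g gy L1 L2' h1 L3 L4 h2; exact: ladyzhenskaya L1 L2' h1 L3 L4 h2.
  have h (x y : R) : x < y -> 0 <= 2 * ((y - x)^-1 + (y - x)).
    by move=> xy; rewrite mulr_ge0// addr_ge0 ?invr_ge0 ?subr_ge0 ?ltW.
  by rewrite mulr_ge0 ?h.
have [M M0 [CM KM]] := exM C K C0 K0.
(* Six derivatives, each a sum of at most four terms added in two rounds costing a factor 4 each;
   [M] dominates the bound of every single term. *)
exists (6 * (4 * (4 * M))); first by rewrite !mulr_ge0.
move=> p v Hp Hv.
suff h Sp Sv : 0 <= Sp -> 0 <= Sv -> sob_dot l p p <= Sp -> sob_dot l v v <= Sv ->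
    H2 l (p \* v) /\ sob_dot l (p \* v) (p \* v) <= 6 * (4 * (4 * (M * (Sp * Sv)))).
  have [Hpv] := h _ _ (sob_ge0 l0 Hp) (sob_ge0 l0 Hv) (lexx _) (lexx _).
  by rewrite !mulrA.
move=> Sp0 Sv0 SpE SvE.
have S0 : 0 <= Sp * Sv by exact: mulr_ge0.
have MS : 0 <= M * (Sp * Sv) by exact: mulr_ge0.
have leM : C * (Sp * Sv) <= M * (Sp * Sv) by exact: ler_wpM2r.
have S4 := le4 _ MS; have S44 := le24 _ MS.
have jp := jet_jd Hp; have jv := jet_jd Hv.
have bnd u : H2 l u -> {ae mO, forall z, u z ^+ 2 <= C * sob_dot l u u}.
  move=> Hu; have [_ e] := crepP l0 Hu.
  have zin := rect_in 0 pi (- l) l.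
  apply: filterS2 e zin => z <- [zx zy]; apply: hC => //.
  apply: (closure_OmegaP l0); [case/andP: zx => z1 z2|case/andP: zy => z1 z2];
  by rewrite !ltW.
have mf u : H2 l u -> measurable_fun [set: mR * mR] u.
  by move=> Hu; exact: L2_measurable (H2_L2 Hu).
have bp : {ae mO, forall z, p z ^+ 2 <= C * Sp}.
  apply: filterS (bnd p Hp) => z h; exact: le_trans h (ler_wpM2l C0 SpE).
have bv : {ae mO, forall z, v z ^+ 2 <= C * Sv}.
  apply: filterS (bnd v Hv) => z h; exact: le_trans h (ler_wpM2l C0 SvE).
have jple i j (ij : (i + j <= 2)%N) : L2le mO (jd p i j) Sp := L2le_le SpE (jd_le ij Hp).
have jvle i j (ij : (i + j <= 2)%N) : L2le mO (jd v i j) Sv := L2le_le SvE (jd_le ij Hv).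
have mulL i j : (i + j <= 2)%N -> L2le mO (fun z => p z * jd v i j z) (M * (Sp * Sv)).
  move=> ij; apply: (L2le_le leM); rewrite mulrA.
  exact: (L2le_mul_bounded (mf p Hp) (mulr_ge0 C0 Sp0) bp (jvle i j ij)).
have mulR i j : (i + j <= 2)%N -> L2le mO (fun z => jd p i j z * v z) (M * (Sp * Sv)).
  move=> ij; apply: (L2le_le leM); rewrite (mulrC Sp) mulrA.
  apply: (@L2le_ext _ _ _ mO (fun z => v z * jd p i j z)); first by move=> z; rewrite mulrC.
  exact: (L2le_mul_bounded (mf v Hv) (mulr_ge0 C0 Sv0) bv (jple i j ij)).
have lad i j i' j' : (i + j <= 1)%N -> (i' + j' <= 1)%N ->
    L2le mO (fun z => jd p i j z * jd v i' j' z) (M * (Sp * Sv)).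
  move=> ij ij'.
  have h1 : (i + j <= 2)%N by exact: leq_trans ij _.
  have h2 : (i' + j' <= 2)%N by exact: leq_trans ij' _.
  have h3 : (i.+1 + j <= 2)%N by rewrite addSn ltnS.
  have h4 : (i' + j'.+1 <= 2)%N by rewrite addnS ltnS.
  have [L1 B1] := jple _ _ h1; have [L3 B3] := jple _ _ h3.
  have [L2' B2] := jvle _ _ h2; have [L4 B4] := jvle _ _ h4.
  have [L5 B5] := ladK _ _ _ _ L1 L3 (jet_wx l0 jp ij) L2' L4 (jet_wy l0 jv ij').
  have P0 f (Lf : L2 mO f) := ip_ge0 (L2_ip mO) Lf.
  split => //; apply: le_trans B5 _.
  exact: lady_arith K0 KM (P0 _ L1) (P0 _ L3) (P0 _ L2') (P0 _ L4) B1 B3 B2 B4.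
(* Like terms are not collected: this is the shape in which [wdx_mul] and [wdx_add] deliver the
   derivatives. *)
pose w10 z := jd p 1 0 z * v z + p z * jd v 1 0 z.
pose w01 z := jd p 0 1 z * v z + p z * jd v 0 1 z.
pose w20 z := (jd p 2 0 z * v z + jd p 1 0 z * jd v 1 0 z) +
  (jd p 1 0 z * jd v 1 0 z + p z * jd v 2 0 z).
pose w11 z := (jd p 1 1 z * v z + jd p 1 0 z * jd v 0 1 z) +
  (jd p 0 1 z * jd v 1 0 z + p z * jd v 1 1 z).
pose w02 z := (jd p 0 2 z * v z + jd p 0 1 z * jd v 0 1 z) +
  (jd p 0 1 z * jd v 0 1 z + p z * jd v 0 2 z).
have b4 f : L2le mO f (4 * (M * (Sp * Sv))) -> L2le mO f (4 * (4 * (M * (Sp * Sv)))).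
  exact: L2le_le.
have n00 : L2le mO (p \* v) (4 * (4 * (M * (Sp * Sv)))).
  by apply: b4; exact: (L2le_le S4 (mulL 0 0 isT)%N).
have n10 : L2le mO w10 (4 * (4 * (M * (Sp * Sv)))).
  by apply: b4; exact: (L2le_add (mulR 1 0 isT)%N (mulL 1 0 isT)%N).
have n01 : L2le mO w01 (4 * (4 * (M * (Sp * Sv)))).
  by apply: b4; exact: (L2le_add (mulR 0 1 isT)%N (mulL 0 1 isT)%N).
have n20 : L2le mO w20 (4 * (4 * (M * (Sp * Sv)))).
  exact: (L2le_add (L2le_add (mulR 2 0 isT)%N (lad 1 0 1 0 isT isT)%N) (L2le_add (lad 1 0 1 0 isT isT)%N (mulL 2 0 isT)%N)).
have n11 : L2le mO w11 (4 * (4 * (M * (Sp * Sv)))).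
  exact: (L2le_add (L2le_add (mulR 1 1 isT)%N (lad 1 0 0 1 isT isT)%N) (L2le_add (lad 0 1 1 0 isT isT)%N (mulL 1 1 isT)%N)).
have n02 : L2le mO w02 (4 * (4 * (M * (Sp * Sv)))).
  exact: (L2le_add (L2le_add (mulR 0 2 isT)%N (lad 0 1 0 1 isT isT)%N) (L2le_add (lad 0 1 0 1 isT isT)%N (mulL 0 2 isT)%N)).
have mj u i j : (i + j <= 2)%N -> H2 l u -> measurable_fun [set: mR * mR] (jd u i j).
  by move=> ij Hu; exact: L2_measurable (jet_L2 (jet_jd Hu) ij).
have ms u i j : (i + j <= 2)%N -> H2 l u ->
    measurable_fun [set: mR * mR] (fun z => jd u i j (swp z)).
  by move=> ij Hu; apply: measurable_swp; exact: mj.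
have X u i j (ij : (i + j <= 1)%N) (Hu : H2 l u) := jet_wx l0 (jet_jd Hu) ij.
have Y u i j (ij : (i + j <= 1)%N) (Hu : H2 l u) := jet_wy l0 (jet_jd Hu) ij.
have x00 : wx l (p \* v) w10.
  exact: (wdx_mul (mj p 0 0 isT Hp)%N (mj v 0 0 isT Hv)%N (X p 0 0 isT Hp)%N (X v 0 0 isT Hv)%N).
have y00 : wy l (p \* v) w01.
  exact: (wdx_mul (ms p 0 0 isT Hp)%N (ms v 0 0 isT Hv)%N (Y p 0 0 isT Hp)%N (Y v 0 0 isT Hv)%N).
have x10 : wx l w10 w20.
  apply: wdx_add.
    exact: (wdx_mul (mj p 1 0 isT Hp)%N (mj v 0 0 isT Hv)%N (X p 1 0 isT Hp)%N (X v 0 0 isT Hv)%N).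
  exact: (wdx_mul (mj p 0 0 isT Hp)%N (mj v 1 0 isT Hv)%N (X p 0 0 isT Hp)%N (X v 1 0 isT Hv)%N).
have y10 : wy l w10 w11.
  apply: wdx_add.
    exact: (wdx_mul (ms p 1 0 isT Hp)%N (ms v 0 0 isT Hv)%N (Y p 1 0 isT Hp)%N (Y v 0 0 isT Hv)%N).
  exact: (wdx_mul (ms p 0 0 isT Hp)%N (ms v 1 0 isT Hv)%N (Y p 0 0 isT Hp)%N (Y v 1 0 isT Hv)%N).
have y01 : wy l w01 w02.
  apply: wdx_add.
    exact: (wdx_mul (ms p 0 1 isT Hp)%N (ms v 0 0 isT Hv)%N (Y p 0 1 isT Hp)%N (Y v 0 0 isT Hv)%N).
  exact: (wdx_mul (ms p 0 0 isT Hp)%N (ms v 0 1 isT Hv)%N (Y p 0 0 isT Hp)%N (Y v 0 1 isT Hv)%N).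
have jw := slices_jet l0 n00.1 n10.1 n01.1 n20.1 n11.1 n02.1 x00 y00 x10 y10 y01.
have [Hpv E] := jet_H2 l0 n00.1 jw; split => //.
rewrite /sob_dot big_seq.
apply: le_trans (_ : _ <= \sum_(k <- sob_idx) (4 * (4 * (M * (Sp * Sv))))) _; last first.
  by rewrite !big_cons big_nil sum6.
rewrite [leRHS]big_seq; apply: ler_sum => k hk; have kle := sob_idx_le hk.
have Lk := jet_L2 jw kle.
rewrite (ip2_ae_eq (L2_wD kle Hpv) Lk (L2_wD kle Hpv) Lk (E _ _ kle) (E _ _ kle)).
move: hk; rewrite !inE => /or4P[|||/or3P[]] /eqP->;
 [exact: n00.2|exact: n10.2|exact: n01.2|exact: n20.2|exact: n11.2|exact: n02.2].
Qed.

Lemma product_H2s p v : H2 l p -> H2s l v -> H2s l (p \* v).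
Proof.
move=> Hp [Hv bv]; have [C C0 hC] := product_H2; have [Hpv _] := hC p v Hp Hv.
split => // y yl; have [v1 v2] := bv y yl.
by rewrite !(crep_mul l0 Hp Hv Hpv) ?v1 ?v2 ?mulr0//;
  apply: (closure_OmegaP l0) => /=; move: yl pi0; lra.
Qed.

End product.

(** * Weights *)

Section reflection.
Context {R : realType}.
Local Notation mR := (measurableTypeR R).
Local Notation lam := (@lebesgue_measure R).

(** By uniqueness of Lebesgue measure it is enough to reflect half-open intervals, whose length does
    not depend on which end is closed. *)
Lemma lebesgue_oppr (A : set mR) : measurable A -> lam A = lam (-%R @^-1` A).
Proof.
move=> mA; have mopp : measurable_fun [set: mR] (-%R : mR -> mR) by exact: oppr_measurable.
pose mu := measure_function_pushforward__canonical__measure_function_Measure lam mopp.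
apply: (@lebesgue_measure_unique R mu) => // X; rewrite /mu/= /pushforward.
move=> /ocitvP[->|[[a b] /= ab ->]]; first by rewrite preimage_set0 !measure0.
rewrite (_ : -%R @^-1` _ = `[- b, - a[%classic); last first.
  by apply/seteqP; split => x; rewrite /= !in_itv/= => /andP[h1 h2]; apply/andP; split; lra.
rewrite !lebesgue_measure_itv/= !lte_fin ab ltrN2 ab -!EFinB.
by congr (_%:E); ring.
Qed.

Lemma mI_ae_oppr (l : R) (P : R -> Prop) : {ae mI (- l) l, forall y, P y} ->
  {ae mI (- l) l, forall y, P (- y)}.
Proof.
move=> /(restr_ae _ (measurable_oo (- l) l))[N [mN N0 PN]].
apply/(restr_ae _ (measurable_oo (- l) l)); exists (-%R @^-1` N); split.
- by rewrite -[X in measurable X]setTI; apply: oppr_measurable.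
- by rewrite -N0; exact/esym/lebesgue_oppr.
move=> y /= nP; apply: PN => /= h; apply: nP; rewrite in_itv/= => yl; apply: h.
by rewrite in_itv/=; move: yl; lra.
Qed.

End reflection.

Section Linfty.
Context {R : realType} (l : R).
Local Notation mR := (measurableTypeR R).
Local Notation mO := (mrect 0 pi (- l) l).
Implicit Types (p u : R * R -> R).

Lemma Linfty_dO p (M : R) : measurable_fun [set: mR * mR] p ->
  {ae mO, forall z, `|p z| <= M} -> p \in Lfun (dO l) +oo%E.
Proof.
move=> mp pM; rewrite dO_mrect inE; apply/andP; split; rewrite inE//=.
rewrite /finite_norm unlock; case: ifPn => // _.
apply: (@le_lt_trans _ _ M%:E); last exact: ltry.
by apply/ess_sup_inf.ess_supP; apply: filterS pM => z h /=; rewrite lee_fin.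
Qed.

Lemma Lfun_dO_measurable (q : \bar R) p : p \in Lfun (dO l) q -> measurable_fun [set: mR * mR] p.
Proof. by move=> /sub_Lfun_mfun; rewrite inE. Qed.

(** Omega has finite measure, so L^q embeds in L^1; forces enter the estimates as integrable
    functions. *)
Lemma Lfun_dO_mint (q : \bar R) p : (1 < q)%E -> p \in Lfun (dO l) q -> mint mO p.
Proof.
rewrite dO_mrect => q1 Lp; apply/Lfun1_integrable.
by apply: (Lfun_subset _ _ _ (ltW q1) Lp) => //; [exact: ltW|exact: fin_num_measure].
Qed.

Lemma areaE : area l = mass mO.
Proof. by rewrite /area dO_mrect. Qed.

Section weights.
Context (al be : R).
Hypothesis (al0 : 0 < al) (al1 : al < 1) (be1 : 1 < be).

Lemma weight_ae p : weight_Linfty l al be p ->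
  [/\ measurable_fun [set: mR * mR] p, {ae mO, forall z, al <= p z <= be},
    {ae mO, forall z, p z = p (z.1, - z.2)} & \int[mO]_z p z = area l].
Proof. by case=> mp; rewrite dO_mrect => h1 h2 h3; split => //; exact: Lfun_dO_measurable mp. Qed.

Lemma ae_weight p : measurable_fun [set: mR * mR] p -> {ae mO, forall z, al <= p z <= be} ->
  {ae mO, forall z, p z = p (z.1, - z.2)} -> \int[mO]_z p z = area l -> weight_Linfty l al be p.
Proof.
move=> mp h1 h2 h3; split; rewrite ?dO_mrect//.
rewrite -dO_mrect; apply: (@Linfty_dO _ be) => //.
by apply: filterS h1 => z /andP[a1 a2]; rewrite ger0_norm// (le_trans (ltW al0)).
Qed.

Lemma weight_norm p : weight_Linfty l al be p -> {ae mO, forall z, `|p z| <= be}.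
Proof.
move=> /weight_ae[_ h _ _]; apply: filterS h => z /andP[a1 a2].
by rewrite ger0_norm// (le_trans (ltW al0)).
Qed.

Lemma weight_L2 p : weight_Linfty l al be p -> L2 mO p /\ ip2 mO p p <= be ^+ 2 * mass mO.
Proof.
move=> Kp; have [mp _ _ _] := weight_ae Kp; have pb := weight_norm Kp.
have Lp : L2 mO p.
  have := L2_mul_bounded mp pb (L2_cst mO 1).
  by congr (L2 _ _); apply/funext => z; rewrite mulr1.
split => //; have -> : be ^+ 2 * mass mO = \int[mO]_z (be ^+ 2 : R).
  by rewrite Rintegral_cst.
apply: Rint_ae_le; [exact: L2_mint_mul|exact: mint_cst|].
apply: filterS pb => z h; rewrite -expr2 -(real_normK (num_real (p z))).
by rewrite lerXn2r// nnegrE// (le_trans (normr_ge0 _) h).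
Qed.

Lemma weight1 : weight_Linfty l al be (fun=> 1).
Proof.
apply: ae_weight => //; [by apply: aeW => z; rewrite !ltW|by apply: aeW|].
by rewrite Rintegral_cst// mul1r areaE.
Qed.

Lemma weight_mid p p' : weight_Linfty l al be p -> weight_Linfty l al be p' ->
  weight_Linfty l al be (midpt p p').
Proof.
move=> Kp Kp'; have [mp a1 s1 i1] := weight_ae Kp; have [mp' a2 s2 i2] := weight_ae Kp'.
have [Lp _] := weight_L2 Kp; have [Lp' _] := weight_L2 Kp'.
apply: ae_weight.
- by have /L2_measurable := ip_comb (L2_ip mO) 2^-1 2^-1 Lp Lp'.
- by apply: filterS2 a1 a2 => z; rewrite /midpt /comb; lra.
- by apply: filterS2 s1 s2 => z; rewrite /midpt /comb => <- <-.
have -> : \int[mO]_z midpt p p' z = \int[mO]_z (2^-1 * p z + 2^-1 * p' z) by [].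
rewrite Rint_lin; [|exact: L2_mint|apply: mintZ; exact: L2_mint].
by rewrite RintegralZl ?i1 ?i2//; [lra|exact: L2_mint].
Qed.

(* An L2-convergent sequence of weights has a subsequence converging a.e., along
   which all the constraints pass to the limit. *)
Lemma weight_limit s u : (forall n, weight_Linfty l al be (s n)) -> L2 mO u ->
  sqcvg (ip2 mO) s u -> weight_Linfty l al be u /\ exists g : nat -> nat,
    {ae mO, forall z, s (g n) z @[n --> \oo] --> u z}.
Proof.
move=> Ks Lu su; have Ls n : L2 mO (s n) by have [] := weight_L2 (Ks n).
have I := L2_ip mO.
have [f [Lf sf [g [_ gf]]]] := L2_complete_ae Ls (sqcvg_cauchy I Ls Lu su).
have fu : {ae mO, forall z, f z = u z}.
  have Lfu := ip_comb I 1 (-1) Lf Lu.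
  have := sqcvg_unique I Ls Lf Lu sf su; rewrite /sqdist.
  by move=> /(ip2_eq0 Lfu); apply: filterS => z; rewrite /comb => h; apply/eqP; rewrite -subr_eq0; apply/eqP; rewrite -h; ring.
have gu : {ae mO, forall z, s (g n) z @[n --> \oo] --> u z}.
  by apply: filterS2 gf fu => z h <-.
split; last by exists g.
have ae_all (P : nat -> R * R -> Prop) : (forall n, {ae mO, forall z, P n z}) ->
    {ae mO, forall z, forall n, P n z} by move=> h; exact: ae_foralln.
apply: ae_weight.
- exact: L2_measurable Lu.
- have h : {ae mO, forall z, forall n, al <= s (g n) z <= be}.
    by apply: ae_all => n; have [] := weight_ae (Ks (g n)).
  apply: filterS2 gu h => z zu zh; apply/andP; split.
    by apply: (cvgr_to_ge zu); near=> n; have /andP[] := zh n.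
  by apply: (cvgr_to_le zu); near=> n; have /andP[] := zh n.
- have h : {ae mO, forall z, forall n, s (g n) z = s (g n) (z.1, - z.2)}.
    by apply: ae_all => n; have [] := weight_ae (Ks (g n)).
  have mref : measurable_fun [set: mR * mR] (fun z => u (z.1, - z.2)).
    apply: (measurableT_comp (L2_measurable Lu)); apply: measurable_fun_pair => //.
    by apply: measurableT_comp => //; exact: oppr_measurable.
  (* Evenness at the limit uses convergence at both [y] and [- y], available for almost every [y] of
     almost every vertical slice, since reflection preserves null sets of the line. *)
  have h' := ae_sec1 ((mrect_ae _ _ _ _ _).1 h); have gu' := ae_sec1 ((mrect_ae _ _ _ _ _).1 gu).
  apply/mrect_ae; apply: ae_eq_prod1; [exact: L2_measurable Lu|exact: mref|].
  apply: filterS2 h' gu' => x hx gx.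
  apply: filterS3 hx gx (mI_ae_oppr gx) => y hy gy gy'.
  apply: cvg_unique gy _ => //=.
  by rewrite (_ : (fun n => _) = (fun n => s (g n) (x, - y)))//; apply/funext => n; exact: hy.
have := sqcvg_Rint Ls Lu (L2_cst mO 1) su.
have -> : (fun n => \int[mO]_z (s n z * 1)) = fun=> area l.
  apply/funext => n; have [_ _ _ <-] := weight_ae (Ks n).
  by apply: eq_Rintegral => z _; rewrite mulr1.
have -> : \int[mO]_z (u z * 1) = \int[mO]_z u z.
  by apply: eq_Rintegral => z _; rewrite mulr1.
by move=> h; apply: (cvg_unique _ h (cvg_cst _)).
Unshelve. all: by end_near.
Qed.

End weights.
End Linfty.

(** * Existence of optimal weights *)

Section norm_arith.
Context {R : realFieldType}.
Implicit Types (x y r e : R).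

Lemma norm_half_le x y r : `|x| <= r -> `|y| <= r -> `|2^-1 * x + 2^-1 * y| <= r.
Proof. by rewrite !ler_norml; lra. Qed.

Lemma norm_le_sqr x e : 0 <= e -> x ^+ 2 <= e ^+ 2 -> `|x| <= e.
Proof.
by move=> e0 h; rewrite -(ler_pXn2r (ltn0Sn 1)) ?nnegrE// real_normK ?num_real.
Qed.

Lemma norm_le_close x y r e : `|x| <= r -> `|x - y| <= e -> `|y| <= r + e.
Proof. by rewrite !ler_norml; lra. Qed.

Lemma midpoint_arith x y z r : x <= r -> y <= r -> 0 <= z -> (x + y) / 2 - z / 4 <= r.
Proof. lra. Qed.

Lemma limit_arith (C D b s e : R) : 0 <= C -> 0 <= D -> 0 <= b -> 0 <= s ->
  s < e ^+ 2 / (C * (D * b) + 1) -> C * (D * s * b) <= e ^+ 2.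
Proof.
move=> C0 D0 b0 s0; have k0 : 0 <= C * (D * b) by rewrite !mulr_ge0.
rewrite ltr_pdivlMr; last exact: ltr_wpDl.
by have -> : C * (D * s * b) = s * (C * (D * b) + 1) - s; [ring|lra].
Qed.

End norm_arith.

Section gap_theory.
Context {R : realType} (l sigma : R).
Hypotheses (l0 : 0 < l) (hsigma : 0 < sigma < 2^-1).
Local Notation mR := (measurableTypeR R).
Local Notation mO := (mrect 0 pi (- l) l).
Local Notation B := (H2s_dot l sigma).
Implicit Types (u v w p : R * R -> R) (T : (R * R -> R) -> R).

Let pi0 : (0 : R) < pi. Proof. exact: pi_gt0. Qed.
Let ll : - l < l. Proof. by move: l0; lra. Qed.
Let ipS := H2s_semi_ip l0 hsigma.

Lemma wdx_cst (a b c d k : R) : wdx a b c d (fun=> k) (fun=> 0).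
Proof.
apply: aeW => y; split; first exact: mint_cst.
exists k; apply: aeW => s; rewrite /prim; under eq_Rintegral do rewrite mulr0.
by rewrite Rintegral_cst// mul0r addr0.
Qed.

(** For [k = 1] it shows that the constant weight meets the H^2 constraint; for [k = 0] it puts zero
    in H^2_*. *)
Lemma H2_cst (k : R) : H2 l (fun=> k) /\ sob_dot l (fun=> k) (fun=> k) = k ^+ 2 * mass mO.
Proof.
have Lk := L2_cst mO k; have L0 := L2_cst mO 0.
have jw := slices_jet l0 Lk L0 L0 L0 L0 L0 (wdx_cst _ _ _ _ k) (wdx_cst _ _ _ _ k)
  (wdx_cst _ _ _ _ 0) (wdx_cst _ _ _ _ 0) (wdx_cst _ _ _ _ 0).
have [Hk E] := jet_H2 l0 Lk jw; split => //.
have E' i j (ij : (i + j <= 2)%N) := ip2_ae_eq (L2_wD ij Hk) (jet_L2 jw ij)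
  (L2_wD ij Hk) (jet_L2 jw ij) (E _ _ ij) (E _ _ ij).
have z0 : ip2 mO (fun=> 0) (fun=> 0) = 0.
  by rewrite /ip2; under eq_Rintegral do rewrite mulr0; rewrite Rintegral_cst// mul0r.
have zk : ip2 mO (fun=> k) (fun=> k) = k ^+ 2 * mass mO by rewrite /ip2 Rintegral_cst.
have aux (x a b c d e : R) : a = 0 -> b = 0 -> c = 0 -> d = 0 -> e = 0 ->
  x + (a + (b + (c + (d + (e + 0))))) = x by move=> -> -> -> -> ->; rewrite !addr0.
rewrite /sob_dot !big_cons big_nil/= (E' 0 0 isT)%N zk; apply: aux; rewrite -[RHS]z0.
- exact: (E' 1 0 isT)%N.
- exact: (E' 0 1 isT)%N.
- exact: (E' 2 0 isT)%N.
- exact: (E' 1 1 isT)%N.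
- exact: (E' 0 2 isT)%N.
Qed.

Lemma H2s_0 : H2s l (fun=> 0).
Proof.
have [H0 _] := H2_cst 0; split => // y yl.
have c0 z : closure (Omega l) z -> crep l (fun=> 0) z = 0.
  move=> cz; apply: (@crep_unique _ _ l0 _ (fun=> 0) H0) => //; last exact: aeW.
  by move=> ?; exact: cvg_cst.
by split; apply: c0; apply: (closure_OmegaP l0) => /=; move: yl pi0; lra.
Qed.

Definition bounded_linear T :=
  (forall a u v, H2s l u -> H2s l v -> T (fun z => a * u z + v z) = a * T u + T v) /\
  exists2 C : R, 0 <= C & forall v, H2s l v -> T v ^+ 2 <= C * B v v.

Lemma H2s_riesz T : bounded_linear T ->
  exists2 u, H2s l u & forall v, H2s l v -> B u v = T v.
Proof.
move=> [linT [C C0 bT]]; apply: (riesz ipS (H2s_complete l0 hsigma) _ linT bT C0).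
by exists (fun=> 0); exact: H2s_0.
Qed.

Lemma weak_solP T : bounded_linear T -> H2s l (weak_sol l sigma T) /\
  forall v, H2s l v -> B (weak_sol l sigma T) v = T v.
Proof.
move=> /H2s_riesz[u Hu hu].
by apply: (@xgetPex _ (cst 0) [set u | H2s l u /\ forall v, H2s l v -> B u v = T v]); exists u.
Qed.

Lemma H2s_crep_bound : exists2 C, 0 <= C & forall u z, H2s l u -> closure (Omega l) z ->
  crep l u z ^+ 2 <= C * B u u.
Proof.
have [C C0 hC] := crep_bound l0; have [D D0 hD] := coercive l0 hsigma.
exists (C * D); first exact: mulr_ge0.
move=> u z Hu cz; apply: le_trans (hC u z Hu.1 cz) _.
by rewrite -mulrA ler_wpM2l// hD.
Qed.

(* The gap at x is a bounded functional; w x is its Riesz representative, and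
   symmetry of the form turns gap(u) = (w x, u) into the load tested on w x. *)
Lemma gap_riesz : exists w : R -> R * R -> R, forall x, 0 < x < pi ->
  H2s l (w x) /\ forall T, bounded_linear T -> gap l sigma T x = T (w x).
Proof.
have [C C0 hC] := H2s_crep_bound.
have cl (x : R) : 0 < x < pi -> closure (Omega l) (x, l) /\ closure (Omega l) (x, - l).
  by move=> xp; split; apply: (closure_OmegaP l0) => /=; move: xp l0; lra.
have ex (x : R) : exists w, 0 < x < pi -> H2s l w /\
    forall v, H2s l v -> B w v = crep l v (x, l) - crep l v (x, - l).
  case: (boolP (0 < x < pi)) => xp; last by exists (fun=> 0).
  have [c1 c2] := cl x xp.
  have [|w Hw hw] := @H2s_riesz (fun v => crep l v (x, l) - crep l v (x, - l)).
    split; first by move=> a u v [Hu _] [Hv _]; rewrite !(crep_lin l0 a Hu Hv)//; ring.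
    exists (4 * C); first by rewrite mulr_ge0.
    move=> v Hv; have := hC v _ Hv c1; have := hC v _ Hv c2.
    have aux (a b t : R) : b ^+ 2 <= C * t -> a ^+ 2 <= C * t -> (a - b) ^+ 2 <= 4 * C * t.
      by move=> h1 h2; have := sqr_ge0 (a + b); nra.
    exact: aux.
  by exists w.
have [w hw] := choice ex; exists w => x xp; have [Hw wE] := hw x xp.
split => // T bT; have [Hu uE] := weak_solP bT.
by rewrite /gap -(uE _ Hw) -(wE _ Hu); exact: (ip_sym ipS).
Qed.

Lemma H2s_ae_bound : exists2 C, 0 <= C & forall v, H2s l v ->
  {ae mO, forall z, `|v z| <= Num.sqrt (C * B v v)}.
Proof.
have [C C0 hC] := H2s_crep_bound; exists C => // v Hv; have [Hv' _] := Hv.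
have [_ e] := crepP l0 Hv'; have zin := rect_in 0 pi (- l) l.
apply: filterS2 e zin => z <- [zx zy]; rewrite -sqrtr_sqr ler_wsqrtr//; apply: hC => //.
apply: (closure_OmegaP l0); [case/andP: zx => z1 z2|case/andP: zy => z1 z2];
by rewrite !ltW.
Qed.

(** Reduces a bound on a maximum to inequalities on [T (w x)], linear in [T], so convexity and
    closedness can be checked for each [x] separately. *)
Lemma gap_max_leP (w : R -> R * R -> R) T (r : R) :
  (forall x, 0 < x < pi -> gap l sigma T x = T (w x)) ->
  (gap_max l sigma T <= r%:E)%E <-> forall x, 0 < x < pi -> `|T (w x)| <= r.
Proof.
move=> gT; split=> [h x xp|h].
  rewrite -gT// -lee_fin; apply: le_trans h; apply: ereal_sup_ubound.
  by exists x => //=; rewrite in_itv.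
apply: ge_ereal_sup => _ [x + <-]; rewrite /= in_itv/= => xp.
by rewrite lee_fin gT//; exact: h.
Qed.

Lemma gap_max_ge0 T : (0 <= gap_max l sigma T)%E.
Proof.
apply: le_trans (_ : `|gap l sigma T (pi / 2)|%:E <= _)%E; first by rewrite lee_fin.
apply: ereal_sup_ubound; exists (pi / 2) => //=; rewrite in_itv/=.
by move: pi0; lra.
Qed.

Section Lq.
Context (al be : R) (q : \bar R).
Hypothesis (al0 : 0 < al) (al1 : al < 1) (be1 : 1 < be) (q1 : (1 < q)%E).

(** The dominating function is the same for all admissible [p], as needed for dominated convergence
    along a sequence of weights. *)
Lemma mint_load p f v (M : R) : mint mO f -> weight_Linfty l al be p ->
  measurable_fun [set: mR * mR] v -> {ae mO, forall z, `|v z| <= M} ->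
  mint mO (fun z => p z * f z * v z) /\
  {ae mO, forall z, `|p z * f z * v z| <= be * M * `|f z|}.
Proof.
move=> mf Kp mv vM; have [mp _ _ _] := weight_ae Kp.
have mpfv : measurable_fun [set: mR * mR] (fun z => p z * f z * v z).
  by apply: measurable_funM => //; apply: measurable_funM => //; exact: mint_measurable mf.
have h : {ae mO, forall z, `|p z * f z * v z| <= be * M * `|f z|}.
  apply: filterS2 (weight_norm al0 Kp) vM => z h1 h2.
  by rewrite !normrM mulrAC ler_wpM2r// ler_pM.
by split => //; apply: mint_ae_le (mintZ _ (mint_norm mf)) h.
Qed.

Lemma load_Lq_bounded_linear p f : f \in Lfun (dO l) q -> weight_Linfty l al be p ->
  bounded_linear (load_Lq l p f).
Proof.
move=> Lf Kp; have mf := Lfun_dO_mint q1 Lf; have [C C0 hC] := H2s_ae_bound.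
have mv v : H2s l v -> measurable_fun [set: mR * mR] v.
  by move=> [Hv _]; exact: L2_measurable (H2_L2 Hv).
have iL v (Hv : H2s l v) := mint_load mf Kp (mv v Hv) (hC v Hv).
split.
  move=> a u v Hu Hv; rewrite /load_Lq !dO_Rint -Rint_lin; [|exact: (iL u Hu).1|exact: (iL v Hv).1].
  by apply: eq_Rintegral => z _; ring.
have b0 : 0 <= be by move: be1; lra.
exists ((be * \int[mO]_z `|f z|) ^+ 2 * C); first by rewrite mulr_ge0// sqr_ge0.
move=> v Hv; have [i h] := iL v Hv; have B0 := ip_ge0 ipS Hv.
have I0 : 0 <= \int[mO]_z `|f z| by apply: Rintegral_ge0.
have k1 : `|load_Lq l p f v| <= be * Num.sqrt (C * B v v) * \int[mO]_z `|f z|.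
  apply: le_trans (le_normr_Rintegral _ i) _ => //.
  rewrite -RintegralZl//; last exact: mint_norm.
  by apply: Rint_ae_le => //; [exact: mint_norm|apply: mintZ; exact: mint_norm].
rewrite -(real_normK (num_real _)).
apply: (@le_trans _ _ ((be * Num.sqrt (C * B v v) * \int[mO]_z `|f z|) ^+ 2)).
  by rewrite lerXn2r// nnegrE !mulr_ge0// sqrtr_ge0.
rewrite !exprMn sqr_sqrtr ?mulr_ge0//.
have aux (x y t : R) : x * (C * t) * y <= x * y * C * t.
  by rewrite le_eqVlt; apply/orP; left; apply/eqP; ring.
exact: aux.
Qed.

Lemma min_worst_gap_Lq : exists2 p, weight_Linfty l al be p & forall p',
  weight_Linfty l al be p' -> (worst_gap_Lq l sigma q p <= worst_gap_Lq l sigma q p')%E.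
Proof.
have [w hw] := gap_riesz; have [C C0 hC] := H2s_ae_bound.
have K1 := weight1 l al0 al1 be1.
(* Without forces the supremum is that of the empty set, the same for every weight; with one force,
   the worst gap is nonnegative, as [min_exists] asks. *)
have [[f0 Ff0]|nof] := pselect (exists f, force_Lq l q f); last first.
  exists (fun=> 1); first exact: K1.
  move=> p' _; apply: ge_ereal_sup => y [f Ff] _.
  by exfalso; apply: nof; exists f.
have gle p (r : R) : weight_Linfty l al be p -> (worst_gap_Lq l sigma q p <= r%:E)%E <->
    forall f x, force_Lq l q f -> 0 < x < pi -> `|load_Lq l p f (w x)| <= r.
  move=> Kp.
  have gp f (Ff : force_Lq l q f) := @gap_max_leP w (load_Lq l p f) r
    (fun x xp => (hw x xp).2 _ (load_Lq_bounded_linear Ff.1 Kp)).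
  split=> [h f x Ff xp|h].
    apply: ((gp f Ff).1 _ x xp); apply: le_trans h; apply: ereal_sup_ubound.
    by exists f.
  apply: ge_ereal_sup => _ [f Ff <-]; apply/(gp f Ff) => x xp; exact: h.
have iL p f x : force_Lq l q f -> 0 < x < pi -> weight_Linfty l al be p ->
    mint mO (fun z => p z * f z * w x z) /\
    {ae mO, forall z, `|p z * f z * w x z| <= be * Num.sqrt (C * B (w x) (w x)) * `|f z|}.
  move=> Ff xp Kp; have [Hw _] := hw x xp.
  apply: mint_load (Lfun_dO_mint q1 Ff.1) Kp _ (hC _ Hw).
  exact: L2_measurable (H2_L2 Hw.1).
apply: (min_exists (L2_ip mO) (K := weight_Linfty l al be)).
- exact: L2_complete.
- by move=> p Kp; have [] := weight_L2 al0 Kp.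
- by exists (fun=> 1).
- move=> p _; apply: le_trans (gap_max_ge0 (load_Lq l p f0)) _.
  by apply: ereal_sup_ubound; exists f0.
- move=> r p p' Kp Kp' /(gle p r Kp) h /(gle p' r Kp') h'.
  have Km := weight_mid al0 Kp Kp'; split => //; apply/(gle _ r Km) => f x Ff xp.
  have -> : load_Lq l (midpt p p') f (w x) =
      2^-1 * load_Lq l p f (w x) + 2^-1 * load_Lq l p' f (w x).
    have [i _] := iL p f x Ff xp Kp; have [i' _] := iL p' f x Ff xp Kp'.
    rewrite /load_Lq !dO_Rint -(RintegralZl _ _ i')// -Rint_lin//; last exact: mintZ.
    by apply: eq_Rintegral => z _; rewrite /midpt /comb; ring.
  exact: norm_half_le (h f x Ff xp) (h' f x Ff xp).
- move=> r s u hs Lu su; have Ks n : weight_Linfty l al be (s n) by have [] := hs n.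
  have [Ku [g gu]] := weight_limit al0 Ks Lu su; split => //.
  apply/(gle _ r Ku) => f x Ff xp; have mf := Lfun_dO_mint q1 Ff.1.
  have lim : load_Lq l (s (g n)) f (w x) @[n --> \oo] --> load_Lq l u f (w x).
    apply: (@Rint_cvg _ _ _ mO (fun n z => s (g n) z * f z * w x z)
      (fun z => u z * f z * w x z) (fun z => be * Num.sqrt (C * B (w x) (w x)) * `|f z|)).
    + by move=> n; apply: mint_measurable; exact: (iL _ f x Ff xp (Ks (g n))).1.
    + by apply: mint_measurable; exact: (iL _ f x Ff xp Ku).1.
    + apply: filterS gu => z zu; apply: cvgM; last exact: cvg_cst.
      by apply: cvgM => //; exact: cvg_cst.
    + by apply: mintZ; exact: mint_norm.
    + by move=> n; exact: (iL _ f x Ff xp (Ks (g n))).2.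
  have nlim : `|load_Lq l (s (g n)) f (w x)| @[n --> \oo] --> `|load_Lq l u f (w x)|.
    exact: cvg_norm lim.
  apply: (cvgr_to_le nlim); near=> n.
  by have [_ /(gle _ r (Ks (g n)))] := hs (g n); apply.
(* The weights themselves form a bounded set of L2, so the bound holds at every level [r]. *)
- by move=> r; exists (be ^+ 2 * mass mO) => p Kp _; have [] := weight_L2 al0 Kp.
Unshelve. all: by end_near.
Qed.

End Lq.

Section Hm2.
Context (al be kappa : R).
Hypothesis (al0 : 0 < al) (al1 : al < 1) (be1 : 1 < be) (k1 : 1 < kappa).

(** [product_H2] carried to the norm of the form: the 2 is the upper bound on the form, [D] the
    coercivity constant. *)
Lemma H2s_prod_bound : exists2 C, 0 <= C & forall p v, H2 l p -> H2s l v ->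
  H2s l (p \* v) /\ B (p \* v) (p \* v) <= C * sob_dot l p p * B v v.
Proof.
have [C C0 hC] := product_H2 l0; have [D D0 hD] := coercive l0 hsigma.
exists (2 * C * D); first by rewrite !mulr_ge0.
move=> p v Hp Hv; have Hpv := product_H2s l0 Hp Hv; split => //.
have [_ h1] := hC p v Hp Hv.1; have h2 := hD v Hv; have h3 := H2s_dot_le hsigma Hpv.1.
have p0 := sob_ge0 l0 Hp.
have aux (a b c d e : R) : 0 <= c -> a <= 2 * b -> b <= C * (c * d) -> d <= D * e ->
    a <= 2 * C * D * c * e.
  move=> c0 a1 a2 a3; apply: le_trans a1 _; rewrite -!mulrA ler_wpM2l//.
  apply: le_trans a2 _; rewrite ler_wpM2l// [leRHS]mulrCA ler_wpM2l//.
exact: aux p0 h3 h1 h2.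
Qed.

Lemma Hm2s_bound f : Hm2s l sigma f -> exists2 C, 0 <= C & forall v, H2s l v ->
  f v ^+ 2 <= C * B v v.
Proof.
move=> [_ [C hC]]; exists (C ^+ 2); first exact: sqr_ge0.
move=> v Hv; have := hC v Hv; rewrite /H2s_norm => h.
have B0 := ip_ge0 ipS Hv.
rewrite -(real_normK (num_real _)) -[B v v in leRHS]sqr_sqrtr// -exprMn.
by rewrite lerXn2r// nnegrE// (le_trans (normr_ge0 _) h).
Qed.

Lemma load_Hm2s_bounded_linear p f : H2 l p -> Hm2s l sigma f -> bounded_linear (load_Hm2s p f).
Proof.
move=> Hp Ff; have [D D0 hD] := H2s_prod_bound; have [C C0 hC] := Hm2s_bound Ff.
split.
  move=> a u v Hu Hv; have [Hpu _] := hD p u Hp Hu; have [Hpv _] := hD p v Hp Hv.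
  rewrite /load_Hm2s -(Ff.1 a _ _ Hpu Hpv); congr f; apply/funext => z /=; ring.
exists (C * (D * sob_dot l p p)); first by rewrite !mulr_ge0// (sob_ge0 l0 Hp).
move=> v Hv; have [Hpv h] := hD p v Hp Hv.
by apply: le_trans (hC _ Hpv) _; rewrite -mulrA; apply: ler_wpM2l.
Qed.

Lemma H2_norm_le p : H2 l p -> (H2_norm l p <= kappa * Num.sqrt (area l)) =
  (sob_dot l p p <= kappa ^+ 2 * mass mO).
Proof.
move=> Hp; rewrite H2_normE areaE; have k0 : 0 <= kappa by move: k1; lra.
have -> : kappa * Num.sqrt (mass mO) = Num.sqrt (kappa ^+ 2 * mass mO).
  by rewrite sqrtrM ?sqr_ge0// sqrtr_sqr ger0_norm.
by rewrite ler_sqrt// mulr_ge0 ?sqr_ge0 ?mass_ge0.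
Qed.

(** For fixed [f] and [x] the pairing is Lipschitz in [p] for the H^2 norm, by [H2s_prod_bound], so
    a sublevel set is closed without passing to a subsequence in the pairing. *)
Lemma min_worst_gap_Hm2s : exists2 p, weight_H2 l al be kappa p & forall p',
  weight_H2 l al be kappa p' ->
  (worst_gap_Hm2s l sigma p <= worst_gap_Hm2s l sigma p')%E.
Proof.
have [w hw] := gap_riesz; have [D D0 hD] := H2s_prod_bound.
pose Q := kappa ^+ 2 * mass mO.
have KE p : weight_H2 l al be kappa p <-> [/\ H2 l p, weight_Linfty l al be p & sob_dot l p p <= Q].
  by split=> -[Hp Kp]; [rewrite (H2_norm_le Hp)|rewrite -(H2_norm_le Hp)]; split.
have K1 : weight_H2 l al be kappa (fun=> 1).
  have [H1 E1] := H2_cst 1; apply/KE; split => //; first exact: weight1.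
  rewrite E1 expr1n mul1r /Q ler_peMl ?mass_ge0//.
  by rewrite expr_ge1//; move: k1; lra.
have [[f0 Ff0]|nof] := pselect (exists f, force_Hm2s l sigma f); last first.
  exists (fun=> 1); first exact: K1.
  move=> p' _; apply: ge_ereal_sup => y [f Ff] _.
  by exfalso; apply: nof; exists f.
have gle p (r : R) : H2 l p -> (worst_gap_Hm2s l sigma p <= r%:E)%E <->
    forall f x, force_Hm2s l sigma f -> 0 < x < pi -> `|load_Hm2s p f (w x)| <= r.
  move=> Hp.
  have gp f (Ff : force_Hm2s l sigma f) := @gap_max_leP w (load_Hm2s p f) r
    (fun x xp => (hw x xp).2 _ (load_Hm2s_bounded_linear Hp Ff.1)).
  split=> [h f x Ff xp|h].
    apply: ((gp f Ff).1 _ x xp); apply: le_trans h; apply: ereal_sup_ubound.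
    by exists f.
  apply: ge_ereal_sup => _ [f Ff <-]; apply/(gp f Ff) => x xp; exact: h.
have loadC a b p p' f x : H2 l p -> H2 l p' -> force_Hm2s l sigma f -> 0 < x < pi ->
    load_Hm2s (comb a b p p') f (w x) = a * load_Hm2s p f (w x) + b * load_Hm2s p' f (w x).
  move=> Hp Hp' Ff xp; have [Hw _] := hw x xp; have [[linf _] _] := Ff.
  have [H1 _] := hD _ _ Hp Hw; have [H2' _] := hD _ _ Hp' Hw.
  rewrite /load_Hm2s; have -> : comb a b p p' \* w x =
      (fun z => a * (p \* w x) z + (fun z => (b - 1) * (p' \* w x) z + (p' \* w x) z) z).
    by apply/funext => z; rewrite /comb/=; ring.
  by rewrite linf//; [rewrite linf//; ring|exact: (ip_lc ipS)].
have I := sob_ip l0.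
apply: (min_exists I (K := weight_H2 l al be kappa)).
- exact: sob_complete.
- by move=> p /KE[].
- by exists (fun=> 1).
- move=> p _; apply: le_trans (gap_max_ge0 (load_Hm2s p f0)) _.
  by apply: ereal_sup_ubound; exists f0.
- move=> r p p' /KE[Hp Kp bp] /KE[Hp' Kp' bp'] /(gle p r Hp) h /(gle p' r Hp') h'.
  have Hm := ip_comb I 2^-1 2^-1 Hp Hp'; split.
    apply/KE; split; [exact: Hm|exact: (weight_mid al0 Kp Kp')|].
    rewrite (ip_midpt I Hp Hp'); exact: midpoint_arith bp bp' (sqdist_ge0 I Hp Hp').
  apply/(gle _ r Hm) => f x Ff xp; rewrite (loadC _ _ _ _ _ _ Hp Hp' Ff xp).
  exact: norm_half_le (h f x Ff xp) (h' f x Ff xp).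
- move=> r s u hs Hu su; have Ks n : weight_H2 l al be kappa (s n) by have [] := hs n.
  have Hs n : H2 l (s n) by have /KE[] := Ks n.
  have Ku : weight_H2 l al be kappa u.
    have uQ : sob_dot l u u <= Q.
      by apply: (sqcvg_bound I Hs Hu su) => n; have /KE[] := Ks n.
    apply/KE; split; [exact: Hu| |exact: uQ].
    have KLs n : weight_Linfty l al be (s n) by have /KE[] := Ks n.
    (* The Sobolev form dominates the squared L2 norm of the function itself, so H^2 convergence
       gives the L2 convergence that transmits the pointwise constraints. *)
    have [] // := weight_limit al0 KLs (H2_L2 Hu) _.
    move=> e e0; have [N hN] := su e e0; exists N => n Nn; apply: le_lt_trans (hN n Nn).
    have Hc := ip_comb I 1 (-1) (Hs n) Hu.
    have [_] := @jd_le _ _ l0 _ 0 0 isT Hc; exact.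
  split => //; apply/(gle _ r Hu) => f x Ff xp; have [Hw _] := hw x xp.
  have [C C0 hC] := Hm2s_bound Ff.1; have Bw := ip_ge0 ipS Hw.
  apply/ler_addgt0Pr => e e0.
  (* A squared distance below this value keeps the two pairings within [e]; the [+ 1] covers the
     case where the product of constants is 0. *)
  have d0 : 0 < e ^+ 2 / (C * (D * B (w x) (w x)) + 1).
    by rewrite divr_gt0 ?exprn_gt0// ltr_wpDl// !mulr_ge0.
  have [N /(_ N (leqnn N)) hN] := su _ d0.
  have Hc := ip_comb I 1 (-1) (Hs N) Hu; have [Hcw cw] := hD _ _ Hc Hw.
  have le1 : `|load_Hm2s (s N) f (w x) - load_Hm2s u f (w x)| <= e.
    have -> : load_Hm2s (s N) f (w x) - load_Hm2s u f (w x) =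
        load_Hm2s (comb 1 (-1) (s N) u) f (w x) by rewrite (loadC _ _ _ _ _ _ (Hs N) Hu Ff xp) mul1r mulN1r.
    apply: (norm_le_sqr (ltW e0)).
    apply: le_trans (hC _ Hcw) _; apply: le_trans (ler_wpM2l C0 cw) _.
    exact: limit_arith C0 D0 Bw (ip_ge0 I Hc) hN.
  have h2 : `|load_Hm2s (s N) f (w x)| <= r.
    by have [_ /(gle _ r (Hs N))] := hs N; apply.
  exact: norm_le_close h2 le1.
- by move=> r; exists Q => p /KE[].
Qed.

End Hm2.
End gap_theory.

Theorem theorem3p2 (R : realType) (l sigma alpha beta : R)
  (hl : 0 < l) (hsigma : 0 < sigma < 2^-1)
  (halpha : 0 < alpha < 1) (hbeta : 1 < beta) :
  (forall q : \bar R, (1 < q)%E ->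
     exists2 p, weight_Linfty l alpha beta p &
       forall p', weight_Linfty l alpha beta p' ->
         (worst_gap_Lq l sigma q p <= worst_gap_Lq l sigma q p')%E) /\
  (forall kappa : R, 1 < kappa ->
     exists2 p, weight_H2 l alpha beta kappa p &
       forall p', weight_H2 l alpha beta kappa p' ->
         (worst_gap_Hm2s l sigma p <= worst_gap_Hm2s l sigma p')%E).
Proof.
case/andP: halpha => a0 a1; split=> [q q1|kappa k1]; first exact: min_worst_gap_Lq.
exact: min_worst_gap_Hm2s.
Qed.
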